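(* Let $\mathbb{H}_+=\{\zeta\in\mathbb{C}:\operatorname{Im}\zeta>0\}$. Let $0<r<1$, let $\Gamma=\{\zeta:|\zeta-i|=r\}$ be the circle centered at $i$ of radius $r$, and let $z\in\mathbb{H}_+$ be a point outside of $\Gamma$, i.e. $|z-i|>r$. Put $$z_0=i\sqrt{1-r^2},\qquad m(\zeta)=\frac{\zeta-z_0}{\zeta+z_0},\qquad \rho=\frac{1-\sqrt{1-r^2}}{r},\qquad \gamma(z)=\frac{\ln|m(z)|}{\ln\rho}.$$ (Here $m$ is the Möbius map transforming the upper half-plane into the unit disc and $\Gamma$ into a concentric circle, whose radius is $\rho$.) Then there exists $C>0$ such that for any $\epsilon>0$ and any $f\in H^2(\mathbb{H}_+)$ with $\|f\|_{H^2(\mathbb{H}_+)}\le1$ and $\|f\|_{L^2(\Gamma)}\le\epsilon$ we have $$|f(z)|\le C\epsilon^{\gamma(z)}.$$ Moreover, this bound is asymptotically optimal as $\epsilon\to0$ and is attained by the function, given by a series convergent in the upper half-plane, $$M(\zeta)=M_\epsilon(\zeta)=\frac{\epsilon^{2-\gamma(z)}}{\zeta+z_0}\sum_{n=1}^\infty\frac{\left(\overline{m(z)}\,m(\zeta)\right)^n}{\epsilon^2+\rho^{2n}},\qquad\zeta\in\mathbb{H}_+,$$ in the sense that there are constants $c_1,c_2,c_3,c_4,\epsilon_0>0$ (independent of $\epsilon$) such that for all $0<\epsilon<\epsilon_0$: $\|M_\epsilon\|_{H^2(\mathbb{H}_+)}\le c_1$, $\|M_\epsilon\|_{L^2(\Gamma)}\le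 c_2\epsilon$, and $c_3\epsilon^{\gamma(z)}\le|M_\epsilon(z)|\le c_4\epsilon^{\gamma(z)}$.
   Context: The Hardy space is $H^2(\mathbb{H}_+)=\{f\text{ analytic in }\mathbb{H}_+:\ \sup_{y>0}\|f(\cdot+iy)\|_{L^2(\mathbb{R})}<\infty\}$. Its elements have $L^2$ boundary values on $\mathbb{R}$, and the norm is $\|f\|_{H^2(\mathbb{H}_+)}=\|f\|_{L^2(\mathbb{R})}$ (norm of the boundary values). $L^2(\Gamma)$ is taken with respect to arc length measure. *)

(* Defs.v *)
From HB Require Import structures.
From mathcomp Require Import all_boot all_order all_algebra.
From mathcomp Require Import complex.
From mathcomp Require Import all_classical all_reals all_analysis.

Set Implicit Arguments.
Unset Strict Implicit.
Unset Printing Implicit Defensive.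

Import Order.TTheory GRing.Theory Num.Theory.
Import numFieldNormedType.Exports.
Local Open Scope classical_set_scope.
Local Open Scope complex_scope.
Local Open Scope ring_scope.

(* [normc] is the modulus with values in [R]; the norm [`|_|] of [R[i]] takes
   its values in [R[i]]. *)
Notation normc := ComplexField.Normc.normc.

Definition upper_half_plane (R : realType) : set R[i] :=
  [set w | 0 < complex.Im w].

(* [R[i]^o] is [R[i]] as a normed module over itself, so that [derivable _ w 1]
   is complex differentiability at [w]. *)
Definition analytic_on (R : realType) (D : set R[i]) (f : R[i] -> R[i]) : Prop :=
  forall w, D w -> derivable (f : R[i]^o -> R[i]^o) w 1.

Definition L2norm_line (R : realType) (g : R -> R[i]) : \bar R :=
  Lnorm lebesgue_measure 2%:E (fun x => (normc (g x))%:E).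

(* The arc length element of the circle [c + r * exp (i t)] is [r dt]. *)
Definition L2norm_circle (R : realType) (c : R[i]) (r : R) (f : R[i] -> R[i]) :
    \bar R :=
  poweR (\int[lebesgue_measure]_(t in `[(0 : R)%R, (2 * pi : R)%R])
           (normc (f (c + r%:C * (cos t +i* sin t))) ^+ 2 * r)%:E)%E 2^-1.

Definition hardy2 (R : realType) (f : R[i] -> R[i]) : Prop :=
  analytic_on (@upper_half_plane R) f /\
  (ereal_sup [set L2norm_line (fun x => f (x +i* y)) | y in [set y : R | (0 < y)%R]]
     < +oo)%E.

(* Boundary values are taken in the sense of L^2-convergence of the horizontal
   traces. *)
Definition boundary_value (R : realType) (f : R[i] -> R[i]) (g : R -> R[i]) :
    Prop :=
  [/\ measurable_fun [set: R] (fun x => complex.Re (g x)),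
      measurable_fun [set: R] (fun x => complex.Im (g x)) &
      L2norm_line (fun x => f (x +i* y) - g x) @[y --> 0^'+] --> 0%E].

(* A function of the Hardy space has boundary values, and they agree almost
   everywhere, so the infimum then ranges over a single number, the L^2 norm of
   the boundary values; a function without boundary values gets [+oo]. *)
Definition hardy2_norm (R : realType) (f : R[i] -> R[i]) : \bar R :=
  ereal_inf [set L2norm_line g | g in boundary_value f].

Definition z0 (R : realType) (r : R) : R[i] := 'i%C * (Num.sqrt (1 - r ^+ 2))%:C.

Definition mobius (R : realType) (r : R) (w : R[i]) : R[i] :=
  (w - z0 r) / (w + z0 r).

Definition rho (R : realType) (r : R) : R := (1 - Num.sqrt (1 - r ^+ 2)) / r.

Definition gamma (R : realType) (r : R) (z : R[i]) : R :=
  ln (normc (mobius r z)) / ln (rho r).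

Definition M_partial_sum (R : realType) (r : R) (z : R[i]) (eps : R)
    (w : R[i]) (N : nat) : R[i]^o :=
  \sum_(1 <= n < N.+1)
    (((mobius r z)^*%C * mobius r w) ^+ n / (eps ^+ 2 + rho r ^+ (2 * n))%:C).

Definition M_fun (R : realType) (r : R) (z : R[i]) (eps : R) (w : R[i]) : R[i] :=
  (eps `^ (2 - gamma r z))%:C / (w + z0 r) *
  lim (M_partial_sum r z eps w N @[N --> \oo]).

(* Main.v *)
(* The map [m] transfers the problem to the unit disc: put [F = f o m^-1] and
   [v = m z], so that [rho < |v| < 1]. Cauchy's kernel splits as
     [1 / (u - v) = \sum_(k < N) v^k / u^(k+1) + (v / u)^N / (u - v)].
   The finite sum has no pole but 0, so the contour of the corresponding part
   of Cauchy's integral for [F v] may be shrunk from [|u| = p] to [|u| = rho].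
   With [p] tending to 1 this bounds [|F v|] by a multiple of
   [(|v| / rho)^N * eps + |v|^N], and the choice [rho^N ~ eps] turns both terms
   into [eps^gamma], because [rho^gamma = |v|].
   For the extremal function, [\sum_n t^n / (eps^2 + rho^(2n))] with
   [rho^2 < t < 1] is of order [eps^(ln t / ln rho - 2)], as the terms with
   [rho^n > eps] and those with [rho^n < eps] are dominated by two geometric
   sums; the line, the circle and the point [z] correspond to [t = |v|],
   [t = |v| * rho] and [t = |v|^2]. *)

Require Import Defs.
From mathcomp Require Import all_boot all_order all_algebra.
From mathcomp Require Import complex.
From mathcomp Require Import all_classical all_reals all_analysis.
From mathcomp Require Import ring lra measurable_realfun.
Import Order.TTheory GRing.Theory Num.Theory.
Import numFieldNormedType.Exports.
Local Open Scope classical_set_scope.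
Local Open Scope complex_scope.
Local Open Scope ring_scope.

Set Implicit Arguments.
Unset Strict Implicit.
Unset Printing Implicit Defensive.

(** * Complex modulus and differentiability *)

(** The obstacle is the boundary: [hardy2_norm f] speaks of L^2 boundary values, and no Cauchy or
    Poisson integral over the line is at hand. So [f] is replaced by its vertical translate by a
    small [y], which is differentiable across the line and bounded above it. On circles [|u| = p]
    near 1 its pullback converges to the trace at height [y], except near [u = 1], the image of
    infinity; there the arc is cut so short that the bound, however large, contributes at most a
    constant. For small [y] the trace has mean square at most 10 whatever [f] is, so [C] depends on
    [r] and [z] alone. Finally [y] is so small, in terms of [f] and [eps], that the translation
    costs at most [eps] on the circle and [eps^gamma] at [z]. Complex integrals are pairs of real
    ones and constants are crude: factors 2 come from adding real and imaginary parts, L^1 means are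
    bounded through [x <= 1 + x^2] or [x <= e + x^2 / e], and winding integrals are only bounded
    from below. The extremal series converges on the closed disc, so the formula itself gives its
    boundary values. *)

Section complex_modulus.
Variable R : realType.
Implicit Types x y : R[i].

Lemma normc_def_sqrt x : normc x = Num.sqrt (complex.Re x ^+ 2 + complex.Im x ^+ 2).
Proof. by case: x. Qed.

Lemma normr_complex x : `|x| = (normc x)%:C :> R[i].
Proof. by []. Qed.

Lemma normc_ge0 x : 0 <= normc x.
Proof. by rewrite normc_def_sqrt sqrtr_ge0. Qed.

Lemma normcM x y : normc (x * y) = normc x * normc y.
Proof. exact: ComplexField.Normc.normcM. Qed.

Lemma normcV x : normc x^-1 = (normc x)^-1.
Proof. exact: ComplexField.Normc.normcV. Qed.

Lemma normcf_div x y : normc (x / y) = normc x / normc y.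
Proof. by rewrite normcM normcV. Qed.

Lemma normcX x n : normc (x ^+ n) = normc x ^+ n.
Proof.
elim: n => [|n IH]; first by rewrite !expr0 ComplexField.Normc.normc1.
by rewrite !exprS normcM IH.
Qed.

Lemma normc_opp x : normc (- x) = normc x.
Proof. exact: normcN. Qed.

Lemma normc_triangle x y : normc (x + y) <= normc x + normc y.
Proof. exact: le_normcD. Qed.

Lemma normc_sub x y : normc (x - y) <= normc x + normc y.
Proof. by rewrite -(normc_opp y) normc_triangle. Qed.

Lemma normcB_ge x y : normc x - normc y <= normc (x - y).
Proof. by rewrite lerBlDr -{1}(subrK y x) normc_triangle. Qed.

Lemma normc_distC x y : normc (x - y) = normc (y - x).
Proof. by rewrite -opprB normc_opp. Qed.

Lemma normc_dist x y : `|normc x - normc y| <= normc (x - y).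
Proof. by rewrite ler_norml lerNl opprB normcB_ge normc_distC normcB_ge. Qed.

Lemma normc_real (a : R) : normc a%:C = `|a|.
Proof. by rewrite normc_def_sqrt /= expr0n /= addr0 sqrtr_sqr. Qed.

Lemma normc_eq0 x : (normc x == 0) = (x == 0).
Proof.
apply/idP/idP => [/eqP/ComplexField.Normc.eq0_normc ->//|/eqP ->].
by rewrite ComplexField.Normc.normc0.
Qed.

Lemma normc_gt0 x : (0 < normc x) = (x != 0).
Proof. by rewrite lt_def normc_ge0 andbT normc_eq0. Qed.

Lemma normc_sqr x : normc x ^+ 2 = complex.Re x ^+ 2 + complex.Im x ^+ 2.
Proof. by rewrite normc_def_sqrt sqr_sqrtr// addr_ge0 ?sqr_ge0. Qed.

Lemma normc_conj x : normc x^*%C = normc x.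
Proof. by case: x => a b; rewrite !normc_def_sqrt /= sqrrN. Qed.

Lemma normc_Re x : `|complex.Re x| <= normc x.
Proof. by rewrite normc_def_sqrt -sqrtr_sqr ler_wsqrtr// lerDl sqr_ge0. Qed.

Lemma normc_Im x : `|complex.Im x| <= normc x.
Proof. by rewrite normc_def_sqrt -sqrtr_sqr ler_wsqrtr// lerDr sqr_ge0. Qed.

Lemma normc_ReIm x : normc x <= `|complex.Re x| + `|complex.Im x|.
Proof.
rewrite normc_def_sqrt -[leRHS]ger0_norm ?addr_ge0// -sqrtr_sqr ler_wsqrtr//.
rewrite sqrrD !real_normK ?num_real// addrAC lerDl mulrn_wge0//; exact: mulr_ge0.
Qed.

Lemma complex_ext x y : complex.Re x = complex.Re y ->
  complex.Im x = complex.Im y -> x = y.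
Proof. by case: x => a b; case: y => c d /= -> ->. Qed.

Lemma cReD x y : complex.Re (x + y) = complex.Re x + complex.Re y.
Proof. by case: x; case: y. Qed.

Lemma cImD x y : complex.Im (x + y) = complex.Im x + complex.Im y.
Proof. by case: x; case: y. Qed.

Lemma cReN x : complex.Re (- x) = - complex.Re x.
Proof. by case: x. Qed.

Lemma cImN x : complex.Im (- x) = - complex.Im x.
Proof. by case: x. Qed.

Lemma cReM x y : complex.Re (x * y) =
  complex.Re x * complex.Re y - complex.Im x * complex.Im y.
Proof. by case: x; case: y. Qed.

Lemma cImM x y : complex.Im (x * y) =
  complex.Re x * complex.Im y + complex.Im x * complex.Re y.
Proof. by case: x => a b; case: y => c d. Qed.

End complex_modulus.

Section complex_derivative.
Variable R : realType.
Implicit Types f g : R[i] -> R[i].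

(* Differentiability is used with the real-valued modulus, in the form of a
   linear approximation. *)
Definition cderiv f (w l : R[i]) : Prop :=
  forall e : R, 0 < e -> exists2 d : R, 0 < d &
    forall h, normc h < d -> normc (f (w + h) - f w - l * h) <= e * normc h.

Definition cdifferentiable f (w : R[i]) : Prop := exists l, cderiv f w l.

(** The bridge to the library: sums, products, inverses and compositions are transported from there,
    while estimates use the real modulus. *)
Lemma cdifferentiableP f (w : R[i]) :
  derivable (f : R[i]^o -> R[i]^o) w 1 <-> cdifferentiable f w.
Proof.
split.
  move=> /cvg_ex[l]; set D := fun h => _.
  move=> Dl; exists l => e e0.
  have e0' : 0 < e%:C :> R[i] by rewrite ltcR.
  have /cvgr_dist_lt/(_ _ e0') := Dl.
  move=> /nbhs_ballP[/= d d0 dP]; exists (complex.Re d).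
    by move: d0; rewrite ltcE => /andP[].
  move=> h hd; have [->|h0] := eqVneq h 0.
    by rewrite addr0 mulr0 subr0 subrr ComplexField.Normc.normc0 mulr0.
  (* In the order of [R[i]] a positive number is real, so the radius can be read as a real one. *)
  have dE : d = (complex.Re d)%:C.
    by move: d0; rewrite ltcE /= => /andP[/eqP]; case: (d) => a b /= ->.
  have := dP h; rewrite /ball /= sub0r normrN normr_complex dE ltcR => /(_ hd h0).
  rewrite normr_complex ltcR => /ltW lte.
  have -> : f (w + h) - f w - l * h = - ((l - D h) * h).
    rewrite /D /= mulrBl opprB; congr (_ - _).
    rewrite /GRing.scale /= mulr1 mulrAC mulVf// mul1r.
    by rewrite [h + w]addrC.
  by rewrite normc_opp normcM ler_wpM2r ?normc_ge0.
move=> [l fl]; apply/cvg_ex; exists l.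
apply/cvgrPdist_le => e e0.
have eE : e = (complex.Re e)%:C.
  by move: e0; rewrite ltcE /= => /andP[/eqP]; case: (e) => a b /= ->.
move: e0; rewrite eE ltcR => e0.
have [d d0 dP] := fl _ e0.
apply/nbhs_ballP; exists d%:C => /=; first by rewrite ltcR.
move=> h; rewrite /ball /= sub0r normrN normr_complex ltcR => hd h0.
rewrite normr_complex lecR.
have := dP h hd.
have -> : f (w + h) - f w - l * h =
    - ((l - h^-1 *: (f (h *: (1 : R[i]^o) + w) - f w)) * h).
  rewrite mulrBl opprB; congr (_ - _).
  rewrite /GRing.scale /= mulr1 mulrAC mulVf// mul1r.
  by rewrite [h + w]addrC.
by rewrite normc_opp normcM ler_pM2r ?normc_gt0.
Qed.

Lemma cdifferentiable_cst (a w : R[i]) : cdifferentiable (fun=> a) w.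
Proof. by apply/cdifferentiableP; exact: derivable_cst. Qed.

Lemma cdifferentiable_id (w : R[i]) : cdifferentiable (fun x => x) w.
Proof. by apply/cdifferentiableP; exact: derivable_id. Qed.

Lemma cdifferentiableD f g w : cdifferentiable f w -> cdifferentiable g w ->
  cdifferentiable (fun x => f x + g x) w.
Proof.
by move=> /cdifferentiableP ? /cdifferentiableP ?;
  apply/cdifferentiableP; exact: derivableD.
Qed.

Lemma cdifferentiableN f w : cdifferentiable f w ->
  cdifferentiable (fun x => - f x) w.
Proof.
by move=> /cdifferentiableP ?; apply/cdifferentiableP; exact: derivableN.
Qed.

Lemma cdifferentiableB f g w : cdifferentiable f w -> cdifferentiable g w ->
  cdifferentiable (fun x => f x - g x) w.
Proof. by move=> ? ?; apply/cdifferentiableD/cdifferentiableN. Qed.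

Lemma cdifferentiableM f g w : cdifferentiable f w -> cdifferentiable g w ->
  cdifferentiable (fun x => f x * g x) w.
Proof.
move=> /cdifferentiableP df /cdifferentiableP dg; apply/cdifferentiableP.
exact: (@derivableM R[i] R[i]^o (f : R[i]^o -> R[i]^o) g w 1 df dg).
Qed.

Lemma cdifferentiableV f w : f w != 0 -> cdifferentiable f w ->
  cdifferentiable (fun x => (f x)^-1) w.
Proof.
move=> fw0 /cdifferentiableP df; apply/cdifferentiableP.
exact: (@derivableV R[i] R[i]^o (f : R[i]^o -> R[i]^o) w 1 fw0 df).
Qed.

Lemma cdifferentiable_comp f g w : cdifferentiable f w ->
  cdifferentiable g (f w) -> cdifferentiable (fun x => g (f x)) w.
Proof.
move=> /cdifferentiableP/derivable1_diffP df.
move=> /cdifferentiableP/derivable1_diffP dg.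
apply/cdifferentiableP/derivable1_diffP.
exact: (@differentiable_comp _ _ _ _ (f : R[i]^o -> R[i]^o)
  (g : R[i]^o -> R[i]^o) w df dg).
Qed.

Lemma cdifferentiable_ext f g (w : R[i]) (d : R) : 0 < d ->
  (forall h, normc h < d -> f (w + h) = g (w + h)) ->
  cdifferentiable f w -> cdifferentiable g w.
Proof.
move=> d0 fg [l fl]; exists l => e /fl[d' d'0 H].
exists (Num.min d d'); first by rewrite lt_min d0.
move=> h; rewrite lt_min => /andP[hd hd'].
rewrite -fg// -{2}(addr0 w) -fg ?ComplexField.Normc.normc0// addr0; exact: H.
Qed.

Lemma cdifferentiable_sum (I : Type) (s : seq I) (F : I -> R[i] -> R[i]) w :
  (forall i, cdifferentiable (F i) w) ->
  cdifferentiable (fun x => \sum_(i <- s) F i x) w.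
Proof.
move=> dF; elim: s => [|i s IH].
  apply: (@cdifferentiable_ext (fun=> 0) _ _ 1) => // [h _|].
    by rewrite big_nil.
  exact: cdifferentiable_cst.
apply: (@cdifferentiable_ext (fun x => F i x + \sum_(j <- s) F j x) _ _ 1) => //.
  by move=> h _; rewrite big_cons.
exact: cdifferentiableD.
Qed.

Lemma cdifferentiableX f n w : cdifferentiable f w ->
  cdifferentiable (fun x => f x ^+ n) w.
Proof.
move=> df; elim: n => [|n IH].
  apply: (@cdifferentiable_ext (fun=> 1) _ _ 1) => //.
  exact: cdifferentiable_cst.
apply: (@cdifferentiable_ext (fun x => f x * f x ^+ n) _ _ 1) => //.
  by move=> h _; rewrite exprS.
exact: cdifferentiableM.
Qed.

Lemma cdifferentiable_continuous f w : cdifferentiable f w ->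
  forall e : R, 0 < e -> exists2 d, 0 < d &
    forall h, normc h < d -> normc (f (w + h) - f w) < e.
Proof.
move=> [l fl] e e0; have [d d0 dP] := fl _ ltr01.
exists (Num.min d (e / (2 + normc l))).
  by rewrite lt_min d0 divr_gt0// ltr_wpDr// normc_ge0.
move=> h; rewrite lt_min => /andP[/dP hd].
rewrite ltr_pdivlMr ?ltr_wpDr ?normc_ge0// => he.
rewrite -(subrK (l * h) (_ - _)) (le_lt_trans (normc_triangle _ _))// normcM.
apply: le_lt_trans (he); rewrite mulrDr.
have := normc_ge0 h; rewrite mul1r in hd; rewrite [normc h * normc l]mulrC.
lra.
Qed.

End complex_derivative.

(** * Contour integrals *)

Section paths.
Variable R : realType.
Implicit Types (g k : R -> R[i]) (t : R).

(** Componentwise, because integrals are taken separately over real and imaginary parts; [ccontP]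
    gives the form with the modulus. *)
Definition ccont g t : Prop :=
  {for t, continuous (fun s => complex.Re (g s))} /\
  {for t, continuous (fun s => complex.Im (g s))}.

Lemma ccontP g t : ccont g t <-> forall e : R, 0 < e -> exists2 d : R, 0 < d &
  forall s, `|s - t| < d -> normc (g s - g t) < e.
Proof.
split=> [[cr ci] e e0|H].
  have e20 : 0 < e / 2 by rewrite divr_gt0.
  move/cvgrPdist_lt/(_ _ e20)/nbhs_ballP : cr => [/= d1 d10 H1].
  move/cvgrPdist_lt/(_ _ e20)/nbhs_ballP : ci => [/= d2 d20 H2].
  exists (Num.min d1 d2); first by rewrite lt_min d10.
  move=> s; rewrite lt_min distrC => /andP[/H1 s1 /H2 s2].
  rewrite (le_lt_trans (normc_ReIm _))// (splitr e) ltrD//.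
    by rewrite cReD cReN distrC.
  by rewrite cImD cImN distrC.
split; apply/cvgrPdist_lt => e /H[d d0 dP]; apply/nbhs_ballP; exists d => //= s;
  rewrite /ball /= distrC => /dP; apply: le_lt_trans; rewrite distrC.
- by rewrite -cReN -cReD normc_Re.
- by rewrite -cImN -cImD normc_Im.
Qed.

Lemma ccont_cst (c : R[i]) t : ccont (fun=> c) t.
Proof. by split; exact: cvg_cst. Qed.

Lemma ccontD g k t : ccont g t -> ccont k t -> ccont (fun s => g s + k s) t.
Proof.
move=> [gr gi] [kr ki]; split.
  rewrite (_ : (fun _ => _) = (fun s => complex.Re (g s) + complex.Re (k s))).
    exact: continuousD.
  by apply/funext => s; rewrite cReD.
rewrite (_ : (fun _ => _) = (fun s => complex.Im (g s) + complex.Im (k s))).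
  exact: continuousD.
by apply/funext => s; rewrite cImD.
Qed.

Lemma ccontM g k t : ccont g t -> ccont k t -> ccont (fun s => g s * k s) t.
Proof.
move=> [gr gi] [kr ki]; split.
  rewrite (_ : (fun _ => _) = (fun s => complex.Re (g s) * complex.Re (k s)
                                        - complex.Im (g s) * complex.Im (k s))).
    by apply: continuousB; exact: continuousM.
  by apply/funext => s; rewrite cReM.
rewrite (_ : (fun _ => _) = (fun s => complex.Re (g s) * complex.Im (k s)
                                      + complex.Im (g s) * complex.Re (k s))).
  by apply: continuousD; exact: continuousM.
by apply/funext => s; rewrite cImM.
Qed.

Lemma ccontN g t : ccont g t -> ccont (fun s => - g s) t.
Proof.
move=> cg; rewrite (_ : (fun _ => _) = (fun s => (-1) * g s)).
  exact: ccontM (ccont_cst _ _) cg.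
by apply/funext => s; rewrite mulN1r.
Qed.

Lemma ccontB g k t : ccont g t -> ccont k t -> ccont (fun s => g s - k s) t.
Proof. by move=> cg ck; exact: ccontD cg (ccontN ck). Qed.

Lemma ccont_comp (K : R[i] -> R[i]) g t : ccont g t -> cdifferentiable K (g t) ->
  ccont (fun s => K (g s)) t.
Proof.
move=> /ccontP cg dK; apply/ccontP => e e0.
have [d d0 dP] := cdifferentiable_continuous dK e0.
have [d' d'0 d'P] := cg _ d0; exists d' => // s /d'P/dP.
by rewrite [g t + _]addrC subrK.
Qed.

Lemma ccont_normc g t : ccont g t -> {for t, continuous (fun s => normc (g s))}.
Proof.
move=> /ccontP cg; apply/cvgrPdist_lt => e /cg[d d0 dP].
apply/nbhs_ballP; exists d => //= s; rewrite /ball /= distrC => /dP.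
by apply: le_lt_trans; rewrite distrC normc_dist.
Qed.

Definition pder g t (l : R[i]) : Prop :=
  is_derive t 1 (fun s => complex.Re (g s)) (complex.Re l) /\
  is_derive t 1 (fun s => complex.Im (g s)) (complex.Im l).

Lemma pder_ccont g t l : pder g t l -> ccont g t.
Proof.
move=> [[dr _] [di _]]; split.
  exact: differentiable_continuous ((derivable1_diffP _ _).1 dr).
exact: differentiable_continuous ((derivable1_diffP _ _).1 di).
Qed.

Lemma pder_cst (c : R[i]) t : pder (fun=> c) t 0.
Proof. by split; exact: is_derive_cst. Qed.

Lemma pderD g k t l m : pder g t l -> pder k t m ->
  pder (fun s => g s + k s) t (l + m).
Proof.
move=> [gr gi] [kr ki]; split.
  rewrite (_ : (fun _ => _) = (fun s => complex.Re (g s)) + (fun s => complex.Re (k s))).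
    by rewrite cReD; exact: is_deriveD.
  by apply/funext => s; rewrite cReD.
rewrite (_ : (fun _ => _) = (fun s => complex.Im (g s)) + (fun s => complex.Im (k s))).
  by rewrite cImD; exact: is_deriveD.
by apply/funext => s; rewrite cImD.
Qed.

Lemma pderM g k t l m : pder g t l -> pder k t m ->
  pder (fun s => g s * k s) t (l * k t + g t * m).
Proof.
move=> [gr gi] [kr ki]; split.
  rewrite (_ : (fun _ => _) = (fun s => complex.Re (g s)) * (fun s => complex.Re (k s)) -
    (fun s => complex.Im (g s)) * (fun s => complex.Im (k s))); last first.
    by apply/funext => s; rewrite cReM.
  apply: (is_derive_eq (is_deriveB (is_deriveM gr kr) (is_deriveM gi ki))).
  by rewrite !(cReD,cReM) /GRing.scale /=; ring.
rewrite (_ : (fun _ => _) = (fun s => complex.Re (g s)) * (fun s => complex.Im (k s)) +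
    (fun s => complex.Im (g s)) * (fun s => complex.Re (k s))); last first.
  by apply/funext => s; rewrite cImM.
apply: (is_derive_eq (is_deriveD (is_deriveM gr ki) (is_deriveM gi kr))).
by rewrite !(cImD,cImM) /GRing.scale /=; ring.
Qed.

Lemma pderZ (c : R[i]) g t l : pder g t l -> pder (fun s => c * g s) t (c * l).
Proof. by move=> /(pderM (pder_cst c t)); rewrite mul0r add0r. Qed.

Lemma pder_real t : pder (fun s : R => s%:C) t 1.
Proof. by split => /=; [exact: is_derive_id|exact: is_derive_cst]. Qed.

Lemma pder_realf (f : R -> R) t d : is_derive t 1 f d ->
  pder (fun s => (f s)%:C) t d%:C.
Proof. by move=> df; split => //=; exact: is_derive_cst. Qed.

Lemma pder_conj g t l : pder g t l -> pder (fun s => (g s)^*%C) t l^*%C.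
Proof.
move=> [gr gi]; split.
  rewrite (_ : (fun _ => _) = (fun s => complex.Re (g s))).
    by case: l gr {gi}.
  by apply/funext => s; case: (g s).
rewrite (_ : (fun _ => _) = - (fun s => complex.Im (g s))).
  rewrite (_ : complex.Im _ = - complex.Im l); first exact: is_deriveN.
  by case: l {gr gi}.
by apply/funext => s; rewrite fctE; case: (g s).
Qed.

Lemma sqr_normc_conj (x : R[i]) : (normc x ^+ 2)%:C = x * x^*%C.
Proof.
case: x => a b; rewrite normc_sqr; apply: complex_ext.
  by rewrite cReM /=; ring.
by rewrite cImM /=; ring.
Qed.

(** Derivatives of paths are componentwise, so [1 / g] is written as [conj g / |g|^2], a path with a
    known derivative times the reciprocal of a real function. *)
Lemma pderV g t l : g t != 0 -> pder g t l ->
  pder (fun s => (g s)^-1) t (- (l / g t ^+ 2)).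
Proof.
move=> g0 dg.
set N := fun s => normc (g s) ^+ 2.
have N0 : N t != 0 by rewrite sqrf_eq0 normc_eq0.
(* At a zero of [g] both sides are 0 by the convention on inverses, so this is an equality of
   functions on the whole line. *)
have gV s : (g s)^-1 = (g s)^*%C * ((N s)^-1)%:C.
  have [->|gs0] := eqVneq (g s) 0; first by rewrite conjc0 mul0r invr0.
  have cs0 : (g s)^*%C != 0 by rewrite conjc_eq0.
  by rewrite /N fmorphV /= sqr_normc_conj invfM mulrCA mulfV// mulr1.
have dN : exists2 n : R, is_derive t 1 N n & n%:C = l * (g t)^*%C + g t * l^*%C.
  have [dr _] := pderM dg (pder_conj dg); eexists; last first.
    apply: complex_ext => /=; first by [].
    rewrite cImD !cImM; case: (l) (g t) => [a b] [c d] /=; ring.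
  rewrite (_ : N = fun s => complex.Re (g s * (g s)^*%C)) //.
  by apply/funext => s; rewrite -sqr_normc_conj.
have [n dNn nE] := dN.
have := pderM (pder_conj dg) (pder_realf (is_deriveV N0 dNn)).
rewrite (_ : (fun s => _) = (fun s => (g s)^-1)); last first.
  by apply/funext => s; rewrite gV.
congr pder; have c0 : (g t)^*%C != 0 by rewrite conjc_eq0.
have -> : (- N t ^- 2 *: n)%:C = - (N t)%:C ^- 2 * n%:C.
  by rewrite rmorphM /= rmorphN /= fmorphV /= rmorphXn.
have -> : ((N t)^-1)%:C = (N t)%:C^-1 by rewrite fmorphV.
by rewrite nE sqr_normc_conj; field; rewrite g0.
Qed.

End paths.

Section complex_integral.
Variable R : realType.
Notation mu := (@lebesgue_measure R).
Implicit Types (g k : R -> R[i]) (f : R -> R) (a b c t : R).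

Lemma continuous_integrable f a b : {in `[a, b], continuous f} ->
  mu.-integrable `[a, b] (EFin \o f).
Proof.
move=> cf; apply: continuous_compact_integrable; first exact: segment_compact.
by apply: continuous_in_subspaceT => x; rewrite inE => xab; exact: cf.
Qed.

Lemma Rintegral_split f a b c : a <= c -> c <= b -> {in `[a, b], continuous f} ->
  (\int[mu]_(x in `[a, b]) f x =
   \int[mu]_(x in `[a, c]) f x + \int[mu]_(x in `[c, b]) f x)%R.
Proof.
move=> ac cb cf.
have /= itf := continuous_integrable cf.
have := @Rintegral_itvB R f (BLeft a) (BRight b) c itf.
rewrite !bnd_simp => /(_ ac cb) /eqP; rewrite subr_eq => /eqP ->.
rewrite addrC Rintegral_itv_obnd_cbnd//.
apply: (@integrableS _ _ _ mu `[a, b]) => //.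
by apply: subset_itv; rewrite !bnd_simp.
Qed.

Lemma lebesgue_itvcc a b : a <= b -> fine (mu `[a, b]%classic) = b - a.
Proof.
move=> ab; rewrite lebesgue_measure_itv /= lte_fin; case: ltP => //= ba.
by rewrite (@le_anti _ _ a b) ?ab// subrr.
Qed.

Lemma Rintegral_le_cst f a b (M : R) : a <= b -> {in `[a, b], continuous f} ->
  {in `[a, b], forall x, f x <= M} ->
  (\int[mu]_(x in `[a, b]) f x)%R <= M * (b - a).
Proof.
move=> ab cf fM; rewrite -lebesgue_itvcc// -Rintegral_cst//.
apply: le_Rintegral => //; first exact: continuous_integrable.
by apply: continuous_integrable => x _; exact: cvg_cst.
Qed.

Lemma FTC_Rintegral (F f : R -> R) a b : a <= b ->
  {in `[a, b], forall x : R, is_derive x 1 F (f x)} -> {in `[a, b], continuous f} ->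
  (\int[mu]_(x in `[a, b]) f x = F b - F a)%R.
Proof.
rewrite le_eqVlt => /predU1P[<- _ _|ab dF cf].
  by rewrite set_itv1 Rintegral_set1 subrr.
have cF : {in `[a, b], continuous F}.
  by move=> x /dF[dx _]; exact: differentiable_continuous ((derivable1_diffP _ _).1 dx).
rewrite /Rintegral (@continuous_FTC2 R f F)//.
- by apply: continuous_in_subspaceT => x; rewrite inE => xab; exact: cf.
- split.
  + by move=> x xab; have [] := dF x (subset_itv_oo_cc xab).
  + by apply: cvg_at_right_filter; apply: cF; rewrite in_itv /= lexx ltW.
  + by apply: cvg_at_left_filter; apply: cF; rewrite in_itv /= lexx ltW.
- move=> x xab; have [_ <-] := dF x (subset_itv_oo_cc xab).
  by rewrite derive1E.
Qed.

Definition cint a b g : R[i] :=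
  (\int[mu]_(x in `[a, b]) complex.Re (g x))%R +i*
  (\int[mu]_(x in `[a, b]) complex.Im (g x))%R.

Definition ccont_on a b g : Prop := {in `[a, b], forall t, ccont g t}.

Lemma ccont_on_Re a b g : ccont_on a b g ->
  {in `[a, b], continuous (fun s => complex.Re (g s))}.
Proof. by move=> cg x /cg[]. Qed.

Lemma ccont_on_Im a b g : ccont_on a b g ->
  {in `[a, b], continuous (fun s => complex.Im (g s))}.
Proof. by move=> cg x /cg[]. Qed.

Lemma eq_cint a b g k : {in `[a, b], g =1 k} -> cint a b g = cint a b k.
Proof.
move=> gk; congr (_ +i* _); apply: eq_Rintegral => x; rewrite inE => /gk ->//.
Qed.

Lemma cintD a b g k : ccont_on a b g -> ccont_on a b k ->
  cint a b (fun t => g t + k t) = cint a b g + cint a b k.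
Proof.
move=> cg ck; apply: complex_ext.
  rewrite cReD /= -RintegralD//.
  - by apply: eq_Rintegral => x _; rewrite cReD.
  - exact/continuous_integrable/ccont_on_Re.
  - exact/continuous_integrable/ccont_on_Re.
rewrite cImD /= -RintegralD//.
- by apply: eq_Rintegral => x _; rewrite cImD.
- exact/continuous_integrable/ccont_on_Im.
- exact/continuous_integrable/ccont_on_Im.
Qed.

Lemma cintZ a b g (l : R[i]) : ccont_on a b g ->
  cint a b (fun t => l * g t) = l * cint a b g.
Proof.
move=> cg.
have ir := continuous_integrable (ccont_on_Re cg).
have ii := continuous_integrable (ccont_on_Im cg).
have iZ (f : R -> R) (u : R) : mu.-integrable `[a, b] (EFin \o f) ->
    mu.-integrable `[a, b] (EFin \o (fun x => u * f x)).
  move=> iF.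
  exact: (@integrableZl _ _ _ mu `[a, b]%classic (measurable_itv _) u (EFin \o f)).
apply: complex_ext.
  rewrite cReM /= -!RintegralZl// -RintegralB//; do ?exact: iZ.
  by apply: eq_Rintegral => x _; rewrite cReM.
rewrite cImM /= -!RintegralZl// -RintegralD//; do ?exact: iZ.
by apply: eq_Rintegral => x _; rewrite cImM.
Qed.

Lemma cintB a b g k : ccont_on a b g -> ccont_on a b k ->
  cint a b (fun t => g t - k t) = cint a b g - cint a b k.
Proof.
move=> cg ck; rewrite -[- cint a b k]mulN1r -cintZ// -cintD//.
  by apply: eq_cint => x _; rewrite mulN1r.
by move=> t /ck ct; exact: ccontM (ccont_cst _ _) ct.
Qed.

Lemma cint_split a b c g : a <= c -> c <= b -> ccont_on a b g ->
  cint a b g = cint a c g + cint c b g.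
Proof.
move=> ac cb cg; apply: complex_ext.
  by rewrite cReD /=; apply: Rintegral_split => //; exact: ccont_on_Re.
by rewrite cImD /=; apply: Rintegral_split => //; exact: ccont_on_Im.
Qed.

(** The factor 2 comes from bounding the real and the imaginary part separately by the integral of
    the modulus; it recurs in every estimate below. *)
Lemma le_normc_cint a b g : ccont_on a b g ->
  normc (cint a b g) <= 2 * (\int[mu]_(x in `[a, b]) normc (g x))%R.
Proof.
move=> cg.
have ig : mu.-integrable `[a, b] (EFin \o (fun x => normc (g x))).
  by apply: continuous_integrable => x /cg; exact: ccont_normc.
have H (f : R -> R) : {in `[a, b], continuous f} ->
    (forall x, `|f x| <= normc (g x)) ->
    `|(\int[mu]_(x in `[a, b]) f x)%R| <= (\int[mu]_(x in `[a, b]) normc (g x))%R.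
  move=> cf fg; have iF := continuous_integrable cf.
  have /le_trans := @le_normr_Rintegral _ _ _ mu _ f (measurable_itv _) iF.
  apply.
  apply: le_Rintegral => //.
  exact: (@integrable_norm _ _ _ mu _ f).
rewrite mulr_natl mulr2n (le_trans (normc_ReIm _))// lerD//=; apply: H.
- exact: ccont_on_Re.
- by move=> x; exact: normc_Re.
- exact: ccont_on_Im.
- by move=> x; exact: normc_Im.
Qed.

Lemma cint_bound a b g (M : R) : a <= b -> ccont_on a b g ->
  {in `[a, b], forall x, normc (g x) <= M} ->
  normc (cint a b g) <= 2 * (M * (b - a)).
Proof.
move=> ab cg gM; apply: le_trans (le_normc_cint cg) _; rewrite ler_pM2l//.
by apply: Rintegral_le_cst => // x /cg; exact: ccont_normc.
Qed.

Lemma FTC_cint a b (G g : R -> R[i]) : a <= b ->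
  {in `[a, b], forall x, pder G x (g x)} -> ccont_on a b g ->
  cint a b g = G b - G a.
Proof.
move=> ab dG cg; apply: complex_ext.
  rewrite cReD cReN /=; apply: (@FTC_Rintegral (fun s => complex.Re (G s))) => //.
    by move=> x /dG[].
  exact: ccont_on_Re.
rewrite cImD cImN /=; apply: (@FTC_Rintegral (fun s => complex.Im (G s))) => //.
  by move=> x /dG[].
exact: ccont_on_Im.
Qed.

End complex_integral.

(** * Goursat's theorem and Cauchy's formula *)

Section bisection.
Variable R : realType.

Lemma nested_point (a b : nat -> R) : (forall n, a n <= a n.+1) ->
  (forall n, b n.+1 <= b n) -> (forall n, a n <= b n) ->
  exists p, forall n, a n <= p <= b n.
Proof.
move=> ai bd ab.
have am m n : (m <= n)%N -> a m <= a n.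
  move=> /subnK <-; elim: (n - m)%N => [|k IH]; first by rewrite add0n.
  by rewrite addSn (le_trans IH).
have bm m n : (m <= n)%N -> b n <= b m.
  move=> /subnK <-; elim: (n - m)%N => [|k IH]; first by rewrite add0n.
  by rewrite addSn (le_trans _ IH).
have amb m n : a m <= b n.
  have [mn|/ltnW nm] := leqP m n; first by rewrite (le_trans (am _ _ mn)).
  by rewrite (le_trans (ab m))// bm.
have ubA n : ubound (range a) (b n) by move=> _ [m _ <-].
have hA : has_sup (range a).
  by split; [exists (a 0%N); exists 0%N|exists (b 0%N); exact: ubA].
exists (sup (range a)) => n; apply/andP; split.
  by apply: sup_ubound; [case: hA|exists n].
by apply: ge_sup => //; case: hA.
Qed.

Implicit Types I J : R * R.

Let mid I := (I.1 + I.2) / 2.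
Let half I I' := I' = (I.1, mid I) \/ I' = (mid I, I.2).

Let halfP I I' : I.1 <= I.2 -> half I I' ->
  [/\ I.1 <= I'.1, I'.1 <= I'.2, I'.2 <= I.2 & I'.2 - I'.1 = (I.2 - I.1) / 2].
Proof. by move=> le; case=> -> /=; rewrite /mid; split; lra. Qed.

Variables (E : R -> R -> R -> R -> R[i]) (P0 P1 Q0 Q1 : R).
Hypotheses (P01 : P0 <= P1) (Q01 : Q0 <= Q1).
Hypothesis addP : forall p0 p p1 q0 q1, P0 <= p0 -> p0 <= p -> p <= p1 ->
  p1 <= P1 -> Q0 <= q0 -> q0 <= q1 -> q1 <= Q1 ->
  E p0 p1 q0 q1 = E p0 p q0 q1 + E p p1 q0 q1.
Hypothesis addQ : forall p0 p1 q0 q q1, P0 <= p0 -> p0 <= p1 ->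
  p1 <= P1 -> Q0 <= q0 -> q0 <= q -> q <= q1 -> q1 <= Q1 ->
  E p0 p1 q0 q1 = E p0 p1 q0 q + E p0 p1 q q1.
Hypothesis small : forall p q, P0 <= p <= P1 -> Q0 <= q <= Q1 ->
  forall e, 0 < e -> exists2 d, 0 < d & forall p0 p1 q0 q1,
    P0 <= p0 -> p0 <= p <= p1 -> p1 <= P1 ->
    Q0 <= q0 -> q0 <= q <= q1 -> q1 <= Q1 ->
    (p1 - p0) + (q1 - q0) < d ->
    normc (E p0 p1 q0 q1) <= e * ((p1 - p0) + (q1 - q0)) ^+ 2.

Let ok (x : (R * R) * (R * R)) :=
  [/\ P0 <= x.1.1, x.1.1 <= x.1.2 & x.1.2 <= P1] /\
  [/\ Q0 <= x.2.1, x.2.1 <= x.2.2 & x.2.2 <= Q1].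
Let N (x : (R * R) * (R * R)) := normc (E x.1.1 x.1.2 x.2.1 x.2.2).

(** The existence is stated for every [x], with the validity condition moved inside, so that choice
    yields a total function to iterate. *)
Let step x : exists y, ok x ->
  [/\ half x.1 y.1, half x.2 y.2 & N x <= 4 * N y].
Proof.
have [okx|nok] := pselect (ok x); last by exists x.
pose y i j : (R * R) * (R * R) :=
  ((if i then (x.1.1, mid x.1) else (mid x.1, x.1.2)),
   (if j then (x.2.1, mid x.2) else (mid x.2, x.2.2))).
have Ny : N x <= N (y true true) + N (y true false) +
    (N (y false true) + N (y false false)).
  case: okx => [[? ? ?] [? ? ?]].
  have ? : x.1.1 <= mid x.1 <= x.1.2 by rewrite /mid; lra.
  have ? : x.2.1 <= mid x.2 <= x.2.2 by rewrite /mid; lra.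
  rewrite /N (@addP _ (mid x.1)); [|lra..].
  rewrite (@addQ _ (mid x.1) _ (mid x.2)); [|lra..].
  rewrite (@addQ (mid x.1) _ _ (mid x.2)); [|lra..].
  rewrite (le_trans (normc_triangle _ _))// lerD//=.
    exact: normc_triangle.
  exact: normc_triangle.
have [i [j le]] : exists i j, N x <= 4 * N (y i j).
  have [|] := leP (N x) (4 * N (y true true)); first by exists true, true.
  have [|] := leP (N x) (4 * N (y true false)); first by exists true, false.
  have [|] := leP (N x) (4 * N (y false true)); first by exists false, true.
  by exists false, false; lra.
exists (y i j) => _; split => //.
  by case: (i); [left|right].
by case: (j); [left|right].
Qed.

(** Goursat's argument for an abstract additive function of rectangles. Each quadrisection keeps a
    piece with at least a quarter of the modulus and half the side, so at every late stage the
    original modulus is at most [4^n * e * (L / 2^n)^2 = e * L^2], where [e] is the tolerance given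
    to [small] at the limit point. *)
Lemma bisection_eq0 : E P0 P1 Q0 Q1 = 0.
Proof.
apply/eqP; rewrite -normc_eq0 eq_le normc_ge0 andbT.
have /choice[f fP] := step.
pose x n := iter n f ((P0, P1), (Q0, Q1)).
have okx n : ok (x n).
  elim: n => [|n IH]; first by split; split.
  have [h1 h2 _] := fP _ IH; case: IH => [[a1 a2 a3] [b1 b2 b3]].
  have [c1 c2 c3 _] := halfP a2 h1; have [d1 d2 d3 _] := halfP b2 h2.
  by split; split => //=; rewrite -?/(x n); lra.
have h1 n : half (x n).1 (x n.+1).1 by have [] := fP _ (okx n).
have h2 n : half (x n).2 (x n.+1).2 by have [] := fP _ (okx n).
have [p pP] : exists p, forall n, (x n).1.1 <= p <= (x n).1.2.
  by apply: nested_point => n;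
    have [[_ le _] _] := okx n => //; have [? ? ? ?] := halfP le (h1 n).
have [q qP] : exists q, forall n, (x n).2.1 <= q <= (x n).2.2.
  by apply: nested_point => n;
    have [_ [_ le _]] := okx n => //; have [? ? ? ?] := halfP le (h2 n).
pose L := (P1 - P0) + (Q1 - Q0).
have L0 : 0 <= L by rewrite addr_ge0 ?subr_ge0.
have side n : ((x n).1.2 - (x n).1.1) + ((x n).2.2 - (x n).2.1) = L / 2 ^+ n.
  elim: n => [|n IH]; first by rewrite expr0 divr1.
  have [[_ le1 _] [_ le2 _]] := okx n.
  have [_ _ _ ->] := halfP le1 (h1 n); have [_ _ _ ->] := halfP le2 (h2 n).
  by rewrite exprSr invfM mulrA -IH; field.
have Nx n : N (x 0%N) <= 4 ^+ n * N (x n).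
  elim: n => [|n IH]; first by rewrite expr0 mul1r.
  rewrite (le_trans IH)// exprSr -mulrA ler_pM2l ?exprn_gt0//.
  by have [] := fP _ (okx n).
apply/ler_addgt0Pl => e e0; rewrite addr0.
(* [L^2 + 1] instead of [L^2], since the rectangle may degenerate to a point. *)
have e'0 : 0 < e / (L ^+ 2 + 1) by rewrite divr_gt0// ltr_wpDl// sqr_ge0.
have [d d0 dP] := small (pP 0%N) (qP 0%N) e'0.
have [n nP] : exists n, L / 2 ^+ n < d.
  exists (Num.bound (L / d)); rewrite ltr_pdivrMr ?exprn_gt0// mulrC -ltr_pdivrMr//.
  exact: upper_nthrootP.
apply: le_trans (Nx n) _.
have [[? ? ?] [? ? ?]] := okx n.
have := dP (x n).1.1 (x n).1.2 (x n).2.1 (x n).2.2; rewrite side.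
move=> /(_ _ (pP n) _ _ (qP n) _ nP) H.
have {}H : N (x n) <= e / (L ^+ 2 + 1) * (L / 2 ^+ n) ^+ 2 by exact: H.
have n0 : (0 : R) < 4 ^+ n by rewrite exprn_gt0.
rewrite (le_trans (ler_wpM2l (ltW n0) H))//.
have -> : 4 ^+ n * (e / (L ^+ 2 + 1) * (L / 2 ^+ n) ^+ 2) =
    e * (L ^+ 2 / (L ^+ 2 + 1)).
  have -> : 4 ^+ n = (2 ^+ n) ^+ 2 :> R by rewrite -exprM mulnC exprM; congr (_ ^+ n); ring.
  have : (2 : R) ^+ n != 0 by rewrite expf_neq0.
  move: (2 ^+ n) => w w0; field.
  by rewrite w0 andbT gt_eqF// ltr_wpDl// sqr_ge0.
rewrite ler_piMr ?(ltW e0)// ler_pdivrMr ?mul1r ?lerDl//.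
by rewrite ltr_wpDl// sqr_ge0.
Qed.

End bisection.

(** * Cauchy's theorem between homothetic curves *)

Section star_goursat.
Variable R : realType.
Implicit Types (g k : R -> R[i]).

Lemma pder_path (c : R[i]) (p : R) (b : R -> R[i]) q l : pder b q l ->
  pder (fun q => c + p%:C * b q) q (p%:C * l).
Proof.
move=> db; have := pderD (pder_cst c q) (pderZ p%:C db).
by rewrite add0r.
Qed.

Lemma pder_ray (c u : R[i]) (p : R) :
  pder (fun p : R => c + p%:C * u) p u.
Proof.
have := pderD (pder_cst c p) (pderM (pder_real p) (pder_cst u p)).
by rewrite add0r mul1r mulr0 addr0.
Qed.

Lemma path_lipschitz (b b' : R -> R[i]) (B : R) :
  (forall q, pder b q (b' q)) -> (forall q, ccont b' q) ->
  (forall q, normc (b' q) <= B) ->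
  forall q q0, normc (b q - b q0) <= 2 * B * `|q - q0|.
Proof.
move=> db cb' bB q q0.
wlog le : q q0 / q0 <= q => [hw|].
  have [|/ltW] := leP q0 q; first exact: hw.
  by rewrite normc_distC distrC; exact: hw.
rewrite -(@FTC_cint R q0 q b b')// ger0_norm ?subr_ge0// -mulrA.
by apply: cint_bound => // x _; exact: cb'.
Qed.

(* [G] is a primitive of the affine approximation of [K] at [u]. *)
Lemma cint_affine_approx (K : R[i] -> R[i]) (g g' : R -> R[i]) (u k l : R[i])
    (s0 s1 w M : R) : s0 <= s1 -> 0 <= w ->
  {in `[s0, s1], forall s, pder g s (g' s)} -> ccont_on s0 s1 g' ->
  ccont_on s0 s1 (fun s => K (g s)) ->
  {in `[s0, s1], forall s, normc (K (g s) - k - l * (g s - u)) <= w} ->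
  {in `[s0, s1], forall s, normc (g' s) <= M} ->
  forall G, G =1 (fun v => k * (v - u) + l / 2 * (v - u) ^+ 2) ->
  normc (cint s0 s1 (fun s => K (g s) * g' s) - (G (g s1) - G (g s0)))
    <= 2 * (w * M * (s1 - s0)).
Proof.
move=> s01 w0 dg cg' cK Kw gM G /funext ->.
have cg : ccont_on s0 s1 g by move=> s /dg; exact: pder_ccont.
pose A s := k + l * (g s - u).
have cA : ccont_on s0 s1 A.
  move=> s /cg cgs; apply: ccontD (ccont_cst _ _) _.
  exact: ccontM (ccont_cst _ _) (ccontB cgs (ccont_cst _ _)).
have dG : {in `[s0, s1], forall s, pder (fun s =>
    k * (g s - u) + l / 2 * (g s - u) ^+ 2) s (A s * g' s)}.
  move=> s /dg ds; have d1 := pderD ds (pder_cst (- u) s).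
  have := pderD (pderZ k d1) (pderZ (l / 2) (pderM d1 d1)).
  rewrite (_ : A s * g' s = k * (g' s + 0) + l / 2 * ((g' s + 0) * (g s - u) +
    (g s - u) * (g' s + 0))); last by rewrite /A; field.
  by under [fun s => k * (g s - u) + _]funext do rewrite expr2.
have cAg : ccont_on s0 s1 (fun s => A s * g' s).
  by move=> s sI; apply: ccontM; [exact: cA|exact: cg'].
have cKg : ccont_on s0 s1 (fun s => K (g s) * g' s).
  by move=> s sI; apply: ccontM; [exact: cK|exact: cg'].
rewrite -(FTC_cint s01 dG)// -cintB//.
apply: cint_bound => //.
  by move=> s sI; apply: ccontB; [exact: cKg|exact: cAg].
move=> s sI; rewrite -mulrBl normcM ler_pM ?normc_ge0//; last exact: gM.
by rewrite /A opprD addrA; exact: Kw.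
Qed.

Section homothety.
Variables (K : R[i] -> R[i]) (c : R[i]) (b b' : R -> R[i]) (B P0 P1 Q0 Q1 : R).
Hypotheses (P0ge0 : 0 <= P0) (P01 : P0 <= P1) (Q01 : Q0 <= Q1).
Hypothesis db : forall q, pder b q (b' q).
Hypothesis cb' : forall q, ccont b' q.
Hypothesis bB : forall q, normc (b q) <= B.
Hypothesis b'B : forall q, normc (b' q) <= B.
Hypothesis dK : forall p q, P0 <= p <= P1 -> cdifferentiable K (c + p%:C * b q).

Let phi (p q : R) := c + p%:C * b q.
Let edgeQ p q0 q1 := cint q0 q1 (fun q => K (phi p q) * (p%:C * b' q)).
Let edgeP q p0 p1 := cint p0 p1 (fun p => K (phi p q) * b q).
(** The integral of [K] along the boundary of the image of a parameter rectangle under [phi]: two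
    arcs of homothetic curves and two radial segments. *)
Let E p0 p1 q0 q1 :=
  (edgeQ p1 q0 q1 - edgeQ p0 q0 q1) - (edgeP q1 p0 p1 - edgeP q0 p0 p1).

Let cKQ p q0 q1 : P0 <= p <= P1 -> ccont_on q0 q1 (fun q => K (phi p q)).
Proof.
move=> pI q _; apply: (ccont_comp (g := phi p)); last exact: dK.
exact: pder_ccont (pder_path c p (db q)).
Qed.

Let cKP q p0 p1 : P0 <= p0 -> p1 <= P1 ->
  ccont_on p0 p1 (fun p => K (phi p q)).
Proof.
move=> p0I p1I p; rewrite in_itv /= => /andP[pl pr].
apply: (ccont_comp (g := fun p => phi p q)).
  exact: pder_ccont (pder_ray c (b q) p).
by apply: dK; rewrite (le_trans p0I)// (le_trans pr).
Qed.

Let cQ p q0 q1 : P0 <= p <= P1 ->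
  ccont_on q0 q1 (fun q => K (phi p q) * (p%:C * b' q)).
Proof.
move=> pI q qI; apply: ccontM; first exact: (cKQ pI qI).
exact: ccontM (ccont_cst _ _) (cb' q).
Qed.

Let cP q p0 p1 : P0 <= p0 -> p1 <= P1 ->
  ccont_on p0 p1 (fun p => K (phi p q) * b q).
Proof.
move=> p0I p1I p pI; apply: ccontM; first exact: (cKP _ p0I p1I pI).
exact: ccont_cst.
Qed.

Let E_addP p0 p p1 q0 q1 : P0 <= p0 -> p0 <= p -> p <= p1 ->
  p1 <= P1 -> Q0 <= q0 -> q0 <= q1 -> q1 <= Q1 ->
  E p0 p1 q0 q1 = E p0 p q0 q1 + E p p1 q0 q1.
Proof.
move=> P0p0 p0p pp1 p1P1 _ _ _; rewrite /E /edgeP.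
rewrite (@cint_split _ p0 p1 p (fun p => K (phi p q1) * b q1))//; last exact: cP.
rewrite (@cint_split _ p0 p1 p (fun p => K (phi p q0) * b q0))//; last exact: cP.
ring.
Qed.

Let E_addQ p0 p1 q0 q q1 : P0 <= p0 -> p0 <= p1 ->
  p1 <= P1 -> Q0 <= q0 -> q0 <= q -> q <= q1 -> q1 <= Q1 ->
  E p0 p1 q0 q1 = E p0 p1 q0 q + E p0 p1 q q1.
Proof.
move=> P0p0 p0p1 p1P1 _ q0q qq1 _; rewrite /E /edgeQ.
rewrite (@cint_split _ q0 q1 q (fun q => K (phi p1 q) * _))//; last first.
  by apply: cQ; rewrite p1P1 (le_trans P0p0).
rewrite (@cint_split _ q0 q1 q (fun q => K (phi p0 q) * _))//; last first.
  by apply: cQ; rewrite P0p0 (le_trans p0p1).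
ring.
Qed.

(** [M] dominates both partial derivatives of [phi], namely [b q] and [p * b' q]. *)
Let M := (1 + P1) * B.
Let B0 : 0 <= B. Proof. exact: le_trans (normc_ge0 _) (bB 0). Qed.
Let P1ge0 : 0 <= P1. Proof. exact: le_trans P01. Qed.
Let M0 : 0 <= M. Proof. by rewrite mulr_ge0// addr_ge0. Qed.

Let phi_lip p q p' q' : 0 <= p <= P1 -> 
  normc (phi p' q' - phi p q) <= 2 * M * (`|p' - p| + `|q' - q|).
Proof.
move=> /andP[p0 p1].
have -> : phi p' q' - phi p q = (p' - p)%:C * b q' + p%:C * (b q' - b q).
  by rewrite /phi rmorphB /=; ring.
rewrite (le_trans (normc_triangle _ _))// !normcM !normc_real [`|p|]ger0_norm//.
have h1 : `|p' - p| * normc (b q') <= `|p' - p| * B by rewrite ler_wpM2l.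
have h2 : p * normc (b q' - b q) <= P1 * (2 * B * `|q' - q|).
  by rewrite ler_pM ?normc_ge0//; exact: path_lipschitz.
apply: le_trans (lerD h1 h2) _.
have : 0 <= `|p' - p| * B by rewrite mulr_ge0.
have : 0 <= `|q' - q| * B by rewrite mulr_ge0.
have : 0 <= P1 * (`|p' - p| * B) by rewrite !mulr_ge0.
rewrite /M; lra.
Qed.

(** On each edge [K] is replaced by its affine approximation at [phi p q], whose primitive [G]
    telescopes over the four corners. What remains is the error [w] times the edge lengths, which is
    quadratic in the size [s] of the rectangle. *)
Let E_small p q : P0 <= p <= P1 -> Q0 <= q <= Q1 ->
  forall e, 0 < e -> exists2 d, 0 < d & forall p0 p1 q0 q1,
    P0 <= p0 -> p0 <= p <= p1 -> p1 <= P1 ->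
    Q0 <= q0 -> q0 <= q <= q1 -> q1 <= Q1 ->
    (p1 - p0) + (q1 - q0) < d ->
    normc (E p0 p1 q0 q1) <= e * ((p1 - p0) + (q1 - q0)) ^+ 2.
Proof.
move=> pI _ e e0; have := P0ge0; have := P1ge0 => P1_ge0 P0_ge0.
have [l Kl] := dK q pI.
have D0 : 0 < 8 * M ^+ 2 + 1 by rewrite ltr_wpDl// mulr_ge0// sqr_ge0.
have [d d0 dP] := Kl _ (divr_gt0 e0 D0).
have D'0 : 0 < 2 * M + 1 by rewrite ltr_wpDl// mulr_ge0.
exists (d / (2 * M + 1)); first by rewrite divr_gt0.
move=> p0 p1 q0 q1 P0p0 /andP[p0p pp1] p1P1 Q0q0 /andP[q0q qq1] q1Q1.
rewrite ltr_pdivlMr//; set s := (_ + _) => sd.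
have s0 : 0 <= s by rewrite /s; lra.
(* The four edges add up to [4 * w * M * s = 8 * eta * M^2 * s^2]; the [+ 1] avoids a division by
   0. *)
pose eta := e / (8 * M ^+ 2 + 1).
pose w := eta * (2 * M * s).
have eta0 : 0 <= eta by rewrite divr_ge0// ltW.
have Ms0 : 0 <= 2 * M * s by apply: mulr_ge0 => //; exact: mulr_ge0.
have w0 : 0 <= w by exact: mulr_ge0.
have Kw p' q' : p0 <= p' <= p1 -> q0 <= q' <= q1 ->
    normc (K (phi p' q') - K (phi p q) - l * (phi p' q' - phi p q)) <= w.
  move=> p'I q'I; set h := phi p' q' - phi p q.
  have hs : normc h <= 2 * M * s.
    apply: le_trans (phi_lip q p' q' _) _; first lra.
    apply: ler_wpM2l; [exact: mulr_ge0|rewrite /s].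
    have : `|p' - p| <= p1 - p0 by rewrite ler_norml; lra.
    have : `|q' - q| <= q1 - q0 by rewrite ler_norml; lra.
    lra.
  have hE : c + p%:C * b q + h = phi p' q' by rewrite /h [LHS]addrC subrK.
  have hd : normc h < d by rewrite (le_lt_trans hs)// (le_lt_trans _ sd)//; lra.
  have H := dP h hd; rewrite hE in H; apply: le_trans H _.
  by rewrite ler_wpM2l.
pose G v := K (phi p q) * (v - phi p q) + l / 2 * (v - phi p q) ^+ 2.
have eQ p' : p0 <= p' <= p1 ->
    normc (edgeQ p' q0 q1 - (G (phi p' q1) - G (phi p' q0))) <=
    2 * (w * M * (q1 - q0)).
  move=> p'I; apply: (@cint_affine_approx K (phi p') (fun q => p'%:C * b' q)
    (phi p q) (K (phi p q)) l q0 q1 w M _ w0 _ _ _ _ _ G (fun=> erefl)).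
  - lra.
  - by move=> q' _; exact: pder_path.
  - by move=> q' _; exact: ccontM (ccont_cst _ _) (cb' _).
  - by apply: cKQ; lra.
  - by move=> q'; rewrite in_itv /=; exact: Kw.
  - move=> q' _; rewrite normcM normc_real ger0_norm; last lra.
    rewrite /M; apply: ler_pM; [lra|exact: normc_ge0|lra|exact: b'B].
have eP q' : q0 <= q' <= q1 ->
    normc (edgeP q' p0 p1 - (G (phi p1 q') - G (phi p0 q'))) <=
    2 * (w * M * (p1 - p0)).
  move=> q'I; apply: (@cint_affine_approx K (phi ^~ q') (fun=> b q')
    (phi p q) (K (phi p q)) l p0 p1 w M _ w0 _ _ _ _ _ G (fun=> erefl)).
  - lra.
  - by move=> p' _; exact: pder_ray.
  - by move=> p' _; exact: ccont_cst.
  - exact: cKP.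
  - by move=> p'; rewrite in_itv /= => p'I; exact: Kw.
  - move=> p' _; apply: le_trans (bB _) _; rewrite /M.
    by apply: ler_peMl; [exact: B0|rewrite lerDl].
have h1 := eQ p1 ltac:(lra); have h0 := eQ p0 ltac:(lra).
have k1 := eP q1 ltac:(lra); have k0 := eP q0 ltac:(lra).
have -> : E p0 p1 q0 q1 =
    ((edgeQ p1 q0 q1 - (G (phi p1 q1) - G (phi p1 q0))) -
     (edgeQ p0 q0 q1 - (G (phi p0 q1) - G (phi p0 q0)))) -
    ((edgeP q1 p0 p1 - (G (phi p1 q1) - G (phi p0 q1))) -
     (edgeP q0 p0 p1 - (G (phi p1 q0) - G (phi p0 q0)))).
  by rewrite /E; ring.
rewrite (le_trans (normc_sub _ _))//.
rewrite (le_trans (lerD (normc_sub _ _) (normc_sub _ _)))//.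
rewrite (le_trans (lerD (lerD h1 h0) (lerD k1 k0)))//.
have -> : 2 * (w * M * (q1 - q0)) + 2 * (w * M * (q1 - q0)) +
  (2 * (w * M * (p1 - p0)) + 2 * (w * M * (p1 - p0))) =
  eta * (8 * M ^+ 2) * s ^+ 2 by rewrite /w /s; ring.
rewrite ler_wpM2r ?sqr_ge0// /eta -mulrA ler_piMr ?(ltW e0)//.
by rewrite mulrC ler_pdivrMr// mul1r lerDl.
Qed.

(** As [b] is closed, the two radial edges of the full rectangle coincide and cancel, leaving the
    two curves. For [P0 > 0] the function [K] may be singular at the centre [c]. *)
Lemma star_goursat : b Q0 = b Q1 ->
  cint Q0 Q1 (fun q => K (c + P1%:C * b q) * (P1%:C * b' q)) =
  cint Q0 Q1 (fun q => K (c + P0%:C * b q) * (P0%:C * b' q)).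
Proof.
move=> bQ; have := bisection_eq0 P01 Q01 E_addP E_addQ E_small.
rewrite /E /edgeP /phi bQ subrr subr0 => /eqP; rewrite subr_eq0 => /eqP.
exact.
Qed.

End homothety.
End star_goursat.

(** * Tonelli's theorem for continuous integrands *)

Section tonelli_continuous.
Variable R : realType.
Notation mu := (@lebesgue_measure R).

Definition continuous2 (g : R -> R -> R) := forall a t e, 0 < e ->
  exists2 d, 0 < d & forall a' t', `|a' - a| < d -> `|t' - t| < d ->
    `|g a' t' - g a t| < e.

(** A superlevel set of [g] is open, hence a countable union of boxes with rational centre and size,
    and these are measurable in the product. *)
Lemma continuous2_measurable (g : R -> R -> R) : continuous2 g ->
  measurable_fun [set: measurableTypeR R * measurableTypeR R]
    (fun z => g z.1 z.2).
Proof.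
move=> cg; apply: (measurability _ (RGenOInfty.measurableE R)).
move=> _ [_ [x ->] <-]; rewrite setTI.
set A := (X in measurable X).
pose box (q : rat * rat * rat) : set (measurableTypeR R * measurableTypeR R) :=
  `]ratr q.1.1 - ratr q.2, ratr q.1.1 + ratr q.2[%classic `*`
  `]ratr q.1.2 - ratr q.2, ratr q.1.2 + ratr q.2[%classic.
rewrite (_ : A = \bigcup_(q in setT) (if pselect (box q `<=` A) then box q else set0)).
  apply: countable_bigcupT_measurable => //.
  by move=> q; case: pselect => [?|?] //=; apply: measurableX; exact: measurable_itv.
apply/seteqP; split; last first.
  by move=> z [q qT]; case: pselect => // qA; exact: qA.
move=> z At.
pose a := z.1; pose t := z.2.
have e0 : 0 < g a t - x by move: At; rewrite /A /= in_itv /= andbT subr_gt0.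
have [d d0 dP] := cg a t _ e0.
(* With half-side below [d / 2] and centre within a half-side of the point, the whole box stays
   within [d] of it. *)
have [e] := rat_in_itvoo (divr_gt0 d0 (ltr0n R 2)); rewrite in_itv /= => /andP[e00 ed].
have [p] := @rat_in_itvoo R (a - ratr e) (a + ratr e) ltac:(lra).
rewrite in_itv /= => pP.
have [s] := @rat_in_itvoo R (t - ratr e) (t + ratr e) ltac:(lra).
rewrite in_itv /= => sP.
exists (p, s, e) => //; case: pselect => [?|[]].
  by rewrite /box; split => /=; rewrite in_itv /=; lra.
move=> z' [/=]; rewrite !in_itv /= => a'P t'P.
rewrite /A /= in_itv /= andbT.
have := dP z'.1 z'.2.
rewrite !ltr_norml => /(_ ltac:(lra) ltac:(lra)); lra.
Qed.

(** Extending the integrand by 0 outside the rectangle reduces this to Tonelli's theorem on the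
    whole product. *)
Lemma continuous2_tonelli (g : R -> R -> R) (a b c d : R) : continuous2 g ->
  (forall x y, 0 <= g x y) ->
  (\int[mu]_(x in `[a, b]) \int[mu]_(y in `[c, d]) (g x y)%:E =
   \int[mu]_(y in `[c, d]) \int[mu]_(x in `[a, b]) (g x y)%:E)%E.
Proof.
move=> cg g0.
pose D := (`[a, b]%classic `*` `[c, d]%classic) : set (measurableTypeR R * measurableTypeR R).
pose F : measurableTypeR R * measurableTypeR R -> \bar R := (fun z => (g z.1 z.2)%:E) \_ D.
have F0 z : (0 <= F z)%E by rewrite /F patchE; case: ifP => // _; rewrite lee_fin.
have mF : measurable_fun [set: measurableTypeR R * measurableTypeR R] F.
  apply/(measurable_restrictT _ _).1; first by apply: measurableX; exact: measurable_itv.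
  apply/measurable_EFinP; apply: measurable_funTS; exact: continuous2_measurable.
have := @fubini_tonelli _ _ _ _ _ mu mu F mF F0.
congr (_ = _).
  rewrite [RHS]integral_mkcond; apply: eq_integral => x _.
  rewrite patchE; case: ifPn => xab.
    rewrite [RHS]integral_mkcond; apply: eq_integral => y _.
    rewrite /F !patchE; congr (if _ then _ else _).
    apply/idP/idP; rewrite !inE /D /=; first by case.
    by move=> ?; split => //=; rewrite inE in xab.
  apply: integral0_eq => y _; rewrite /F patchE ifF//.
  apply/negP; rewrite inE /D /= => -[+ _]; move/negP: xab; rewrite inE; exact.
rewrite [RHS]integral_mkcond; apply: eq_integral => y _.
rewrite patchE; case: ifPn => ycd.
  rewrite [RHS]integral_mkcond; apply: eq_integral => x _.
  rewrite /F !patchE; congr (if _ then _ else _).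
  apply/idP/idP; rewrite !inE /D /=; first by case.
  by move=> ?; split => //=; rewrite inE in ycd.
apply: integral0_eq => x _; rewrite /F patchE ifF//.
apply/negP; rewrite inE /D /= => -[_ +]; move/negP: ycd; rewrite inE; exact.
Qed.

Lemma continuous2_integral_measurable (g : R -> R -> R) (c d : R) :
  continuous2 g -> (forall x y, 0 <= g x y) ->
  measurable_fun [set: measurableTypeR R]
    (fun x => \int[mu]_(y in `[c, d]) (g x y)%:E)%E.
Proof.
move=> cg g0.
pose D := (setT `*` `[c, d]%classic) : set (measurableTypeR R * measurableTypeR R).
pose F : measurableTypeR R * measurableTypeR R -> \bar R :=
  (fun z => (g z.1 z.2)%:E) \_ D.
have F0 z : (0 <= F z)%E by rewrite /F patchE; case: ifP => // _; rewrite lee_fin.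
have mF : measurable_fun [set: measurableTypeR R * measurableTypeR R] F.
  apply/(measurable_restrictT _ _).1.
    by apply: measurableX; [exact: measurableT|exact: measurable_itv].
  apply/measurable_EFinP; apply: measurable_funTS; exact: continuous2_measurable.
have := @measurable_fun_fubini_tonelli_F _ _ _ _ _ mu F mF F0.
congr measurable_fun; apply/funext => x.
rewrite /fubini_F [RHS]integral_mkcond; apply: eq_integral => y _.
rewrite /F !patchE; congr (if _ then _ else _).
by apply/idP/idP; rewrite !inE /D /=; [case|move=> ?; split].
Qed.

End tonelli_continuous.

(** * Cauchy's formula along a closed curve *)

Section cauchy_formula.
Variable R : realType.

Definition expi (t : R) : R[i] := cos t +i* sin t.

Lemma pder_expi t : pder expi t ('i%C * expi t).
Proof.
by split => /=; rewrite !(mul0r, mul1r, add0r, sub0r, addr0);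
  [exact: is_derive_cos|exact: is_derive_sin].
Qed.

Lemma normc_expi t : normc (expi t) = 1.
Proof. by rewrite /expi /= cos2Dsin2 sqrtr1. Qed.

Lemma expi2pi : expi (2 * pi) = expi 0.
Proof. by rewrite /expi mulr_natl cos2pi sin2pi cos0 sin0. Qed.

Lemma normc_i : normc ('i%C : R[i]) = 1.
Proof. by rewrite /= expr0n /= add0r expr1n sqrtr1. Qed.

Lemma expi_lipschitz t u : normc (expi t - expi u) <= 2 * `|t - u|.
Proof.
rewrite -[2 in leRHS]mulr1.
apply: (@path_lipschitz R expi (fun t => 'i%C * expi t)).
- exact: pder_expi.
- by move=> q; exact: ccontM (ccont_cst _ _) (pder_ccont (pder_expi q)).
- by move=> q; rewrite normcM normc_i normc_expi mul1r.
Qed.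

Lemma cderiv_bound (f : R[i] -> R[i]) w l : cderiv f w l ->
  exists2 d, 0 < d & forall h, normc h < d ->
    normc (f (w + h) - f w) <= (normc l + 1) * normc h.
Proof.
move=> fl; have [d d0 dP] := fl _ (ltr01 : 0 < 1 :> R).
exists d => // h /dP hd; rewrite -(subrK (l * h) (_ - _)).
by rewrite (le_trans (normc_triangle _ _))// normcM addrC mulrDl lerD.
Qed.

Lemma le_small_eq0 (x C d : R) : 0 < d -> 0 <= x ->
  (forall p, 0 < p -> p < d -> x <= C * p) -> x = 0.
Proof.
move=> d0 x0 H; apply/eqP; rewrite eq_le x0 andbT.
apply/ler_addgt0Pl => e e0; rewrite addr0.
pose p := Num.min (d / 2) (e / (`|C| + 1)).
have C1 : 0 < `|C| + 1 by rewrite ltr_wpDl.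
have p0 : 0 < p by rewrite lt_min !divr_gt0.
have pd : p < d by rewrite gt_min; apply/orP; left; lra.
apply: (le_trans (H p p0 pd)).
apply: (@le_trans _ _ ((`|C| + 1) * p)).
  rewrite ler_pM2r// (le_trans (ler_norm C))//; lra.
by rewrite mulrC -ler_pdivlMr// ge_min lexx orbT.
Qed.

Section closed_curve.
Variables (f : R[i] -> R[i]) (w : R[i]) (b b' : R -> R[i]) (B m Q0 Q1 : R).
Hypothesis Q01 : Q0 <= Q1.
Hypothesis db : forall q, pder b q (b' q).
Hypothesis cb' : forall q, ccont b' q.
Hypothesis bB : forall q, normc (b q) <= B.
Hypothesis b'B : forall q, normc (b' q) <= B.
Hypothesis b0 : forall q, b q != 0.
Hypothesis bQ : b Q0 = b Q1.
Hypothesis df : forall p q, 0 <= p <= 1 -> cdifferentiable f (w + p%:C * b q).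

Let B0 : 0 <= B. Proof. exact: le_trans (normc_ge0 _) (bB 0). Qed.

(** The divided difference is differentiable away from [w], so the curve may be shrunk towards [w].
    There the quotient is bounded by [|l| + 1] while the length of the curve tends to 0. *)
Lemma cint_divided_difference :
  cint Q0 Q1 (fun q => (f (w + b q) - f w) / b q * b' q) = 0.
Proof.
pose K u := (f u - f w) / (u - w).
have dK p q : 0 < p <= 1 -> cdifferentiable K (w + p%:C * b q).
  move=> /andP[p0 p1]; apply: cdifferentiableM.
    by apply/cdifferentiableB/cdifferentiable_cst/df; rewrite (ltW p0).
  apply: cdifferentiableV.
    rewrite [w + _]addrC addrK mulf_neq0// -normc_eq0 normc_real.
    by rewrite normr_eq0 gt_eqF.
  exact/cdifferentiableB/cdifferentiable_cst/cdifferentiable_id.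
pose J p := cint Q0 Q1 (fun q => K (w + p%:C * b q) * (p%:C * b' q)).
have J1 : J 1 = cint Q0 Q1 (fun q => (f (w + b q) - f w) / b q * b' q).
  by apply: eq_cint => q _; rewrite !mul1r /K [w + _ - w]addrC addKr.
have Jp p : 0 < p -> p <= 1 -> J 1 = J p.
  move=> p0 p1; apply: (star_goursat (B := B)) => //; first exact: ltW.
  by move=> p' q /andP[pp' p'1]; apply: dK; rewrite (lt_le_trans p0).
rewrite -J1; apply/eqP; rewrite -normc_eq0; apply/eqP.
have [l fl] : cdifferentiable f w.
  by have := @df 0 0; rewrite lexx ler01 mul0r addr0; exact.
have [d d0 dP] := cderiv_bound fl.
have B1 : 0 < B + 1 by rewrite ltr_wpDl.
pose d' := Num.min 1 (d / (B + 1)).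
have d'0 : 0 < d' by rewrite lt_min ltr01 divr_gt0.
apply: (@le_small_eq0 _ (2 * ((normc l + 1) * B * (Q1 - Q0))) d' d'0) => [|p p0].
  exact: normc_ge0.
rewrite lt_min => /andP[p1 pd]; rewrite (Jp p p0 (ltW p1)).
have cJ : ccont_on Q0 Q1 (fun q => K (w + p%:C * b q) * (p%:C * b' q)).
  move=> q _; apply: ccontM; last exact: ccontM (ccont_cst _ _) (cb' q).
  apply: (ccont_comp (g := fun q => w + p%:C * b q)).
    exact: pder_ccont (pder_path w p (db q)).
  by apply: dK; rewrite p0 ltW.
rewrite (_ : _ * p = 2 * ((normc l + 1) * (p * B) * (Q1 - Q0))); last by ring.
apply: cint_bound => // q _; rewrite normcM; apply: ler_pM; rewrite ?normc_ge0//.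
  have h0 : p%:C * b q != 0.
    by rewrite mulf_neq0// -normc_eq0 normc_real normr_eq0 gt_eqF.
  rewrite /K [w + _ - w]addrC addKr normcf_div ler_pdivrMr ?normc_gt0//.
  apply: dP; rewrite normcM normc_real gtr0_norm//.
  move: pd; rewrite ltr_pdivlMr//; apply: le_lt_trans.
  by rewrite ler_wpM2l ?(ltW p0)// (le_trans (bB q))// lerDl.
by rewrite normcM normc_real gtr0_norm// ler_wpM2l// ltW.
Qed.

(** The integral of [b' / b] is left unevaluated, which spares the computation of a winding number;
    in the end only a lower bound for its modulus enters. *)
Lemma cauchy_closed_curve :
  f w * cint Q0 Q1 (fun q => (b q)^-1 * b' q) =
  cint Q0 Q1 (fun q => f (w + b q) * ((b q)^-1 * b' q)).
Proof.
have cV q : ccont (fun q => (b q)^-1 * b' q) q.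
  exact: ccontM (pder_ccont (pderV (b0 q) (db q))) (cb' q).
have cf q : ccont (fun q => f (w + b q)) q.
  have -> : (fun q => f (w + b q)) = (fun q => f (w + 1%:C * b q)).
    by apply/funext => ?; rewrite mul1r.
  apply: (ccont_comp (g := fun q => w + 1%:C * b q)).
    exact: pder_ccont (pder_path w 1 (db q)).
  by apply: df; rewrite ler01 lexx.
have cVon : ccont_on Q0 Q1 (fun q => (b q)^-1 * b' q) by move=> q _; exact: cV.
apply/esym/eqP; rewrite -subr_eq0 -(cintZ (f w) cVon) -cintB.
- apply/eqP; rewrite -[RHS]cint_divided_difference; apply: eq_cint => q _.
  by ring.
- by move=> q _; exact: ccontM (cf q) (cV q).
- by move=> q _; exact: ccontM (ccont_cst _ _) (cV q).
Qed.

End closed_curve.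
End cauchy_formula.

(** * Functions with bounded mean squares on horizontal lines *)

Section horizontal_traces.
Variable R : realType.
Notation mu := (@lebesgue_measure R).

Lemma EFin_Rintegral (f : R -> R) a b : {in `[a, b], continuous f} ->
  (\int[mu]_(x in `[a, b]) f x)%R%:E = (\int[mu]_(x in `[a, b]) (f x)%:E)%E.
Proof.
move=> cf; rewrite /Rintegral fineK//.
apply: (@integrable_fin_num _ _ _ mu _ _ (EFin \o f)) => //.
exact: continuous_integrable.
Qed.

Lemma integral_itv_shift (G : R -> R) (c a b : R) : a <= b -> continuous G ->
  (\int[mu]_(x in `[(a + c)%R, (b + c)%R]) (G x)%:E =
   \int[mu]_(x in `[a, b]) (G (x + c)%R)%:E)%E.
Proof.
move=> ab cG; pose F (x : R) := x + c.
have dF (x : R) : is_derive x 1 F 1.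
  by rewrite -[1 in X in is_derive _ _ _ X]addr0; exact: is_deriveD.
have F1 : F^`()%classic = cst 1 by apply/funext => x; rewrite derive1E derive_val.
have cF (x : R) : {for x, continuous F}.
  by have [dx _] := dF x; exact: differentiable_continuous ((derivable1_diffP _ _).1 dx).
rewrite (@integration_by_substitution_increasing R F G a b)//.
- by apply: eq_integral => x _; rewrite F1 /= mulr1.
- by move=> x y _ _; rewrite ltrD2r.
- by rewrite F1 => x _; exact: cvg_cst.
- by rewrite F1; apply: is_cvg_cst.
- by rewrite F1; apply: is_cvg_cst.
- split.
  + by move=> x _; have [] := dF x.
  + exact: cvg_at_right_filter (cF a).
  + exact: cvg_at_left_filter (cF b).
- by apply: continuous_subspaceT => x; exact: cG.
Qed.

Lemma Rintegral_ge_cst (f : R -> R) (a b M : R) : a <= b -> {in `[a, b], continuous f} ->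
  {in `[a, b], forall x, M <= f x} ->
  M * (b - a) <= (\int[mu]_(x in `[a, b]) f x)%R.
Proof.
move=> ab cf fM; rewrite -lebesgue_itvcc// -Rintegral_cst//.
apply: le_Rintegral => //; last exact: continuous_integrable.
by apply: continuous_integrable => x _; exact: cvg_cst.
Qed.

(** Applied to [b] and [b'], this is the angular speed of a curve about the origin; its positivity
    bounds a winding integral from below. *)
Lemma Im_invM (x y : R[i]) : complex.Im (x^-1 * y) =
  (complex.Re x * complex.Im y - complex.Im x * complex.Re y) / normc x ^+ 2.
Proof. by case: x => a b; case: y => c d; rewrite normc_sqr /=; ring. Qed.

Lemma Im_ge (w h : R[i]) : complex.Im w - normc h <= complex.Im (w + h).
Proof.
rewrite cImD lerD2l lerNl (le_trans _ (normc_Im h))//.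
by rewrite -normrN ler_norm.
Qed.

Section bounded.
Variables (f : R[i] -> R[i]) (K : R).
Hypothesis df : forall w, 0 < complex.Im w -> cdifferentiable f w.
Hypothesis fK : forall y, 0 < y ->
  (\int[mu]_x (normc (f (x +i* y)) ^+ 2)%:E <= K%:E)%E.

Let cf_line (y : R) : 0 < y -> continuous (fun x : R => normc (f (x +i* y))).
Proof.
move=> y0 x; apply: (ccont_normc (g := fun x : R => f (x +i* y))).
apply: (ccont_comp (g := fun x : R => x +i* y)); last exact: df.
by split; [exact: cvg_id|exact: cvg_cst].
Qed.

Section average.
Variables (w : R[i]) (d : R).
Hypotheses (d0 : 0 < d) (dw : 4 * d <= complex.Im w).

(** Circles of radius [2 * d] shifted horizontally by [a]. For [|a| <= d] each stays at distance at
    least [d] from [w]; for fixed [t] and varying [a] the point moves on a horizontal line, where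
    the mean square of [f] is controlled. Averaging over [a] thus replaces the usual area
    integral. *)
Let b (a t : R) : R[i] := a%:C + (2 * d)%:C * expi t.
Let b' (t : R) : R[i] := (2 * d)%:C * ('i%C * expi t).
Let g (a t : R) : R := normc (f (w + b a t)).

Let db a t : pder (b a) t (b' t).
Proof. exact: (pder_path _ _ (pder_expi t)). Qed.

Let cb' t : ccont b' t.
Proof.
apply: ccontM (ccont_cst _ _) _.
exact: ccontM (ccont_cst _ _) (pder_ccont (pder_expi t)).
Qed.

Let normc_2d t : normc ((2 * d)%:C * expi t) = 2 * d.
Proof. by rewrite normcM normc_expi mulr1 normc_real ger0_norm// mulr_ge0// ltW. Qed.

Let Im_b a t : 0 < complex.Im (w + b a t).
Proof.
rewrite cImD /b cImD /= add0r mul0r addr0.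
have : -1 <= sin t by rewrite sin_geN1.
have := d0; have := dw => dw' d0' s1.
have : d * -1 <= d * sin t by rewrite ler_wpM2l// ltW.
lra.
Qed.

Let g_continuous2 : continuous2 g.
Proof.
move=> a t e e0.
have [d1 d10 dP] := cdifferentiable_continuous (df (Im_b a t)) e0.
have D0 : 0 < 1 + 4 * d by have := d0; lra.
exists (d1 / (1 + 4 * d)); first by rewrite divr_gt0.
move=> a' t'; rewrite !ltr_pdivlMr// => a'd t'd.
apply: le_lt_trans (normc_dist _ _) _.
have -> : w + b a' t' = w + b a t + (b a' t' - b a t) by ring.
apply: dP.
have -> : b a' t' - b a t = (a' - a)%:C + (2 * d)%:C * (expi t' - expi t).
  by rewrite /b rmorphB /=; ring.
apply: le_lt_trans (normc_triangle _ _) _.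
rewrite normcM !normc_real [`|2 * d|]ger0_norm; last by rewrite mulr_ge0// ltW.
have h : 2 * d * normc (expi t' - expi t) <= 2 * d * (2 * `|t' - t|).
  by rewrite ler_wpM2l ?expi_lipschitz// mulr_ge0// ltW.
have h1 : `|a' - a| * (1 + 4 * d) < d1 by [].
have h2 : `|t' - t| * (1 + 4 * d) < d1 by [].
have D1 : 0 < 1 + 4 * d by [].
rewrite -(ltr_pM2r D1).
have k1 : (`|a' - a| + 4 * d * `|t' - t|) * (1 + 4 * d) < d1 * (1 + 4 * d).
  have : 4 * d * (`|t' - t| * (1 + 4 * d)) <= 4 * d * d1.
    by rewrite ler_wpM2l ?(ltW h2)// mulr_ge0// ltW.
  lra.
by apply: le_lt_trans k1; rewrite ler_pM2r// lerD2l (le_trans h)//; lra.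
Qed.

Let cg a : continuous (g a).
Proof.
move=> t; apply: (ccont_normc (g := fun t => f (w + b a t))).
apply: (ccont_comp (g := fun t => w + b a t)); last exact/df/Im_b.
exact: ccontD (ccont_cst _ _) (pder_ccont (db a t)).
Qed.

(** Origin of the constant: [Im (b' / b)] has numerator [4 d^2 + 2 a d cos t >= 2 d^2] and
    denominator at most [9 d^2], so the winding integral is at least [4 pi / 9] in modulus. On the
    other side [|b'| / |b| <= 2], with another 2 from [le_normc_cint]. *)
Let mean_value a : `|a| <= d ->
  normc (f w) * (pi / 9) <= (\int[mu]_(t in `[0, 2 * pi]) g a t)%R.
Proof.
move=> ad; have pi0 := pi_gt0 R; have d0' := d0.
have bge t : d <= normc (b a t).
  have := normcB_ge ((2 * d)%:C * expi t) (- a%:C).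
  rewrite normc_opp normc_2d normc_real opprK [_ + a%:C]addrC -/(b a t); lra.
have ble t : normc (b a t) <= 3 * d.
  apply: le_trans (normc_triangle _ _) _.
  by rewrite normc_2d normc_real; lra.
have b'le t : normc (b' t) <= 3 * d.
  by rewrite /b' mulrCA normcM normc_i mul1r normc_2d; lra.
have b0 t : b a t != 0 by rewrite -normc_gt0 (lt_le_trans d0).
have bQ : b a 0 = b a (2 * pi) by rewrite /b expi2pi.
have pi2 : 0 <= 2 * pi :> R by rewrite mulr_ge0// ltW.
have dfb p t : 0 <= p <= 1 -> cdifferentiable f (w + p%:C * b a t).
  move=> /andP[p0 p1]; apply: df; apply: lt_le_trans (Im_ge _ _).
  rewrite normcM normc_real ger0_norm//.
  have : p * normc (b a t) <= 1 * (3 * d) by rewrite ler_pM// normc_ge0.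
  have := dw; lra.
have cV t : ccont (fun t => (b a t)^-1 * b' t) t.
  exact: ccontM (pder_ccont (pderV (b0 t) (db a t))) (cb' t).
have cfb t : ccont (fun t => f (w + b a t)) t.
  apply: (ccont_comp (g := fun t => w + b a t)); last exact/df/Im_b.
  exact: ccontD (ccont_cst _ _) (pder_ccont (db a t)).
have := cauchy_closed_curve pi2 (db a) cb' ble b'le b0 bQ dfb.
set kappa := cint _ _ _ => E.
have kge : 4 * pi / 9 <= normc kappa.
  apply: le_trans (normc_Im _); apply: le_trans (ler_norm _).
  have -> : 4 * pi / 9 = 2 / 9 * (2 * pi - 0) :> R by field.
  rewrite /kappa /=; apply: Rintegral_ge_cst => // [t _|t _]; first by have [] := cV t.
  change (2 / 9 <= complex.Im ((b a t)^-1 * b' t)).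
  rewrite Im_invM ler_pdivlMr ?exprn_gt0 ?normc_gt0//.
  apply: (@le_trans _ _ (2 / 9 * (3 * d) ^+ 2)).
    by rewrite ler_pM2l// ler_sqr ?nnegrE ?normc_ge0// mulr_ge0// ltW.
  rewrite /b /b' /=.
  have cs := cos2Dsin2 t.
  have : `|a * cos t| <= d * 1 by rewrite normrM ler_pM// cos_max.
  rewrite mulr1 ler_norml => /andP[h1 h2].
  have : d * - d <= d * (a * cos t) by rewrite ler_wpM2l// ltW.
  have -> : 2 * d * sin t + 0 * cos t = 2 * d * sin t by ring.
  have s2 : sin t ^+ 2 = 1 - cos t ^+ 2 by rewrite -cs; ring.
  move=> h3.
  apply: (@le_trans _ _ (4 * d ^+ 2 + 2 * (d * (a * cos t)))); first nra.
  by rewrite le_eqVlt; apply/orP; left; apply/eqP; ring: s2.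
have le2 : normc (f w) * normc kappa <=
    2 * (2 * (\int[mu]_(t in `[0, 2 * pi]) g a t))%R.
  rewrite -normcM E.
  have con : ccont_on 0 (2 * pi) (fun t => f (w + b a t) * ((b a t)^-1 * b' t)).
    by move=> t _; exact: ccontM (cfb t) (cV t).
  apply: le_trans (le_normc_cint con) _; rewrite ler_pM2l//.
  rewrite -RintegralZl//; last by apply: continuous_integrable => t _; exact: cg.
  apply: le_Rintegral => //.
  - by apply: continuous_integrable => t /con; exact: ccont_normc.
  - apply: continuous_integrable => t _.
    by apply: (@continuousM _ _ (cst 2)); [exact: cvg_cst|exact: cg].
  move=> t _; rewrite normcM mulrC ler_wpM2r ?normc_ge0// normcM normcV.
  rewrite /b' mulrCA normcM normc_i mul1r normc_2d mulrC ler_pdivrMr ?normc_gt0//.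
  by rewrite ler_pM2l.
have : normc (f w) * (4 * pi / 9) <= normc (f w) * normc kappa.
  by rewrite ler_wpM2l ?normc_ge0.
lra.
Qed.

(** From [x <= 1 + x^2] on an interval of length [2 * d], followed by a translation along the
    horizontal line at height [Im (w + b 0 t)]. *)
Let trace_bound t :
  (\int[mu]_(a in `[(- d)%R, d]) (g a t)%:E <= (2 * d + K)%:E)%E.
Proof.
have y0 := Im_b 0 t.
set y := complex.Im _ in y0.
pose x0 := complex.Re (w + b 0 t).
have wb a : w + b a t = (a + x0) +i* y.
  by rewrite /x0 /y /b; case: (w) => u v; apply: complex_ext => /=; ring.
pose G (x : R) := normc (f (x +i* y)) ^+ 2.
have cG : continuous G.
  by move=> x; apply: (@continuousM _ _ (fun x : R => normc (f (x +i* y))));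
    exact: cf_line.
have ndd : - d <= d by have := d0; lra.
have cG' : continuous (fun a => G (a + x0)).
  move=> a; apply: (@continuous_comp _ _ _ (fun a => a + x0) G); last exact: cG.
  by apply: continuousD; [exact: cvg_id|exact: cvg_cst].
have mG : measurable_fun [set: measurableTypeR R] G by exact: continuous_measurable_fun.
have mG' : measurable_fun [set: measurableTypeR R] (fun a : R => G (a + x0))
  by exact: continuous_measurable_fun.
have mg : measurable_fun [set: measurableTypeR R] (fun a : R => g a t).
  apply: continuous_measurable_fun => a.
  apply/cvgrPdist_lt => e e0; have [d1 d10 dP] := g_continuous2 a t e0.
  apply/nbhs_ballP; exists d1 => // a'; rewrite /ball /= distrC => aa'.
  by rewrite distrC; apply: dP => //; rewrite subrr normr0.
apply: (@le_trans _ _ (\int[mu]_(a in `[(- d)%R, d]) (1%:E + (G (a + x0))%:E))%E).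
  apply: ge0_le_integral => //.
  - by move=> a _; rewrite lee_fin normc_ge0.
  - by apply/measurable_EFinP; exact: measurable_funTS.
  - apply/measurable_EFinP; apply: measurable_funTS.
    by apply: measurable_funD => //; exact: measurable_cst.
  - move=> a _; rewrite -EFinD lee_fin /g wb /G.
    have := normc_ge0 (f ((a + x0) +i* y)); nra.
rewrite ge0_integralD//; last 2 first.
- by move=> a _; rewrite lee_fin sqr_ge0.
- by apply/measurable_EFinP; exact: measurable_funTS.
rewrite EFinD; apply: leeD.
  rewrite integral_cst//= lebesgue_measure_itv /= lte_fin; case: ifPn => _.
    by rewrite mul1e -EFinD lee_fin; lra.
  by rewrite mule0 lee_fin; have := d0; lra.
rewrite -integral_itv_shift//; apply: le_trans (fK y0).
apply: ge0_subset_integral => //.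
- by apply/measurable_EFinP.
- by move=> x _; rewrite lee_fin sqr_ge0.
Qed.

(** [mean_value] is integrated over [a] in [[-d, d]]; exchanging the integrals leaves [trace_bound]
    for each angle. *)
Lemma average_bound : normc (f w) <= 9 / d * (2 * d + K).
Proof.
have d0' := d0; have pi0 := pi_gt0 R.
have ndd : - d <= d by lra.
have g0 a t : 0 <= g a t by exact: normc_ge0.
have g2' : continuous2 (fun t a => g a t).
  move=> t a e e0; have [d1 d10 dP] := g_continuous2 a t e0.
  by exists d1 => // t' a' ? ?; exact: dP.
have h1 : ((normc (f w) * (pi / 9) * (2 * d))%:E <=
    \int[mu]_(a in `[(- d)%R, d]) \int[mu]_(t in `[0%R, (2 * pi)%R]) (g a t)%:E)%E.
  apply: (@le_trans _ _ (\int[mu]_(a in `[(- d)%R, d]) (normc (f w) * (pi / 9))%:E)%E).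
    rewrite integral_cst//= lebesgue_measure_itv /= lte_fin; case: ifPn => [_|].
      by rewrite -EFinD -EFinM lee_fin le_eqVlt; apply/orP; left; apply/eqP; ring.
    by move=> /negP[]; lra.
  apply: ge0_le_integral => //.
  - by move=> a _; rewrite lee_fin mulr_ge0 ?normc_ge0// divr_ge0// ltW.
  - exact: measurable_funTS (continuous2_integral_measurable _ _ g_continuous2 g0).
  - move=> a; rewrite /= in_itv /= => ad.
    rewrite -EFin_Rintegral; last by move=> t _; exact: cg.
    by rewrite lee_fin; apply: mean_value; rewrite ler_norml.
have h2 : (\int[mu]_(t in `[0%R, (2 * pi)%R]) \int[mu]_(a in `[(- d)%R, d]) (g a t)%:E
    <= ((2 * d + K) * (2 * pi))%:E)%E.
  apply: (@le_trans _ _ (\int[mu]_(t in `[0%R, (2 * pi)%R]) (2 * d + K)%:E)%E).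
    apply: ge0_le_integral => //.
    - by move=> t _; apply: integral_ge0 => a _; rewrite lee_fin.
    - exact: measurable_funTS (continuous2_integral_measurable _ _ g2' _).
  rewrite integral_cst//= lebesgue_measure_itv /= lte_fin mulr_gt0//.
  by rewrite -EFinD -EFinM lee_fin subr0.
rewrite (continuous2_tonelli _ _ _ _ g_continuous2 g0) in h1.
have := le_trans h1 h2; rewrite lee_fin => h3.
have {}h3 : (normc (f w) * d) * (pi * 2) <= (9 * (2 * d + K)) * (pi * 2) by lra.
rewrite mulrAC ler_pdivlMr//; move: h3; rewrite ler_pM2r//.
by rewrite mulr_gt0.
Qed.

End average.

(** With [d = y / 4] the averaging circles stay in the half-plane. The bound depends on [y] and on
    [f]; it only serves to dominate and to neglect short arcs in the passage to the boundary. *)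
Lemma bounded_above_line (y : R) : 0 < y ->
  exists B, forall w, y <= complex.Im w -> normc (f w) <= B.
Proof.
move=> y0; exists (9 / (y / 4) * (2 * (y / 4) + K)) => w yw.
by apply: average_bound; lra.
Qed.

End bounded.
End horizontal_traces.

(** * The two-circle estimate in the unit disc *)

Section two_circles.
Variable R : realType.
Notation mu := (@lebesgue_measure R).
Variable a : R.
Hypotheses (a0 : 0 < a) (a1 : a < 1).

(* The automorphism [w |-> (w + a) / (1 + a w)] of the unit disc gives the
   circles [|u| = p] the parametrization induced by the angle on the Euclidean
   circle which the Moebius map sends to [|u| = a]. *)
Definition disc_curve (t : R) : R[i] := (expi t + a%:C) / (1 + a%:C * expi t).

Definition disc_curve' (t : R) : R[i] :=
  'i%C * expi t * (1 - a ^+ 2)%:C / (1 + a%:C * expi t) ^+ 2.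

Local Notation b := disc_curve.
Local Notation b' := disc_curve'.
Local Notation B := ((1 + a) / (1 - a)).

Lemma disc_den_ge t : 1 - a <= normc (1 + a%:C * expi t).
Proof.
have := normcB_ge 1 (- (a%:C * expi t)).
rewrite opprK normc_opp normcM normc_expi mulr1 normc_real gtr0_norm//.
by rewrite ComplexField.Normc.normc1.
Qed.

Lemma disc_den_le t : normc (1 + a%:C * expi t) <= 1 + a.
Proof.
have := normc_triangle 1 (a%:C * expi t).
rewrite normcM normc_expi mulr1 normc_real gtr0_norm//.
by rewrite ComplexField.Normc.normc1.
Qed.

Lemma disc_den_neq0 t : 1 + a%:C * expi t != 0 :> R[i].
Proof. by rewrite -normc_gt0 (lt_le_trans _ (disc_den_ge t))// subr_gt0. Qed.

(** Since [expi t] times its conjugate is 1. Hence numerator and denominator of [disc_curve] have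
    the same modulus. *)
Lemma disc_num t : expi t + a%:C = expi t * (1 + a%:C * expi t)^*%C.
Proof.
have cs := cos2Dsin2 t.
have s2 : sin t ^+ 2 = 1 - cos t ^+ 2 by rewrite -cs; ring.
by apply: complex_ext; rewrite /expi /=; ring: s2.
Qed.

Lemma normc_disc_curve t : normc (b t) = 1.
Proof.
rewrite /b normcf_div disc_num normcM normc_expi mul1r normc_conj divff//.
by rewrite normc_eq0 disc_den_neq0.
Qed.

Lemma disc_curve_neq0 t : b t != 0.
Proof. by rewrite -normc_gt0 normc_disc_curve. Qed.

Lemma pder_disc_curve t : pder b t (b' t).
Proof.
have d1 := pderD (pder_expi t) (pder_cst a%:C t).
have d2 := pderD (pder_cst 1 t) (pderZ a%:C (pder_expi t)).
have d0 := disc_den_neq0 t.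
have := pderM d1 (pderV d0 d2); congr pder.
by rewrite /b' rmorphB rmorphXn /= rmorph1; field.
Qed.

Lemma ccont_disc_curve' t : ccont b' t.
Proof.
have ce := pder_ccont (pder_expi t).
have d2 := pderD (pder_cst 1 t) (pderZ a%:C (pder_expi t)).
have d0 := disc_den_neq0 t.
have cV := pder_ccont (pderV d0 d2).
rewrite (_ : b' = fun t => ('i%C * (1 - a ^+ 2)%:C) * (expi t *
  ((1 + a%:C * expi t)^-1 * (1 + a%:C * expi t)^-1))).
  exact: ccontM (ccont_cst _ _) (ccontM ce (ccontM cV cV)).
by apply/funext => s; rewrite /b' -invfM -expr2; ring.
Qed.

Lemma normc_disc_curve' t : normc (b' t) = (1 - a ^+ 2) / normc (1 + a%:C * expi t) ^+ 2.
Proof.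
rewrite /b' normcf_div normcX !normcM normc_i normc_expi !mul1r normc_real ger0_norm//.
by rewrite subr_ge0 expr_le1// ltW.
Qed.

Lemma disc_curve'_le t : normc (b' t) <= B.
Proof.
have h : 0 < 1 - a by rewrite subr_gt0.
rewrite normc_disc_curve' ler_pdivrMr; last first.
  by rewrite exprn_gt0// normc_gt0 disc_den_neq0.
apply: (@le_trans _ _ (B * (1 - a) ^+ 2)).
  rewrite le_eqVlt; apply/orP; left; apply/eqP; field; lra.
rewrite ler_pM2l; last by rewrite divr_gt0// addr_gt0.
by rewrite ler_sqr ?nnegrE ?normc_ge0 ?disc_den_ge// ltW.
Qed.

(** The factor of ['i] is a Poisson kernel: real because the curve lies on the unit circle, and
    positive, which yields [disc_index_ge]. *)
Lemma disc_curve_log_derivative t :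
  (b t)^-1 * b' t = 'i%C * ((1 - a ^+ 2) / normc (1 + a%:C * expi t) ^+ 2)%:C.
Proof.
have d0 := disc_den_neq0 t.
have c0 : (1 + a%:C * expi t)^*%C != 0 by rewrite conjc_eq0.
have e0 : expi t != 0 by rewrite -normc_gt0 normc_expi.
have -> : ((1 - a ^+ 2) / normc (1 + a%:C * expi t) ^+ 2)%:C =
    (1 - a ^+ 2)%:C / (normc (1 + a%:C * expi t) ^+ 2)%:C.
  by rewrite [in LHS]rmorphM [in LHS]fmorphV.
rewrite /b /b' disc_num sqr_normc_conj.
move: (1 + a%:C * expi t) d0 c0 => X; move: (X^*%C) (expi t) e0 => D e e0 X0 D0.
by field; rewrite X0 D0 e0.
Qed.

Lemma disc_curve2pi : b 0 = b (2 * pi).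
Proof. by rewrite /b expi2pi. Qed.

Let pi2 : 0 <= 2 * pi :> R. Proof. by rewrite mulr_ge0// ltW// pi_gt0. Qed.

Let B0 : 0 < B. Proof. by rewrite divr_gt0 ?subr_gt0 ?addr_gt0. Qed.

(** The Poisson kernel is at least [(1 - a^2) / (1 + a)^2 = (1 - a) / (1 + a)]. The exact value
    [2 pi i] of the integral is never computed. *)
Lemma disc_index_ge :
  2 * pi * ((1 - a) / (1 + a)) <=
  normc (cint 0 (2 * pi) (fun t => (b t)^-1 * b' t)).
Proof.
have h : 0 < 1 - a by rewrite subr_gt0.
apply: le_trans (normc_Im _); apply: le_trans (ler_norm _).
rewrite mulrC -[2 * pi in leLHS]subr0 /=; apply: Rintegral_ge_cst => // t _.
  by have [] := ccontM (pder_ccont (pderV (disc_curve_neq0 t) (pder_disc_curve t)))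
    (ccont_disc_curve' t).
change ((1 - a) / (1 + a) <= complex.Im ((b t)^-1 * b' t)).
have Im_iM (x : R) : complex.Im ('i%C * x%:C) = x by rewrite /= mul0r add0r mul1r.
rewrite disc_curve_log_derivative Im_iM.
rewrite ler_pdivlMr; last by rewrite exprn_gt0// normc_gt0 disc_den_neq0.
apply: (@le_trans _ _ ((1 - a) / (1 + a) * (1 + a) ^+ 2)).
  rewrite ler_pM2l; last by rewrite divr_gt0// addr_gt0.
  rewrite ler_sqr ?nnegrE ?normc_ge0 ?disc_den_le//.
  by rewrite addr_ge0// ltW.
rewrite le_eqVlt; apply/orP; left; apply/eqP; field.
by rewrite gt_eqF// addr_gt0.
Qed.

Section fixed_point.
Variable v : R[i].
Hypotheses (av : a < normc v) (v1 : normc v < 1).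

Definition geometric_kernel (N : nat) (u : R[i]) : R[i] :=
  \sum_(0 <= n < N) v ^+ n / u ^+ n.+1.

Lemma geometric_kernelE N u : u != 0 ->
  geometric_kernel N u * (u - v) = 1 - (v / u) ^+ N.
Proof.
move=> u0; rewrite /geometric_kernel; elim: N => [|N IH].
  by rewrite big_nil mul0r expr0 subrr.
rewrite big_nat_recr//= mulrDl IH !expr_div_n !exprS.
have uN : u ^+ N != 0 by rewrite expf_neq0.
move: uN; move: (u ^+ N) (v ^+ N) => A C A0; field; by rewrite A0 u0.
Qed.

Lemma cdifferentiable_geometric_kernel N u : u != 0 ->
  cdifferentiable (geometric_kernel N) u.
Proof.
move=> u0; apply: cdifferentiable_sum => n.
apply: cdifferentiableM; first exact: cdifferentiable_cst.
apply: cdifferentiableV; first by rewrite expf_neq0.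
by apply: cdifferentiableX; exact: cdifferentiable_id.
Qed.

(** A geometric sum in closed form. Keeping the [- 1] makes the bound vanish at [N = 0], the order
    chosen later when [eps >= 1]. *)
Lemma geometric_kernel_bound N u : normc u = a ->
  normc (geometric_kernel N u) <= ((normc v / a) ^+ N - 1) / (normc v - a).
Proof.
move=> ua; have va : normc v - a != 0 by rewrite gt_eqF// subr_gt0.
rewrite /geometric_kernel; elim: N => [|N IH].
  by rewrite big_nil ComplexField.Normc.normc0 expr0 subrr mul0r.
rewrite big_nat_recr//=; apply: le_trans (normc_triangle _ _) _.
apply: le_trans (lerD IH (lexx _)) _.
rewrite normcf_div !normcX ua le_eqVlt; apply/orP; left; apply/eqP.
rewrite !expr_div_n !exprS; have := expf_neq0 N (lt0r_neq0 a0).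
by move: (a ^+ N) (normc v ^+ N) => A V A0; field; rewrite A0 va gt_eqF.
Qed.

Section radius.
Variable p : R.
Hypotheses (vp : normc v < p) (p1 : p < 1).

Let p0 : 0 < p. Proof. exact: le_lt_trans (normc_ge0 _) vp. Qed.

Let pB0 : 0 <= p * B. Proof. by rewrite mulr_ge0 ?(ltW p0) ?(ltW B0). Qed.

(** The circle [|u| = p] as seen from [v]: Cauchy's formula above takes curves relative to the point
    of evaluation. *)
Let c (t : R) := p%:C * b t - v.
Let c' (t : R) := p%:C * b' t.

Let dc t : pder c t (c' t).
Proof.
have := pderD (pderZ p%:C (pder_disc_curve t)) (pder_cst (- v) t).
by rewrite addr0.
Qed.

Let cc' t : ccont c' t.
Proof. exact: ccontM (ccont_cst _ _) (ccont_disc_curve' t). Qed.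

Let normc_pb t : normc (p%:C * b t) = p.
Proof. by rewrite normcM normc_disc_curve mulr1 normc_real gtr0_norm. Qed.

Let c_ge t : p - normc v <= normc (c t).
Proof. by have := normcB_ge (p%:C * b t) v; rewrite normc_pb. Qed.

Let c_neq0 t : c t != 0.
Proof. by rewrite -normc_gt0 (lt_le_trans _ (c_ge t))// subr_gt0. Qed.

Let c'_le t : normc (c' t) <= p * B.
Proof.
rewrite normcM normc_real gtr0_norm//; apply: ler_wpM2l; first exact: ltW.
exact: disc_curve'_le.
Qed.

Let cintb := cint 0 (2 * pi) (fun t => (b t)^-1 * b' t).

Let cVc t : ccont (fun t => (c t)^-1 * c' t) t.
Proof. exact: ccontM (pder_ccont (pderV (c_neq0 t) (dc t))) (cc' t). Qed.

Let cVb t : ccont (fun t => (b t)^-1 * b' t) t.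
Proof.
exact: ccontM (pder_ccont (pderV (disc_curve_neq0 t) (pder_disc_curve t)))
  (ccont_disc_curve' t).
Qed.

(* The two integrands differ by the restriction of [v / (u (u - v))], which has
   no residue at infinity: let the radius tend to infinity. *)
Let index_shift : cint 0 (2 * pi) (fun t => (c t)^-1 * c' t) = cintb.
Proof.
apply/eqP; rewrite -subr_eq0 -cintB; last 2 first.
- by move=> t _; exact: cVc.
- by move=> t _; exact: cVb.
pose K u := v * (u * (u - v))^-1.
pose J P := cint 0 (2 * pi) (fun t => K (0 + P%:C * (p%:C * b t)) * (P%:C * c' t)).
have nu P t : 1 <= P -> normc (0 + P%:C * (p%:C * b t)) = P * p.
  by move=> P1; rewrite add0r normcM normc_pb normc_real ger0_norm// (le_trans _ P1).
have dK P t : 1 <= P -> cdifferentiable K (0 + P%:C * (p%:C * b t)).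
  move=> P1; have P0 : 0 < P by exact: lt_le_trans P1.
  apply: cdifferentiableM; first exact: cdifferentiable_cst.
  apply: cdifferentiableV.
    rewrite mulf_neq0// -normc_gt0; first by rewrite nu// mulr_gt0.
    apply: lt_le_trans (normcB_ge _ _); rewrite nu// subr_gt0.
    by rewrite (lt_le_trans vp)// ler_peMl// ltW.
  apply: cdifferentiableM; first exact: cdifferentiable_id.
  exact/cdifferentiableB/cdifferentiable_cst/cdifferentiable_id.
rewrite (_ : cint _ _ _ = J 1); last first.
  apply: eq_cint => t _; rewrite /K add0r mul1r -/(c t) mul1r.
  have := c_neq0 t; have := disc_curve_neq0 t => b0 c0.
  have pC0 : p%:C != 0 :> R[i] by rewrite -normc_gt0 normc_real normr_gt0 gt_eqF.
  have c0' : p%:C * b t - v != 0 by [].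
  by rewrite /c /c'; field; rewrite b0 pC0 c0'.
rewrite -normc_eq0; apply/eqP.
have JP P : 1 <= P -> J P = J 1.
  move=> P1; have B'0 : 0 <= p + p * B by rewrite addr_ge0 ?pB0// ltW.
  have h1 t : normc (p%:C * b t) <= p + p * B by rewrite normc_pb lerDl pB0.
  have h2 t : normc (c' t) <= p + p * B.
    by rewrite (le_trans (c'_le t))// lerDr ltW.
  have h3 P' t : 1 <= P' <= P -> cdifferentiable K (0 + P'%:C * (p%:C * b t)).
    by move=> /andP[P'1 _]; exact: dK.
  have h4 : p%:C * b 0 = p%:C * b (2 * pi) by rewrite disc_curve2pi.
  exact: (@star_goursat R K 0 _ c' _ 1 P 0 (2 * pi) ler01 P1 pi2
    (fun t => pderZ p%:C (pder_disc_curve t)) cc' h1 h2 h3 h4).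
apply: (@le_small_eq0 _ _ (2 * (normc v * B / (p - normc v) * (2 * pi - 0))) 1 ltr01).
  exact: normc_ge0.
(* The dilation factor is [P = 1 / q]. On the circle of radius [P * p] the function [K] decays like
   [P^-2] while the length grows like [P], so the integral is at most a multiple of [q]. *)
move=> q q0 q1; have q1' : 1 <= q^-1 by rewrite invf_ge1// ltW.
rewrite -(JP _ q1').
rewrite (_ : _ * q = 2 * ((normc v * B / (p - normc v) * q) * (2 * pi - 0))); last by ring.
have pv : 0 < p - normc v by rewrite subr_gt0.
apply: cint_bound => //.
  move=> t _; apply: ccontM; last exact: ccontM (ccont_cst _ _) (cc' t).
  apply: (ccont_comp (g := fun t => 0 + (q^-1)%:C * (p%:C * b t))); last exact: dK.
  exact: pder_ccont (pder_path 0 q^-1 (pderZ p%:C (pder_disc_curve t))).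
move=> t _; rewrite /K.
set u := 0 + _.
have uE : normc u = q^-1 * p by rewrite /u nu.
have uv : q^-1 * (p - normc v) <= normc (u - v).
  apply: le_trans (normcB_ge _ _); rewrite uE mulrBr lerD2l lerN2.
  by rewrite ler_peMl// normc_ge0.
have uv0 : 0 < normc (u - v) by apply: lt_le_trans uv; rewrite mulr_gt0// invr_gt0.
rewrite (normcM (v * _)) (normcM v) normcV (normcM u) uE (normcM (q^-1)%:C).
rewrite normc_real ger0_norm ?invr_ge0 ?(ltW q0)//.
have -> : normc v / (q^-1 * p * normc (u - v)) * (q^-1 * normc (c' t)) =
  normc v * (normc (c' t) / p) / normc (u - v).
  by field; rewrite (gt_eqF q0) (gt_eqF p0) (gt_eqF uv0).
rewrite ler_pdivrMr//.
apply: (@le_trans _ _ (normc v * B)).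
  apply: ler_wpM2l; first exact: normc_ge0.
  by rewrite ler_pdivrMr// mulrC.
apply: (@le_trans _ _ ((normc v * B / (p - normc v) * q) * (q^-1 * (p - normc v)))).
  rewrite le_eqVlt; apply/orP; left; apply/eqP; field.
  by rewrite !gt_eqF// subr_gt0.
apply: ler_wpM2l => //; apply: mulr_ge0; last exact: ltW.
by apply: divr_ge0; [rewrite mulr_ge0 ?normc_ge0// ltW|exact: ltW].
Qed.

Section analytic.
Variable F : R[i] -> R[i].
Hypothesis dF : forall u, normc u < 1 -> cdifferentiable F u.

Let ap : a < p. Proof. exact: lt_trans vp. Qed.

Let cF q t : 0 <= q < 1 -> ccont (fun t => F (q%:C * b t)) t.
Proof.
move=> /andP[q0 q1]; apply: (ccont_comp (g := fun t => q%:C * b t)).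
  exact: pder_ccont (pderZ q%:C (pder_disc_curve t)).
by apply: dF; rewrite normcM normc_disc_curve mulr1 normc_real ger0_norm.
Qed.

Let cauchy : F v * cintb =
  cint 0 (2 * pi) (fun t => F (p%:C * b t) * ((c t)^-1 * c' t)).
Proof.
have Bc : 0 <= 1 + p * B by rewrite addr_ge0 ?pB0.
rewrite -index_shift.
rewrite (@cauchy_closed_curve R F v c c' (p + normc v + p * B) 0 (2 * pi))//.
- by apply: eq_cint => t _; rewrite /c [v + _]addrC subrK.
- move=> t; by rewrite /c (le_trans (normc_sub _ _))// normc_pb lerDl pB0.
- move=> t; rewrite (le_trans (c'_le t))// lerDr.
  by rewrite addr_ge0 ?normc_ge0// ltW.
- by rewrite /c disc_curve2pi.
move=> q t /andP[q0 q1]; apply: dF.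
(* A convex combination of [v] and a point of the circle, hence in the disc. *)
have -> : v + q%:C * c t = (1 - q)%:C * v + q%:C * (p%:C * b t).
  by rewrite /c rmorphB /= rmorph1; ring.
apply: le_lt_trans (normc_triangle _ _) _.
rewrite (normcM _ v) (normcM _ (p%:C * b t)) normc_pb !normc_real.
rewrite !ger0_norm ?subr_ge0//.
apply: (@le_lt_trans _ _ ((1 - q) * p + q * p)); last by rewrite -mulrDl subrK mul1r.
by rewrite lerD2r ler_wpM2l ?subr_ge0// ltW.
Qed.

Let shrink N :
  cint 0 (2 * pi) (fun t => F (p%:C * b t) * geometric_kernel N (p%:C * b t) * (p%:C * b' t)) =
  cint 0 (2 * pi) (fun t => F (a%:C * b t) * geometric_kernel N (a%:C * b t) * (a%:C * b' t)).
Proof.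
pose K u := F u * geometric_kernel N u.
have := @star_goursat R K 0 b b' (1 + B) a p 0 (2 * pi) (ltW a0) (ltW ap) pi2
  pder_disc_curve ccont_disc_curve'.
have h1 t : normc (b t) <= 1 + B by rewrite normc_disc_curve lerDl ltW.
have h2 t : normc (b' t) <= 1 + B by rewrite (le_trans (disc_curve'_le t))// lerDr.
have h3 q t : a <= q <= p -> cdifferentiable K (0 + q%:C * b t).
  move=> /andP[aq qp]; have q0 : 0 < q by exact: lt_le_trans aq.
  have nq : normc (q%:C * b t) = q.
    by rewrite normcM normc_disc_curve mulr1 normc_real gtr0_norm.
  rewrite add0r; apply: cdifferentiableM.
    by apply: dF; rewrite nq (le_lt_trans qp).
  by apply: cdifferentiable_geometric_kernel; rewrite -normc_gt0 nq.
move=> /(_ h1 h2 h3 disc_curve2pi) E.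
have E1 q : cint 0 (2 * pi) (fun t => K (0 + q%:C * b t) * (q%:C * b' t)) =
  cint 0 (2 * pi) (fun t => F (q%:C * b t) * geometric_kernel N (q%:C * b t) * (q%:C * b' t)).
  by apply: eq_cint => t _; rewrite add0r.
by rewrite -!E1.
Qed.

(** Only L^1 means of [F] over the two circles enter. In the coefficients, 2 comes from
    [le_normc_cint], [B] bounds the derivative of the curve, and the rest bounds the finite sum on
    [|u| = a] and the remainder [(v / u)^N / (u - v)] on [|u| = p]. *)
Lemma two_circles (N : nat) :
  normc (F v) * (2 * pi * ((1 - a) / (1 + a))) <=
  2 * B / (normc v - a) * ((normc v / a) ^+ N - 1) *
    (\int[mu]_(t in `[0, (2 * pi)%R]) normc (F (a%:C * b t)))%R +
  2 * B / (p - normc v) * (normc v / p) ^+ N *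
    (\int[mu]_(t in `[0, (2 * pi)%R]) normc (F (p%:C * b t)))%R.
Proof.
have v0 : 0 < normc v by exact: lt_trans av.
have pv : 0 < p - normc v by rewrite subr_gt0.
have va : 0 < normc v - a by rewrite subr_gt0.
have na t : normc (a%:C * b t) = a.
  by rewrite normcM normc_disc_curve mulr1 normc_real gtr0_norm.
have ca : 0 <= a < 1 by rewrite ltW.
have cp : 0 <= p < 1 by rewrite ltW.
have cker q t : 0 < q -> ccont (fun t => geometric_kernel N (q%:C * b t)) t.
  move=> q0; apply: (ccont_comp (g := fun t => q%:C * b t)).
    exact: pder_ccont (pderZ q%:C (pder_disc_curve t)).
  apply: cdifferentiable_geometric_kernel.
  by rewrite -normc_gt0 normcM normc_disc_curve mulr1 normc_real normr_gt0 gt_eqF.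
pose Ia t := F (a%:C * b t) * geometric_kernel N (a%:C * b t) * (a%:C * b' t).
pose Ip t := F (p%:C * b t) * (v / (p%:C * b t)) ^+ N * ((c t)^-1 * c' t).
have cIa t : ccont Ia t.
  apply: ccontM (ccontM (cF _ ca) (cker _ _ a0)) _.
  exact: ccontM (ccont_cst _ _) (ccont_disc_curve' t).
have pb0 t : p%:C * b t != 0 by rewrite -normc_gt0 normc_pb.
have cIp t : ccont Ip t.
  apply: ccontM (ccontM (cF _ cp) _) (cVc t).
  apply: (ccont_comp (g := fun t => p%:C * b t) (K := fun u => (v / u) ^+ N)).
    exact: pder_ccont (pderZ p%:C (pder_disc_curve t)).
  apply: cdifferentiableX; apply: cdifferentiableM; first exact: cdifferentiable_cst.
  by apply: cdifferentiableV => //; exact: cdifferentiable_id.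
have E : F v * cintb = cint 0 (2 * pi) Ia + cint 0 (2 * pi) Ip.
  rewrite cauchy -shrink -cintD.
  - apply: eq_cint => t _; have G := geometric_kernelE N (pb0 t).
    have c0 : p%:C * b t - v != 0 by exact: c_neq0.
    have cE : (c t)^-1 = geometric_kernel N (p%:C * b t) + (v / (p%:C * b t)) ^+ N / c t.
      apply: (mulIf c0); rewrite mulrDl G -/(c t) mulVf// divfK//.
      by rewrite subrK.
    by rewrite {1}cE /Ip /c'; ring.
  - move=> t _; apply: ccontM (ccontM (cF _ cp) (cker _ _ p0)) _.
    exact: ccontM (ccont_cst _ _) (ccont_disc_curve' t).
  - by move=> t _; exact: cIp.
have bound (q M : R) (I : R -> R[i]) : 0 <= q < 1 -> (forall t, ccont I t) ->
    (forall t, normc (I t) <= M * normc (F (q%:C * b t))) ->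
    normc (cint 0 (2 * pi) I) <=
    2 * (M * (\int[mu]_(t in `[0%R, (2 * pi)%R]) normc (F (q%:C * b t)))%R).
  move=> q01 cI IM.
  have cI' : ccont_on 0 (2 * pi) I by move=> t _; exact: cI.
  apply: le_trans (le_normc_cint cI') _; rewrite ler_pM2l//.
  have cnF t : {for t, continuous (fun t => normc (F (q%:C * b t)))}.
    exact/ccont_normc/cF.
  rewrite -RintegralZl//; last by apply: continuous_integrable => t _; exact: cnF.
  apply: le_Rintegral => //.
    by apply: continuous_integrable => t _; exact: ccont_normc.
  apply: continuous_integrable => t _.
  by apply: (@continuousM _ _ (cst M)); [exact: cvg_cst|exact: cnF].
have hIa t : normc (Ia t) <=
    (B / (normc v - a) * ((normc v / a) ^+ N - 1)) * normc (F (a%:C * b t)).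
  rewrite /Ia -mulrA normcM mulrC ler_wpM2r ?normc_ge0//.
  rewrite normcM; have h1 := geometric_kernel_bound N (na t).
  have h2 : normc (a%:C * b' t) <= B.
    rewrite normcM normc_real gtr0_norm//.
    apply: le_trans (ler_wpM2l (ltW a0) (disc_curve'_le t)) _.
    by rewrite ler_piMl// ltW.
  have -> : B / (normc v - a) * ((normc v / a) ^+ N - 1) =
    ((normc v / a) ^+ N - 1) / (normc v - a) * B by ring.
  by apply: ler_pM; rewrite ?normc_ge0.
have hIp t : normc (Ip t) <=
    (B / (p - normc v) * (normc v / p) ^+ N) * normc (F (p%:C * b t)).
  rewrite /Ip -mulrA normcM mulrC ler_wpM2r ?normc_ge0//.
  rewrite normcM normcX normcf_div normc_pb mulrC ler_wpM2r//.
    by rewrite exprn_ge0// divr_ge0 ?normc_ge0// ltW.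
  rewrite normcM normcV mulrC; apply: ler_pM; rewrite ?invr_ge0 ?normc_ge0//.
    apply: le_trans (c'_le t) _; by rewrite ler_piMl// ltW.
  by rewrite lef_pV2// posrE normc_gt0.
have H := le_trans (normc_triangle _ _ : normc (_ + _) <= _)
  (lerD (bound _ _ _ ca cIa hIa) (bound _ _ _ cp cIp hIp)).
rewrite -E normcM in H.
apply: le_trans (ler_wpM2l (normc_ge0 _) disc_index_ge) _.
by apply: le_trans H _; rewrite le_eqVlt; apply/orP; left; apply/eqP; ring.
Qed.

End analytic.
End radius.
End fixed_point.
End two_circles.

(** * Transfer to the half-plane *)

Section half_plane_geometry.
Variables (R : realType) (r : R).
Hypotheses (r0 : 0 < r) (r1 : r < 1).

Local Notation s := (Num.sqrt (1 - r ^+ 2)).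
Local Notation a := (rho r).

Lemma sqr_height : s ^+ 2 = 1 - r ^+ 2.
Proof. by rewrite sqr_sqrtr// subr_ge0 expr_le1// ltW. Qed.

Lemma height_gt0 : 0 < s.
Proof. by rewrite sqrtr_gt0 subr_gt0 expr_lt1// ltW. Qed.

Lemma height_lt1 : s < 1.
Proof.
have := sqr_height; have := height_gt0 => s0 s2.
have r20 : 0 < r ^+ 2 by rewrite exprn_gt0.
rewrite ltNge; apply/negP => s1.
have : 1 <= s ^+ 2 by rewrite exprn_ege1.
lra.
Qed.

Lemma rhoM : a * r = 1 - s.
Proof. by rewrite /rho divfK// gt_eqF. Qed.

Lemma rhoM_height : a * (1 + s) = r.
Proof.
have r0' : r != 0 by rewrite gt_eqF.
apply: (mulIf r0'); rewrite mulrAC rhoM -expr2.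
by have := sqr_height; lra.
Qed.

Lemma rho_gt0 : 0 < a.
Proof. by rewrite divr_gt0// subr_gt0 height_lt1. Qed.

Lemma rho_lt1 : a < 1.
Proof.
have h : 0 < 1 + s by rewrite addr_gt0// height_gt0.
by rewrite -(ltr_pM2r h) rhoM_height mul1r (lt_trans r1)// ltrDl height_gt0.
Qed.

Lemma rho_sqr : a ^+ 2 * (1 + s) = 1 - s.
Proof. by rewrite expr2 -mulrA rhoM_height rhoM. Qed.

(** The quotient [s * (1 + a) / (1 - a)] is the scale of the parametrization of the line in
    [mobius_inv_line]; this identity turns it into [1 + r]. *)
Lemma height_rho : s * (1 + a) = (1 + r) * (1 - a).
Proof. by have := rhoM; have := rhoM_height; lra. Qed.

Lemma z0_neq0 : z0 r != 0.
Proof.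
by rewrite /z0 -normc_gt0 normcM normc_i mul1r normc_real gtr0_norm height_gt0.
Qed.

Lemma normc_sub_z0 (w : R[i]) :
  normc (w - z0 r) ^+ 2 = complex.Re w ^+ 2 + (complex.Im w - s) ^+ 2.
Proof. by rewrite normc_sqr /z0; case: w => x y /=; congr (_ ^+ 2 + _ ^+ 2); ring. Qed.

Lemma normc_add_z0 (w : R[i]) :
  normc (w + z0 r) ^+ 2 = complex.Re w ^+ 2 + (complex.Im w + s) ^+ 2.
Proof. by rewrite normc_sqr /z0; case: w => x y /=; congr (_ ^+ 2 + _ ^+ 2); ring. Qed.

Lemma normc_sub_i (w : R[i]) :
  normc (w - 'i%C) ^+ 2 = complex.Re w ^+ 2 + (complex.Im w - 1) ^+ 2.
Proof. by rewrite normc_sqr; case: w => x y /=; congr (_ ^+ 2 + _ ^+ 2); ring. Qed.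

Lemma add_z0_neq0 (w : R[i]) : 0 <= complex.Im w -> w + z0 r != 0.
Proof.
move=> w0; apply/eqP => /(congr1 (fun x => complex.Im x)).
have -> : complex.Im (w + z0 r) = complex.Im w + s.
  by rewrite /z0; case: (w) => x y /=; ring.
by apply/eqP; rewrite gt_eqF//= ltr_wpDl// height_gt0.
Qed.

Lemma mobius_normc_lt1 (w : R[i]) : 0 < complex.Im w -> normc (mobius r w) < 1.
Proof.
move=> w0; have d0 := add_z0_neq0 (ltW w0).
rewrite /mobius normcf_div ltr_pdivrMr ?normc_gt0// mul1r.
rewrite -ltr_sqr ?nnegrE ?normc_ge0// normc_sub_z0 normc_add_z0 ltrD2l.
have : 0 < complex.Im w * s by rewrite mulr_gt0// height_gt0.
lra.
Qed.

Lemma mobius_normc_le1 (w : R[i]) : 0 <= complex.Im w -> normc (mobius r w) <= 1.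
Proof.
move=> w0; have d0 := add_z0_neq0 w0.
rewrite /mobius normcf_div ler_pdivrMr ?normc_gt0// mul1r.
rewrite -ler_sqr ?nnegrE ?normc_ge0// normc_sub_z0 normc_add_z0 lerD2l.
have : 0 <= complex.Im w * s by rewrite mulr_ge0// ltW// height_gt0.
lra.
Qed.

(* [|m w|^2 - rho^2] has the sign of [|w - i|^2 - r^2]. *)
Lemma mobius_rho (w : R[i]) :
  (1 + s) * (normc (w - z0 r) ^+ 2 - a ^+ 2 * normc (w + z0 r) ^+ 2) =
  2 * s * (normc (w - 'i%C) ^+ 2 - r ^+ 2).
Proof.
have -> x y : (1 + s) * (x - a ^+ 2 * y) = (1 + s) * x - a ^+ 2 * (1 + s) * y by ring.
rewrite rho_sqr normc_sub_z0 normc_add_z0 normc_sub_i.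
have : r ^+ 2 = 1 - s ^+ 2 by rewrite sqr_height; ring.
by move: (Num.sqrt _) => S ->; ring.
Qed.

Lemma mobius_outside (w : R[i]) : 0 < complex.Im w -> r < normc (w - 'i%C) ->
  a < normc (mobius r w).
Proof.
move=> w0 rw; have d0 := add_z0_neq0 (ltW w0).
rewrite /mobius normcf_div ltr_pdivlMr ?normc_gt0//.
have ge0 := mulr_ge0 (ltW rho_gt0) (normc_ge0 (w + z0 r)).
rewrite -ltr_sqr ?nnegrE ?normc_ge0// exprMn -subr_gt0.
have h : 0 < 1 + s by rewrite addr_gt0// height_gt0.
rewrite -(pmulr_rgt0 _ h) mobius_rho mulr_gt0 ?mulr_gt0 ?height_gt0//.
by rewrite subr_gt0 ltr_sqr ?nnegrE ?normc_ge0// ltW.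
Qed.

Lemma mobius_circle (w : R[i]) : 0 <= complex.Im w -> normc (w - 'i%C) = r ->
  normc (mobius r w) = a.
Proof.
move=> w0 rw; have d0 := add_z0_neq0 w0.
have h : 1 + s != 0 by rewrite gt_eqF// addr_gt0// height_gt0.
have := mobius_rho w; rewrite rw subrr mulr0 => /eqP.
rewrite mulf_eq0 (negbTE h) /= subr_eq0 -exprMn => /eqP e.
have a0 := rho_gt0.
have {}e : normc (w - z0 r) = a * normc (w + z0 r).
  by apply/eqP; rewrite -(@eqrXn2 _ 2) ?normc_ge0 ?e// mulr_ge0 ?normc_ge0// ltW.
by rewrite /mobius normcf_div e mulfK// normc_eq0.
Qed.

Definition mobius_inv (u : R[i]) : R[i] := z0 r * (1 + u) / (1 - u).

Lemma one_sub_neq0 (u : R[i]) : normc u < 1 -> 1 - u != 0.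
Proof.
move=> u1; rewrite subr_eq0; apply/negP => /eqP e.
by move: u1; rewrite -e ComplexField.Normc.normc1 ltxx.
Qed.

Lemma mobiusK (w : R[i]) : 0 <= complex.Im w -> mobius_inv (mobius r w) = w.
Proof.
move=> w0; have d0 := add_z0_neq0 w0; have n0 := z0_neq0.
have -> : mobius_inv (mobius r w) = z0 r * (2 * w / (w + z0 r)) / (2 * z0 r / (w + z0 r)).
  by rewrite /mobius_inv /mobius; congr (_ * _ / _); field.
have t0 : 2 != 0 :> R[i] by rewrite pnatr_eq0.
by field; rewrite n0 d0.
Qed.

Lemma Im_mobius_inv (u : R[i]) : normc u < 1 -> 0 < complex.Im (mobius_inv u).
Proof.
move=> u1; have d0 := one_sub_neq0 u1.
have dg : 0 < normc (1 - u) ^+ 2 by rewrite exprn_gt0// normc_gt0.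
have -> : complex.Im (mobius_inv u) = s * (1 - normc u ^+ 2) / normc (1 - u) ^+ 2.
  rewrite /mobius_inv mulrC Im_invM; congr (_ / _).
  by rewrite normc_sqr /z0; case: (u) => x y /=; ring.
rewrite divr_gt0// mulr_gt0 ?height_gt0// subr_gt0 expr_lt1 ?normc_ge0//.
Qed.

Lemma cdifferentiable_mobius_inv (u : R[i]) : 1 - u != 0 ->
  cdifferentiable mobius_inv u.
Proof.
move=> u1; apply: cdifferentiableM.
  apply: cdifferentiableM; first exact: cdifferentiable_cst.
  exact: cdifferentiableD (cdifferentiable_cst _ _) (cdifferentiable_id _).
apply: cdifferentiableV => //.
exact: cdifferentiableB (cdifferentiable_cst _ _) (cdifferentiable_id _).
Qed.

(** With [E = expi t] and [b = (E + a) / (1 + a * E)], the quotient [(1 + a * b) / (1 - a * b)] is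
    affine in [E]: it equals [(1 + a^2 + 2 a E) / (1 - a^2)]. The identities [e1] and [e2] say that
    after multiplication by [s] the constant term is 1 and the coefficient of [E] is [r]. *)
Lemma mobius_inv_circle (t : R) :
  mobius_inv (a%:C * disc_curve a t) = 'i%C + r%:C * ('i%C * expi t).
Proof.
have d0 := disc_den_neq0 rho_gt0 rho_lt1 t.
have sq := rho_sqr; have rs := rhoM_height; have s0 := height_gt0.
have a1 : 1 - a ^+ 2 != 0.
  by rewrite subr_eq0 eq_sym lt_eqF// expr_lt1 ?rho_lt1// ltW// rho_gt0.
have h : 1 + s != 0 by rewrite gt_eqF// addr_gt0.
have e0 : (1 - a ^+ 2) * (1 + s) = 2 * s.
  have -> : (1 - a ^+ 2) * (1 + s) = 1 + s - a ^+ 2 * (1 + s) by ring.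
  by rewrite sq; ring.
have e1 : s * (1 + a ^+ 2) = 1 - a ^+ 2.
  apply: (mulIf h); rewrite e0.
  have -> : s * (1 + a ^+ 2) * (1 + s) = s * (1 + s) + s * (a ^+ 2 * (1 + s)) by ring.
  by rewrite sq; ring.
have e2 : s * (2 * a) = r * (1 - a ^+ 2).
  apply: (mulIf h); rewrite -[in RHS]mulrA e0.
  have -> : s * (2 * a) * (1 + s) = 2 * s * (a * (1 + s)) by ring.
  by rewrite rs; ring.
move: d0; rewrite /mobius_inv /z0 /disc_curve.
have a1C : 1 - a%:C ^+ 2 != 0 :> R[i].
  by rewrite -rmorphXn -(rmorph1 (real_complex R)) -rmorphB -normc_gt0 normc_real normr_gt0.
have e1C : s%:C * (1 + a%:C ^+ 2) = 1 - a%:C ^+ 2 :> R[i].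
  by rewrite -rmorphXn -(rmorph1 (real_complex R)) -rmorphD -rmorphB -rmorphM e1.
have e2C : s%:C * (2 * a%:C) = r%:C * (1 - a%:C ^+ 2) :> R[i].
  rewrite -rmorphXn -(rmorph1 (real_complex R)) -rmorphB -[2]/(2%:R).
  by rewrite -(rmorph_nat (real_complex R)) -!rmorphM e2.
move: e1C e2C a1C; move: (s%:C) (a%:C) (r%:C) (expi t) => S A Q E e1C e2C a1C d0.
have -> : 1 - A * ((E + A) / (1 + A * E)) = (1 - A ^+ 2) / (1 + A * E) by field.
have -> : 1 + A * ((E + A) / (1 + A * E)) = (1 + A ^+ 2 + 2 * A * E) / (1 + A * E) by field.
have -> : 'i%C * S * ((1 + A ^+ 2 + 2 * A * E) / (1 + A * E)) / ((1 - A ^+ 2) / (1 + A * E)) =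
  'i%C * (S * (1 + A ^+ 2) + S * (2 * A) * E) / (1 - A ^+ 2) :> R[i].
  by field; rewrite d0 a1C.
by rewrite e1C e2C; field.
Qed.

(** The half-angle is measured from [t = pi], which corresponds to the origin of the line, while
    [t = 0] and [t = 2 * pi] correspond to infinity. *)
Lemma expi_double (t : R) : expi t = - expi ((t - pi) / 2) ^+ 2.
Proof.
have -> : t = (t - pi) / 2 + (t - pi) / 2 + pi by field.
set u := (t - pi) / 2; have -> : (u + u + pi - pi) / 2 = u by field.
by apply: complex_ext; rewrite /expi /= ?cosDpi ?sinDpi ?cosD ?sinD; ring.
Qed.

Lemma disc_curve_neq1 (t : R) : cos ((t - pi) / 2) != 0 ->
  1 - disc_curve a t != 0.
Proof.
have d0 := disc_den_neq0 rho_gt0 rho_lt1 t; have a1 := rho_lt1.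
set u := (t - pi) / 2 => c0.
have cs := cos2Dsin2 u.
have s2 : sin u ^+ 2 = 1 - cos u ^+ 2 by rewrite -cs; ring.
have h2 : 1 - expi t = 2 * (cos u)%:C * expi u.
  by rewrite expi_double -/u; apply: complex_ext; rewrite /expi /=; ring: s2.
have -> : 1 - disc_curve a t = (1 - a%:C) * (1 - expi t) / (1 + a%:C * expi t).
  by rewrite /disc_curve; field.
rewrite h2 !mulf_neq0 ?invr_eq0//.
- by rewrite -(rmorph1 (real_complex R)) -rmorphB -normc_gt0 normc_real normr_gt0 subr_eq0 gt_eqF.
- by rewrite -normc_gt0 normc_real normr_gt0.
- by rewrite -normc_gt0 normc_expi.
Qed.

(** In the half-angle [u], both [1 + expi t] and [1 - expi t] contain the factor [2 * expi u], and
    their quotient is [- 'i * tan u]; [height_rho] supplies the scale. *)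
Lemma mobius_inv_line (t : R) : cos ((t - pi) / 2) != 0 ->
  mobius_inv (disc_curve a t) = ((1 + r) * tan ((t - pi) / 2))%:C.
Proof.
have d0 := disc_den_neq0 rho_gt0 rho_lt1 t.
have sa := height_rho; have a1 := rho_lt1.
set u := (t - pi) / 2 => c0.
have e0 : expi u != 0 by rewrite -normc_gt0 normc_expi.
have cs := cos2Dsin2 u.
have s2 : sin u ^+ 2 = 1 - cos u ^+ 2 by rewrite -cs; ring.
have h1 : 1 + expi t = - (2 * 'i%C * (sin u)%:C) * expi u.
  by rewrite expi_double -/u; apply: complex_ext; rewrite /expi /=; ring: s2.
have h2 : 1 - expi t = 2 * (cos u)%:C * expi u.
  by rewrite expi_double -/u; apply: complex_ext; rewrite /expi /=; ring: s2.
have c0C : (cos u)%:C != 0 :> R[i] by rewrite -normc_gt0 normc_real normr_gt0.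
have a1C : 1 - a%:C != 0 :> R[i].
  by rewrite -(rmorph1 (real_complex R)) -rmorphB -normc_gt0 normc_real normr_gt0 subr_eq0 gt_eqF.
have saC : s%:C * (1 + a%:C) = (1 + r%:C) * (1 - a%:C) :> R[i].
  by rewrite -(rmorph1 (real_complex R)) -!rmorphD -rmorphB -!rmorphM sa.
have t0 : 2 != 0 :> R[i] by rewrite pnatr_eq0.
have -> : ((1 + r) * tan u)%:C = (1 + r%:C) * ((sin u)%:C / (cos u)%:C) :> R[i].
  by rewrite /tan [LHS]rmorphM rmorphD rmorph1 rmorphM fmorphV.
have -> : mobius_inv (disc_curve a t) =
    'i%C * (s%:C * (1 + a%:C)) * (1 + expi t) / ((1 - a%:C) * (1 - expi t)).
  have w0 : 1 - expi t != 0 by rewrite h2 !mulf_neq0.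
  rewrite /mobius_inv /z0 /disc_curve.
  have -> : 1 - (expi t + a%:C) / (1 + a%:C * expi t) =
    (1 - a%:C) * (1 - expi t) / (1 + a%:C * expi t) by field.
  have -> : 1 + (expi t + a%:C) / (1 + a%:C * expi t) =
    (1 + a%:C) * (1 + expi t) / (1 + a%:C * expi t) by field.
  by field; rewrite d0 w0 a1C.
rewrite saC h1 h2.
have i2 : 'i%C ^+ 2 = -1 :> R[i] by exact: sqr_i.
move: c0C a1C e0; move: (cos u)%:C (sin u)%:C a%:C (expi u) => C S A E c0C a1C e0.
have -> : 'i%C * ((1 + r%:C) * (1 - A)) * (- (2 * 'i%C * S) * E) =
  - ('i%C ^+ 2) * ((1 + r%:C) * (1 - A)) * (2 * S) * E :> R[i] by ring.
by rewrite i2; field; rewrite a1C c0C e0.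
Qed.

End half_plane_geometry.

(** * Circle means of the pullback near the boundary *)

Section boundary_limit.
Variables (R : realType) (r : R).
Hypotheses (r0 : 0 < r) (r1 : r < 1).
Notation mu := (@lebesgue_measure R).
Local Notation a := (rho r).

Let l := 1 + r.
Let l0 : 0 < l. Proof. by rewrite addr_gt0. Qed.
(** [X] parametrizes the line by the angle on the circle and [T] is its inverse. The substitution is
    made with [T], which is smooth on the whole line with derivative at most [2 / l], whereas [X]
    blows up at 0 and [2 * pi]. *)
Let T (x : R) := pi + 2 * atan (x / l).
Let X (t : R) := l * tan ((t - pi) / 2).

Let dT (x : R) : is_derive x 1 T (2 / (l * (1 + (x / l) ^+ 2))).
Proof.
have d1 : is_derive x 1 (fun x : R => x / l) l^-1.
  have := is_deriveM (is_derive_id x 1) (is_derive_cst (l^-1) x 1).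
  by rewrite /GRing.scale /= mulr0 mulr1 add0r.
have d2 := @is_derive1_comp R atan (fun x => x / l) x _ _ (is_derive1_atan (x / l)) d1.
have := is_deriveD (is_derive_cst pi x 1) (is_deriveZ 2 d2).
rewrite add0r; congr is_derive.
rewrite /GRing.scale /=; field.
have : 0 < l ^+ 2 + x ^+ 2 by rewrite ltr_wpDr ?sqr_ge0// exprn_gt0.
by move=> h; rewrite !gt_eqF//= ltr_wpDr ?sqr_ge0.
Qed.

Let T_mono x y : x < y -> T x < T y.
Proof.
move=> xy; rewrite ltrD2l ltr_pM2l//.
by rewrite -ltr_tan ?in_itv /= ?atan_gtNpi2 ?atan_ltpi2// !atanK ltr_pM2r// invr_gt0.
Qed.

Let TK x : X (T x) = x.
Proof.
rewrite /X /T.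
have -> : (pi + 2 * atan (x / l) - pi) / 2 = atan (x / l) by field.
by rewrite atanK mulrC divfK// gt_eqF.
Qed.

Let continuous_X (t : R) : 0 < t -> t < 2 * pi -> {for t, continuous X}.
Proof.
move=> t0 tpi.
apply: (@continuousM _ _ (cst l)); first exact: cvg_cst.
apply: (@continuous_comp _ _ _ (fun t => (t - pi) / 2) tan).
  apply: (@continuousM _ _ (fun t => t - pi) (cst 2^-1)); last exact: cvg_cst.
  by apply: (@continuousB _ _ _ id (cst pi)); [exact: cvg_id|exact: cvg_cst].
by apply: continuous_tan; rewrite gt_eqF// cos_gt0_pihalf//; lra.
Qed.

Let line_substitution (G : R -> R) (K d : R) : 0 < d -> d < pi ->
  continuous G -> (forall x, 0 <= G x) ->
  (\int[mu]_x (G x)%:E <= K%:E)%E ->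
  (\int[mu]_(t in `[d, (2 * pi - d)%R]) (G (X t))%:E <= (2 / l * K)%:E)%E.
Proof.
move=> d0 dpi cG G0 GK.
have pi0 := pi_gt0 R.
(* This is [X (2 * pi - d)], so [T] maps [[-A, A]] onto [[d, 2 * pi - d]]. *)
pose A := l * tan ((pi - d) / 2).
have lK z : l * z / l = z by rewrite mulrC mulKf// gt_eqF.
have TA : T A = 2 * pi - d.
  rewrite /T /A lK tanK; last by rewrite in_itv /=; lra.
  by field.
have TNA : T (- A) = d.
  rewrite /T /A -mulrN lK -tanN tanK; last by rewrite in_itv /=; lra.
  by field.
have A0 : 0 <= A.
  rewrite leNgt; apply/negP => A0; have : T A < T (- A) by apply: T_mono; lra.
  rewrite TA TNA; lra.
have T' : T^`()%classic = fun x => 2 / (l * (1 + (x / l) ^+ 2)).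
  by apply/funext => x; rewrite derive1E; have [_ ->] := dT x.
have den (x : R) : 0 < 1 + (x / l) ^+ 2 by rewrite ltr_wpDr ?sqr_ge0.
have cT' : continuous (fun x : R => 2 / (l * (1 + (x / l) ^+ 2))).
  move=> x; have c1 : {for x, continuous (fun x : R => x / l)}.
    by apply: (@continuousM _ _ id (cst l^-1)); [exact: cvg_id|exact: cvg_cst].
  have c2 : {for x, continuous (fun x : R => (x / l) ^+ 2)}.
    exact: (@continuousM _ _ _ _ _ c1 c1).
  have c3 : {for x, continuous (fun x : R => l * (1 + (x / l) ^+ 2))}.
    apply: (@continuousM _ _ (cst l)); first exact: cvg_cst.
    exact: (@continuousD _ _ _ (cst (1 : R)) _ x (cvg_cst _) c2).
  have c4 : {for x, continuous (fun x : R => (l * (1 + (x / l) ^+ 2))^-1)}.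
    by apply: (continuousV _ c3); rewrite mulf_neq0// gt_eqF.
  exact: (@continuousM _ _ (cst (2 : R)) _ x (cvg_cst _) c4).
have cT (x : R) : {for x, continuous T}.
  by have [dx _] := dT x; exact: differentiable_continuous ((derivable1_diffP _ _).1 dx).
have cGX : {within `[T (- A), T A], continuous (G \o X)}.
  apply: continuous_in_subspaceT => t; rewrite inE TA TNA /= in_itv /= => tI.
  apply: continuous_comp; last exact: cG.
  by apply: continuous_X; lra.
rewrite -{1}TNA -TA.
rewrite (@integration_by_substitution_increasing R T (G \o X) (- A) A).
- rewrite T'.
  have cI : continuous (fun x : R => G x * (2 / (l * (1 + (x / l) ^+ 2)))).
    by move=> x; exact: (@continuousM _ _ G _ x (cG x) (cT' x)).
  have mG : measurable_fun [set: measurableTypeR R] G by exact: continuous_measurable_fun.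
  have mI : measurable_fun [set: measurableTypeR R]
      (fun x : R => G x * (2 / (l * (1 + (x / l) ^+ 2)))) by exact: continuous_measurable_fun.
  apply: (@le_trans _ _ (\int[mu]_(x in `[(- A)%R, A]) ((2 / l)%:E * (G x)%:E))%E).
    under eq_integral => x _ do rewrite fctE /= TK.
    apply: ge0_le_integral => //.
    + by move=> x _; rewrite lee_fin mulr_ge0// divr_ge0// mulr_ge0// ltW.
    + by apply/measurable_EFinP; exact: measurable_funTS.
    + apply/measurable_EFinP; apply: measurable_funTS.
      by apply: measurable_funM => //; exact: measurable_cst.
    + move=> x _; rewrite -EFinM lee_fin mulrC ler_wpM2r// ler_pM2l//.
      by rewrite lef_pV2 ?posrE ?mulr_gt0// ler_pMr// lerDl sqr_ge0.
  rewrite ge0_integralZl//; last 3 first.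
  + by apply/measurable_EFinP; exact: measurable_funTS.
  + by move=> x _; rewrite lee_fin.
  + by rewrite lee_fin divr_ge0// ltW.
  rewrite (EFinM (2 / l) K); apply: lee_pmul => //.
  + by rewrite lee_fin divr_ge0// ltW.
  + by apply: integral_ge0 => x _; rewrite lee_fin.
  apply: le_trans GK; apply: ge0_subset_integral => //.
  + by apply/measurable_EFinP.
  + by move=> x _; rewrite lee_fin.
- lra.
- by move=> x y _ _; exact: T_mono.
- by rewrite T' => x _; exact: cT'.
- by rewrite T'; apply/cvg_ex; eexists; apply: cvg_at_right_filter; exact: cT'.
- by rewrite T'; apply/cvg_ex; eexists; apply: cvg_at_left_filter; exact: cT'.
- split.
  + by move=> x _; have [] := dT x.
  + exact: cvg_at_right_filter (cT (- A)).
  + exact: cvg_at_left_filter (cT A).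
- exact: cGX.
Qed.

Section trace.
Variables (f : R[i] -> R[i]) (y K B : R).
Hypothesis df : forall w, 0 < complex.Im w -> cdifferentiable f w.
Hypothesis y0 : 0 < y.
Hypothesis fK : (\int[mu]_x (normc (f (x +i* y)) ^+ 2)%:E <= K%:E)%E.
Hypothesis fB : forall w, y <= complex.Im w -> normc (f w) <= B.

(** The shift by [y] makes the pullback bounded in the disc and differentiable at every point of the
    unit circle except 1. *)
Definition disc_pullback (u : R[i]) : R[i] := f (mobius_inv r u + y%:C * 'i%C).
Local Notation F := disc_pullback.
Local Notation b := (disc_curve a).

Let ImD (w : R[i]) : complex.Im (w + y%:C * 'i%C) = complex.Im w + y.
Proof. by case: w => u v /=; ring. Qed.

Lemma cdifferentiable_disc_pullback (u : R[i]) : 1 - u != 0 ->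
  0 <= complex.Im (mobius_inv r u) -> cdifferentiable F u.
Proof.
move=> u1 Iu; apply: (cdifferentiable_comp (f := fun u => mobius_inv r u + y%:C * 'i%C)).
  by apply: cdifferentiableD; [exact: cdifferentiable_mobius_inv|exact: cdifferentiable_cst].
by apply: df; rewrite ImD ltr_wpDl.
Qed.

Lemma cdifferentiable_disc_pullback_disc (u : R[i]) : normc u < 1 ->
  cdifferentiable F u.
Proof.
move=> u1; apply: cdifferentiable_disc_pullback; first exact: one_sub_neq0.
exact/ltW/Im_mobius_inv.
Qed.

Let FB (u : R[i]) : normc u < 1 -> normc (F u) <= B.
Proof. by move=> u1; apply: fB; rewrite ImD lerDr ltW// Im_mobius_inv. Qed.

Let normc_qb q t : 0 <= q -> normc (q%:C * b t) = q.
Proof.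
move=> q0; rewrite normcM normc_disc_curve ?rho_gt0 ?rho_lt1// mulr1 normc_real.
by rewrite ger0_norm.
Qed.

Let q_ (n : nat) : R := 1 - n.+2%:R^-1.

Let q_ge0 n : 0 <= q_ n.
Proof. by rewrite subr_ge0 invf_le1// ler1n. Qed.

Let q_lt1 n : q_ n < 1.
Proof. by rewrite gtrBl invr_gt0. Qed.

Let cFq n t : {for t, continuous (fun t => normc (F ((q_ n)%:C * b t)))}.
Proof.
apply: ccont_normc; apply: (ccont_comp (g := fun t => (q_ n)%:C * b t)).
  exact: pder_ccont (pderZ _ (pder_disc_curve (rho_gt0 r0 r1) (rho_lt1 r0 r1) t)).
by apply: cdifferentiable_disc_pullback_disc; rewrite normc_qb.
Qed.

Let Fq_cvg d t : 0 < d -> d <= t -> t <= 2 * pi - d ->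
  (normc (F ((q_ n)%:C * b t)))%:E @[n --> \oo] --> (normc (f ((X t) +i* y)))%:E.
Proof.
move=> d0 dt td; have pi0 := pi_gt0 R.
have c0 : cos ((t - pi) / 2) != 0.
  by rewrite gt_eqF// cos_gt0_pihalf//; lra.
have line := mobius_inv_line r0 r1 c0.
have Fb : F (b t) = f (X t +i* y).
  by rewrite /disc_pullback line /X /l; congr f; apply: complex_ext => /=; ring.
apply: cvg_EFin; first by near=> n.
apply/cvgrPdist_lt => e e0.
have dF : cdifferentiable F (b t).
  by apply: cdifferentiable_disc_pullback; [exact: disc_curve_neq1|rewrite line].
have [d1 d10 dP] := cdifferentiable_continuous dF e0.
near=> n.
rewrite -Fb distrC; apply: le_lt_trans (normc_dist _ _) _.
have -> : (q_ n)%:C * b t = b t + - (n.+2%:R^-1)%:C * b t.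
  by rewrite /q_ rmorphB rmorph1; ring.
apply: dP; rewrite mulNr normc_opp normc_qb ?invr_ge0//.
near: n.
have := @cvg_harmonic R => /cvgrPdist_lt/(_ _ d10) [N _ NP].
exists N => // n Nn; have := NP n.+1; rewrite /= sub0r normrN ger0_norm ?invr_ge0//.
by apply; rewrite /= (leq_trans Nn).
Unshelve. all: by end_near. Qed.

(** The bound must not involve [B], which depends on [y] and [f]. On [[d, 2 * pi - d]] dominated
    convergence leads to a limit of at most [2 * pi + 2 / l * K], by [x <= 1 + x^2] and the
    substitution; being within 1 of the limit costs 1, and the two end arcs together cost another
    1. *)
Lemma circle_integral_bound (p : R) : p < 1 -> exists2 q, p < q < 1 &
  (\int[mu]_(t in `[0%R, (2 * pi)%R]) normc (F (q%:C * b t)))%R <=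
    2 + 2 * pi + 2 / l * K.
Proof.
move=> p1; have pi2 := pi_ge2 R.
have B0 : 0 <= B by apply: le_trans (normc_ge0 _) (fB (w := 0 +i* y) _).
(* Chosen so that [d * B <= 1 / 2], the contribution of each of the two end arcs. *)
pose d : R := (2 * (B + 1))^-1.
have d0 : 0 < d by rewrite invr_gt0 mulr_gt0// ltr_wpDl.
have d1 : d < 1.
  by rewrite invf_lt1 ?mulr_gt0 ?ltr_wpDl//; lra.
have dB : d * B <= 1 / 2.
  by rewrite /d mulrC ler_pdivrMr ?mulr_gt0 ?ltr_wpDl//; lra.
pose D := `[d, (2 * pi - d)%R]%classic.
have cX t : d <= t <= 2 * pi - d -> {for t, continuous (fun t => normc (f (X t +i* y)))}.
  move=> tI; apply: (ccont_normc (g := fun t => f (X t +i* y))).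
  apply: (ccont_comp (g := fun t => X t +i* y)); last exact: df.
  by split; [apply: continuous_X; lra|exact: cvg_cst].
have cv : (\int[mu]_(t in D) (normc (F ((q_ n)%:C * b t)))%:E)%E @[n --> \oo] -->
    (\int[mu]_(t in D) (normc (f (X t +i* y)))%:E)%E.
  apply: (@dominated_cvg _ _ _ mu D _ _ _ (cst B%:E)).
  - exact: measurable_itv.
  - move=> n; apply: (measurable_int mu).
    by apply: continuous_integrable => t _; exact: cFq.
  - by move=> t; rewrite /D /= in_itv /= => /andP[dt td]; exact: (Fq_cvg d0).
  - by [].
  - by apply: continuous_integrable => t _; exact: cvg_cst.
  - move=> n t _; rewrite /= lee_fin ger0_norm ?normc_ge0//.
    by apply: FB; rewrite normc_qb.
have lim_le : (\int[mu]_(t in D) (normc (f (X t +i* y)))%:E <=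
    (2 * pi + 2 / l * K)%:E)%E.
  pose G (x : R) := normc (f (x +i* y)) ^+ 2.
  have cG : continuous G.
    move=> x; have cf : {for x, continuous (fun x : R => normc (f (x +i* y)))}.
      apply: (ccont_normc (g := fun x : R => f (x +i* y))).
      apply: (ccont_comp (g := fun x : R => x +i* y)); last exact: df.
      by split; [exact: cvg_id|exact: cvg_cst].
    exact: (@continuousM _ _ _ _ _ cf cf).
  have mX : measurable_fun D (fun t => normc (f (X t +i* y))).
    apply/measurable_EFinP; apply: (measurable_int mu).
    by apply: continuous_integrable => t; rewrite in_itv /=; exact: cX.
  have mGX : measurable_fun D (fun t => G (X t)) by exact: measurable_funX.
  apply: (@le_trans _ _ (\int[mu]_(t in D) (1%:E + (G (X t))%:E))%E).
    apply: ge0_le_integral => //.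
    - exact: measurable_itv.
    - by move=> t _; rewrite lee_fin normc_ge0.
    - exact/measurable_EFinP.
    - by apply/measurable_EFinP; apply: measurable_funD => //; exact: measurable_cst.
    - move=> t _; rewrite -EFinD lee_fin /G.
      have := normc_ge0 (f (X t +i* y)); nra.
  rewrite ge0_integralD//; last 3 first.
  - exact: measurable_itv.
  - by move=> t _; rewrite lee_fin sqr_ge0.
  - exact/measurable_EFinP.
  rewrite EFinD; apply: leeD; last first.
    by apply: line_substitution => //; [lra|move=> x; rewrite sqr_ge0].
  rewrite integral_cst//=; last exact: measurable_itv.
  rewrite lebesgue_measure_itv /= lte_fin; case: ifPn => _.
    by rewrite mul1e -EFinD lee_fin; lra.
  by rewrite mule0 lee_fin; lra.
pose I n := (\int[mu]_(t in D) normc (F ((q_ n)%:C * b t)))%R.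
pose L := (\int[mu]_(t in D) normc (f (X t +i* y)))%R.
have IE n : (I n)%:E = (\int[mu]_(t in D) (normc (F ((q_ n)%:C * b t)))%:E)%E.
  by rewrite EFin_Rintegral// => t _; exact: cFq.
have LE : L%:E = (\int[mu]_(t in D) (normc (f (X t +i* y)))%:E)%E.
  by rewrite EFin_Rintegral// => t; rewrite in_itv /=; exact: cX.
rewrite -LE lee_fin in lim_le.
have {cv} : I n @[n --> \oo] --> L.
  by apply: fine_cvg; move: cv; rewrite -LE; under eq_fun do rewrite -IE.
move=> /cvgrPdist_lt/(_ _ ltr01) [N1 _ N1P].
have p0 : 0 < 1 - p by rewrite subr_gt0.
have := @cvg_harmonic R => /cvgrPdist_lt/(_ _ p0) [N2 _ N2P].
(* [N1] brings the mean within 1 of its limit, [N2] brings the radius beyond [p]. *)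
pose n := maxn N1 N2.
have qp : p < q_ n.
  have := N2P n.+1 (leqW (leq_maxr _ _)).
  rewrite /= sub0r normrN ger0_norm ?invr_ge0// /q_; set h := (_.+2%:R^-1); lra.
exists (q_ n); first by rewrite qp q_lt1.
have := N1P n (leq_maxl _ _); rewrite /= ltr_norml => /andP[h1 _].
have cFI u v : {in `[u, v], continuous (fun t => normc (F ((q_ n)%:C * b t)))}.
  by move=> t _; exact: cFq.
have FqB u v : {in `[u, v], forall t, normc (F ((q_ n)%:C * b t)) <= B}.
  by move=> t _; apply: FB; rewrite normc_qb.
rewrite (@Rintegral_split _ _ _ _ d)//; [|lra|lra].
rewrite (@Rintegral_split _ _ d _ (2 * pi - d))//; [|lra|lra].
rewrite -[X in _ + (X + _)]/(I n).
have i1 := @Rintegral_le_cst _ _ 0 d B (ltW d0) (cFI _ _) (FqB _ _).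
have i2 : 2 * pi - d <= 2 * pi by lra.
have {}i2 := @Rintegral_le_cst _ _ _ _ B i2 (cFI _ _) (FqB _ _).
move: i1 i2; move: (Rintegral _ _ _) (Rintegral _ _ _) => x1 x2; lra.
Qed.

End trace.
End boundary_limit.

(** * L^2 norms and traces of Hardy functions *)

Section L2_norms.
Variable R : realType.
Notation mu := (@lebesgue_measure R).

Lemma measurable_ReB (f g : R -> R[i]) :
  measurable_fun [set: measurableTypeR R] (fun x => complex.Re (f x)) ->
  measurable_fun [set: measurableTypeR R] (fun x => complex.Re (g x)) ->
  measurable_fun [set: measurableTypeR R] (fun x => complex.Re (f x - g x)).
Proof. by move=> mf mg; under eq_fun do rewrite cReD cReN; exact: measurable_funB. Qed.

Lemma measurable_ImB (f g : R -> R[i]) :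
  measurable_fun [set: measurableTypeR R] (fun x => complex.Im (f x)) ->
  measurable_fun [set: measurableTypeR R] (fun x => complex.Im (g x)) ->
  measurable_fun [set: measurableTypeR R] (fun x => complex.Im (f x - g x)).
Proof. by move=> mf mg; under eq_fun do rewrite cImD cImN; exact: measurable_funB. Qed.

Lemma poweR_half_le (I : \bar R) (c : R) : (0 <= I)%E -> 0 <= c ->
  (poweR I 2^-1 <= c%:E)%E <-> (I <= (c ^+ 2)%:E)%E.
Proof.
case: I => [x| |] //; last first.
  by move=> _ _; rewrite poweRyr ?invr_eq0//; split; rewrite leye_eq.
rewrite lee_fin => x0 c0; rewrite poweR_EFin powR12_sqrt// !lee_fin.
split=> h; first by rewrite -(sqr_sqrtr x0) ler_sqr ?nnegrE ?sqrtr_ge0.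
by rewrite -ler_sqr ?nnegrE ?sqrtr_ge0// sqr_sqrtr.
Qed.

Lemma L2norm_lineE (g : R -> R[i]) :
  L2norm_line g = poweR (\int[mu]_x (normc (g x) ^+ 2)%:E)%E 2^-1.
Proof.
rewrite /L2norm_line unlock; congr poweR; apply: eq_integral => x _ /=.
by rewrite ger0_norm ?normc_ge0// powR_mulrn// normc_ge0.
Qed.

Lemma L2norm_line_le (g : R -> R[i]) (c : R) : 0 <= c ->
  (L2norm_line g <= c%:E)%E <->
  (\int[mu]_x (normc (g x) ^+ 2)%:E <= (c ^+ 2)%:E)%E.
Proof.
move=> c0; rewrite L2norm_lineE; apply: poweR_half_le => //.
by apply: integral_ge0 => x _; rewrite lee_fin sqr_ge0.
Qed.

Lemma L2norm_circle_le (c : R[i]) (r : R) (f : R[i] -> R[i]) (e : R) :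
  0 <= r -> 0 <= e ->
  (L2norm_circle c r f <= e%:E)%E <->
  (\int[mu]_(t in `[0%R, (2 * pi)%R])
     (normc (f (c + r%:C * expi t)) ^+ 2 * r)%:E <= (e ^+ 2)%:E)%E.
Proof.
move=> r0 e0; apply: poweR_half_le => //.
by apply: integral_ge0 => x _; rewrite lee_fin mulr_ge0// sqr_ge0.
Qed.

Lemma measurable_normc_sqr (g : R -> R[i]) :
  measurable_fun [set: measurableTypeR R] (fun x => complex.Re (g x)) ->
  measurable_fun [set: measurableTypeR R] (fun x => complex.Im (g x)) ->
  measurable_fun [set: measurableTypeR R] (fun x => normc (g x) ^+ 2).
Proof.
move=> mr mi.
rewrite (_ : (fun _ => _) = fun x => complex.Re (g x) ^+ 2 + complex.Im (g x) ^+ 2).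
  by apply: measurable_funD; exact: measurable_funX.
by apply/funext => x; rewrite normc_sqr.
Qed.

Lemma measurable_ccont (g : R -> R[i]) : (forall t, ccont g t) ->
  measurable_fun [set: measurableTypeR R] (fun x => complex.Re (g x)) /\
  measurable_fun [set: measurableTypeR R] (fun x => complex.Im (g x)).
Proof.
move=> cg; split; apply: continuous_measurable_fun => t; by have [] := cg t.
Qed.

Section hardy.
Variable f : R[i] -> R[i].
Hypothesis df : forall w, 0 < complex.Im w -> cdifferentiable f w.

Lemma ccont_line y : 0 < y -> forall x : R, ccont (fun x : R => f (x +i* y)) x.
Proof.
move=> y0 x; apply: (ccont_comp (g := fun x : R => x +i* y)); last exact: df.
by split; [exact: cvg_id|exact: cvg_cst].
Qed.

(** The infimum being below 2, some boundary value [g] has norm below 2. Traces at small height are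
    within 1 of it, and [|x + y|^2 <= 2 |x|^2 + 2 |y|^2] gives [2 * 1 + 2 * 4 = 10]. The point is
    that this number does not depend on [f]. *)
Lemma hardy2_norm_trace : (hardy2_norm f <= 1%:E)%E ->
  exists2 d : R, 0 < d & forall y, 0 < y -> y < d ->
    (\int[mu]_x (normc (f (x +i* y)) ^+ 2)%:E <= 10%:E)%E.
Proof.
move=> f1.
have /ereal_inf_lt[_ [g [mr mi cvg0] <-] g2] : (hardy2_norm f < 2%:E)%E.
  by apply: le_lt_trans f1 _; rewrite lte_fin; lra.
have {g2} Ig : (\int[mu]_x (normc (g x) ^+ 2)%:E <= (2 ^+ 2)%:E)%E.
  by apply/L2norm_line_le => //; exact: ltW.
have [d d0 dP] : exists2 d : R, 0 < d & forall y, 0 < y -> y < d ->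
    (L2norm_line (fun x => f (x +i* y) - g x)%R <= 1%:E)%E.
  have n0 : nbhs (0%E : \bar R) [set x | (x <= 1%:E)%E].
    suff : nbhs (0 : R) (fun x : R => (x%:E <= 1%:E)%E) by [].
    apply/nbhs_ballP; exists 1 => //= x; rewrite /ball /= sub0r normrN lee_fin.
    by move=> /ltW; apply: le_trans; exact: ler_norm.
  have /nbhs_ballP[/= d d0 dP] := cvg0 _ n0.
  exists d => // y y0 yd; apply: dP => //.
  by rewrite /ball /= sub0r normrN gtr0_norm.
exists d => // y y0 yd.
have /L2norm_line_le Id := dP y y0 yd.
have {}Id := Id ler01.
have [mfr mfi] := measurable_ccont (ccont_line y0).
have mf2 := measurable_normc_sqr mfr mfi.
have mg2 := measurable_normc_sqr mr mi.
have md2 : measurable_fun [set: measurableTypeR R] (fun x => normc (f (x +i* y) - g x) ^+ 2).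
  apply: measurable_normc_sqr.
    exact: measurable_ReB.
  exact: measurable_ImB.
apply: (@le_trans _ _ (\int[mu]_x (2%:E * (normc (f (x +i* y) - g x)%R ^+ 2)%:E +
    2%:E * (normc (g x) ^+ 2)%:E))%E).
  apply: ge0_le_integral => //.
  - by move=> x _; rewrite lee_fin sqr_ge0.
  - exact/measurable_EFinP.
  - apply: emeasurable_funD; apply: measurable_funeM; exact/measurable_EFinP.
  - move=> x _; rewrite -!EFinM -EFinD lee_fin.
    have := normc_triangle (f (x +i* y) - g x) (g x); rewrite subrK.
    have := normc_ge0 (f (x +i* y)).
    set u := normc (f _); set v := normc (_ - _); set w := normc (g x) => u0 h.
    have : u ^+ 2 <= (v + w) ^+ 2 by rewrite ler_sqr ?nnegrE// (le_trans u0 h).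
    have := sqr_ge0 (v - w); lra.
rewrite ge0_integralD//; last 4 first.
- by move=> x _; rewrite mule_ge0// lee_fin ?sqr_ge0.
- by apply: measurable_funeM; exact/measurable_EFinP.
- by move=> x _; rewrite mule_ge0// lee_fin ?sqr_ge0.
- by apply: measurable_funeM; exact/measurable_EFinP.
rewrite !ge0_integralZl//; last 4 first.
- exact/measurable_EFinP.
- by move=> x _; rewrite lee_fin sqr_ge0.
- exact/measurable_EFinP.
- by move=> x _; rewrite lee_fin sqr_ge0.
apply: (@le_trans _ _ (2%:E * (1 ^+ 2)%:E + 2%:E * (2 ^+ 2)%:E)%E).
  by apply: leeD; apply: lee_pmul => //; rewrite ?lee_fin//;
    apply: integral_ge0 => x _; rewrite lee_fin sqr_ge0.
by rewrite -!EFinM -EFinD lee_fin; lra.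
Qed.

(** Here [K] depends on [f], so it may enter only qualitatively, through [bounded_above_line]. *)
Lemma hardy2_trace_bound :
  (ereal_sup [set L2norm_line (fun x => f (x +i* y)) | y in [set y : R | (0 < y)%R]]
     < +oo)%E ->
  exists2 K : R, 0 <= K & forall y, 0 < y ->
    (\int[mu]_x (normc (f (x +i* y)) ^+ 2)%:E <= K%:E)%E.
Proof.
set S := ereal_sup _ => Soo.
have SP y : 0 < y -> (L2norm_line (fun x => f (x +i* y)) <= S)%E.
  by move=> y0; apply: ereal_sup_ubound; exists y.
have S0 : (0 <= S)%E by apply: le_trans (SP 1 ltr01); exact: Lnorm_ge0.
have Sfin : S \is a fin_num by rewrite ge0_fin_numE.
have fS0 : 0 <= fine S by exact: fine_ge0.
exists (fine S ^+ 2) => [|y y0]; first exact: sqr_ge0.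
by apply/L2norm_line_le => //; rewrite fineK// SP.
Qed.

End hardy.
End L2_norms.

(** * The upper bound *)

Section exponents.
Variables (R : realType) (a q : R).
Hypotheses (a0 : 0 < a) (aq : a < q) (q1 : q < 1).
Local Notation g := (ln q / ln a).

Let q0 : 0 < q. Proof. exact: lt_trans aq. Qed.

Let ln_a : ln a < 0.
Proof. by rewrite ln_lt0// a0 (lt_trans aq). Qed.

Let ln_q : ln q < 0.
Proof. by rewrite ln_lt0// q0. Qed.

Lemma exponent_gt0 : 0 < g.
Proof. by rewrite -divrNN divr_gt0 ?oppr_gt0. Qed.

Lemma powR_exponent : a `^ g = q.
Proof. by rewrite /powR gt_eqF// divfK ?lt_eqF// lnK ?posrE. Qed.

Lemma powR_exponentX n : (a ^+ n) `^ g = q ^+ n.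
Proof.
rewrite -powR_mulrn ?(ltW a0)// -powRrM mulrC powRrM powR_exponent.
by rewrite powR_mulrn// ltW.
Qed.

Lemma expr_le_small (e : R) : 0 < e -> exists n, a ^+ n <= e.
Proof.
move=> e0; have a1 : `|a| < 1 by rewrite gtr0_norm// (lt_trans aq).
have := cvg_expr a1 => /cvgrPdist_lt/(_ _ e0)[n _ nP]; exists n.
have := nP n (leqnn _); rewrite /= sub0r normrN ger0_norm => [/ltW//|].
by rewrite exprn_ge0// ltW.
Qed.

(** [N] is the least exponent with [a^N <= e], and minimality gives the other inequality; [e < 1]
    forces [N > 0]. *)
Lemma exists_scale (e : R) : 0 < e -> e < 1 -> exists N : nat,
  [/\ (0 < N)%N, a ^+ N <= e & a * e < a ^+ N].
Proof.
move=> e0 e1; have := expr_le_small e0 => exN.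
have [N aN Nmin] := ex_minnP exN.
case: N aN Nmin => [|N] aN Nmin; first by move: aN; rewrite expr0 leNgt e1.
exists N.+1; split => //; rewrite exprS ltr_pM2l// ltNge.
by apply/negP => /Nmin; rewrite ltnn.
Qed.

(** Since [q^N = (a^N)^g], a power [a^N] comparable to [e] makes [q^N] at most [e^g] and [e / a^N]
    at most [1 / a]. *)
Lemma exists_order (e : R) : 0 < e -> exists N : nat,
  q ^+ N <= e `^ g /\ ((q / a) ^+ N - 1) * e <= e `^ g / a.
Proof.
move=> e0; have g0 := exponent_gt0.
(* For [e >= 1] the order [N = 0] serves: the first left-hand side is 1 and the second vanishes. *)
have [e1|e1] := leP 1 e.
  exists 0%N; rewrite !expr0 subrr mul0r; split; last by rewrite divr_ge0 ?powR_ge0// ltW.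
  have : 1 `^ g <= e `^ g by rewrite ge0_ler_powR ?nnegrE// ltW.
  by rewrite powR1.
have [N [_ aN eN]] := exists_scale e0 e1.
have qN : q ^+ N <= e `^ g.
  by rewrite -powR_exponentX ge0_ler_powR ?nnegrE ?exprn_ge0// ltW.
exists N; split => //.
have aN0 : 0 < a ^+ N by rewrite exprn_gt0.
have h : e / a ^+ N <= a^-1.
  by rewrite ler_pdivrMr// mulrC ler_pdivlMr// mulrC ltW.
rewrite expr_div_n; apply: (@le_trans _ _ (q ^+ N * (e / a ^+ N))).
  have -> : q ^+ N * (e / a ^+ N) = q ^+ N / a ^+ N * e by ring.
  by rewrite ler_wpM2r ?(ltW e0)// lerBlDr lerDl.
apply: ler_pM => //; first by rewrite exprn_ge0// ltW.
by rewrite divr_ge0// ltW.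
Qed.

End exponents.

Section upper_bound.
Variable R : realType.
Notation mu := (@lebesgue_measure R).

Lemma Rintegral_shift (G : R -> R) (c u v : R) : u <= v -> continuous G ->
  (\int[mu]_(x in `[(u + c)%R, (v + c)%R]) G x =
   \int[mu]_(x in `[u, v]) G (x + c))%R.
Proof. by move=> uv cG; rewrite /Rintegral integral_itv_shift. Qed.

Lemma Rintegral_periodic (G : R -> R) (T c : R) : 0 <= c -> c <= T ->
  continuous G -> (forall x, G (x + T) = G x) ->
  (\int[mu]_(x in `[0%R, T]) G (x + c) = \int[mu]_(x in `[0%R, T]) G x)%R.
Proof.
move=> c0 cT cG GT; have T0 := le_trans c0 cT.
have cGI u v : {in `[u, v], continuous G} by move=> x _; exact: cG.
rewrite -Rintegral_shift// add0r (@Rintegral_split _ _ c (T + c) T)//; last first.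
  by rewrite lerDl.
rewrite (_ : (\int[mu]_(x in `[T, (T + c)%R]) G x = \int[mu]_(x in `[0%R, c]) G x)%R).
  by rewrite addrC -Rintegral_split.
rewrite -[X in `[X, _]]add0r [T + c]addrC Rintegral_shift//.
by apply: eq_Rintegral => x _; rewrite GT.
Qed.

Lemma mul_i_expi (t : R) : 'i%C * expi t = expi (t + pi / 2).
Proof.
by apply: complex_ext; rewrite /expi /= ?cosDpihalf ?sinDpihalf; ring.
Qed.

Section circle.
Variables (r : R) (f : R[i] -> R[i]).
Hypotheses (r0 : 0 < r) (r1 : r < 1).
Hypothesis df : forall w, 0 < complex.Im w -> cdifferentiable f w.

Lemma Im_circle (t : R) : 0 < complex.Im ('i%C + r%:C * expi t).
Proof.
have -> : complex.Im ('i%C + r%:C * expi t) = 1 + r * sin t by rewrite /expi /=; ring.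
have : r * -1 <= r * sin t by rewrite ler_wpM2l ?sin_geN1// ltW.
have := r1; lra.
Qed.

Lemma ccont_circle (y t : R) : 0 <= y ->
  ccont (fun t => f ('i%C + r%:C * expi t + y%:C * 'i%C)) t.
Proof.
move=> y0; apply: (ccont_comp (g := fun t => 'i%C + r%:C * expi t + y%:C * 'i%C)).
  apply: ccontD (ccont_cst _ _).
  exact: pder_ccont (pder_path 'i%C r (pder_expi t)).
apply: df; apply: lt_le_trans (Im_circle t) _.
by rewrite cImD lerDl /= mul0r addr0 mulr1.
Qed.

Lemma ccont_circle0 (t : R) : ccont (fun t => f ('i%C + r%:C * expi t)) t.
Proof.
have -> : (fun t => f ('i%C + r%:C * expi t)) =
    (fun t => f ('i%C + r%:C * expi t + 0%:C * 'i%C)).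
  by apply/funext => u; rewrite mul0r addr0.
exact: ccont_circle.
Qed.

(** In place of Cauchy-Schwarz, [h <= e + h^2 / e]: both terms integrate to a multiple of [e]. *)
Lemma circle_mean_le (e : R) : 0 < e -> (L2norm_circle 'i%C r f <= e%:E)%E ->
  (\int[mu]_(t in `[0%R, (2 * pi)%R]) normc (f ('i%C + r%:C * expi t)))%R <=
  (2 * pi + r^-1) * e.
Proof.
move=> e0 /(L2norm_circle_le _ _ (ltW r0) (ltW e0)) fe.
have pi0 := pi_gt0 R; have pi2 : 0 <= 2 * pi :> R by rewrite mulr_ge0// ltW.
pose h t := normc (f ('i%C + r%:C * expi t)).
have ch t : {for t, continuous h} by exact: ccont_normc (ccont_circle0 t).
have ch2 t : {for t, continuous (fun t => h t ^+ 2)}.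
  exact: (@continuousM _ _ _ _ _ (ch t) (ch t)).
have cZ (k : R) t : {for t, continuous (fun t => k * h t ^+ 2)}.
  exact: (@continuousM _ _ (cst k) _ t (cvg_cst _) (ch2 t)).
have {}fe : r * (\int[mu]_(t in `[0%R, (2 * pi)%R]) (h t ^+ 2))%R <= e ^+ 2.
  rewrite -RintegralZl//; last by apply: continuous_integrable => t _; exact: ch2.
  rewrite -lee_fin EFin_Rintegral; last by move=> t _; exact: cZ.
  by apply: le_trans fe; under eq_integral do rewrite mulrC.
have le1 : (\int[mu]_(t in `[0%R, (2 * pi)%R]) h t)%R <=
   (\int[mu]_(t in `[0%R, (2 * pi)%R]) (e + e^-1 * h t ^+ 2))%R.
  apply: le_Rintegral => //.
  - by apply: continuous_integrable => t _; exact: ch.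
  - apply: continuous_integrable => t _.
    exact: (@continuousD _ _ _ (cst e) _ t (cvg_cst _) (cZ _ t)).
  move=> t _; rewrite -(ler_pM2l e0) mulrDr mulrA mulfV ?gt_eqF// mul1r.
  by have := sqr_ge0 (e - h t); have := sqr_ge0 (e + h t); nra.
apply: (le_trans le1); rewrite RintegralD//; last 2 first.
- by apply: continuous_integrable => t _; exact: cvg_cst.
- by apply: continuous_integrable => t _; exact: cZ.
rewrite Rintegral_cst// lebesgue_itvcc// RintegralZl//; last first.
  by apply: continuous_integrable => t _; exact: ch2.
move: fe; move: (Rintegral _ _ _) => I fe.
have {}fe : e^-1 * I <= r^-1 * e.
  rewrite mulrC ler_pdivrMr// -(ler_pM2l r0) (le_trans fe)//.
  by rewrite !mulrA mulfV ?gt_eqF// mul1r -expr2.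
lra.
Qed.

(** The parametrization from [mobius_inv_circle] runs a quarter-turn ahead of the one in
    [L2norm_circle]; periodicity absorbs this. *)
Lemma circle_mean_shift :
  (\int[mu]_(t in `[0%R, (2 * pi)%R]) normc (f ('i%C + r%:C * ('i%C * expi t))))%R =
  (\int[mu]_(t in `[0%R, (2 * pi)%R]) normc (f ('i%C + r%:C * expi t)))%R.
Proof.
have pi0 := pi_gt0 R.
rewrite -(@Rintegral_periodic (fun t => normc (f ('i%C + r%:C * expi t))) _ (pi / 2)).
- by apply: eq_Rintegral => t _; rewrite mul_i_expi.
- lra.
- lra.
- by move=> t; exact: ccont_normc (ccont_circle0 t).
- move=> t; congr (normc (f (_ + _ * _))).
  by rewrite /expi mulr_natl cosD2pi sinD2pi.
Qed.

(** By compactness of the parameter interval. The pullback sees only the circle raised by [y],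
    whereas the hypothesis on [f] concerns the circle itself. *)
Lemma circle_uniform (e : R) : 0 < e -> exists2 d, 0 < d &
  forall y t, 0 < y -> y < d -> t \in `[0, 2 * pi] ->
    normc (f ('i%C + r%:C * ('i%C * expi t) + y%:C * 'i%C)) <=
    normc (f ('i%C + r%:C * ('i%C * expi t))) + e.
Proof.
move=> e0; pose zeta (t : R) := 'i%C + r%:C * ('i%C * expi t).
have Iz t : 0 < complex.Im (zeta t) by rewrite /zeta mul_i_expi Im_circle.
have e20 : 0 < e / 2 by rewrite divr_gt0.
have /compact_near_coveringP cpt := @segment_compact R 0 (2 * pi).
pose P (y t : R) := normc (f (zeta t + y%:C * 'i%C) - f (zeta t)) < e.
have /nbhs_ballP[/= d d0 dP] : \forall y \near (0 : R)^'+, `[0, 2 * pi]%classic `<=` P y.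
  apply: cpt.
  move=> t _.
  have [d d0 dP] := cdifferentiable_continuous (df (Iz t)) e20.
  (* Moving [t] by less than [d / 4] moves [zeta t] by less than [d / 2], as [expi] is 2-Lipschitz,
     and raising by [y] adds less than [d / 2]. *)
  exists ([set t' | `|t' - t| < d / 4], [set y | 0 < y < d / 2]) => /=.
    split.
      apply/nbhs_ballP; exists (d / 4) => /=; first by rewrite divr_gt0.
      by move=> t'; rewrite /ball /= distrC.
    apply/nbhs_ballP; exists (d / 2) => /=; first by rewrite divr_gt0.
    by move=> y; rewrite /ball /= sub0r normrN => yd y0; rewrite gtr0_norm// y0 in yd *.
  move=> [t' y] /= [td /andP[y0 yd]].
  have lip : normc (zeta t' - zeta t) < d / 2.
    have -> : zeta t' - zeta t = r%:C * ('i%C * (expi t' - expi t)) by rewrite /zeta; ring.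
    rewrite !normcM normc_i mul1r normc_real gtr0_norm//.
    have : r * normc (expi t' - expi t) <= 1 * (2 * `|t' - t|).
      by apply: ler_pM; rewrite ?normc_ge0 ?expi_lipschitz// ltW.
    lra.
  rewrite /P /=.
  have -> : f (zeta t' + y%:C * 'i%C) - f (zeta t') =
    (f (zeta t + (zeta t' - zeta t + y%:C * 'i%C)) - f (zeta t)) -
    (f (zeta t + (zeta t' - zeta t)) - f (zeta t)).
    have -> : zeta t + (zeta t' - zeta t + y%:C * 'i%C) = zeta t' + y%:C * 'i%C by ring.
    have -> : zeta t + (zeta t' - zeta t) = zeta t' by ring.
    ring.
  rewrite (splitr e); apply: le_lt_trans (normc_sub _ _) _; apply: ltrD; apply: dP.
    apply: le_lt_trans (normc_triangle _ _) _.
    rewrite normcM normc_i mulr1 normc_real gtr0_norm//; lra.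
  by apply: lt_trans lip _; lra.
exists d => // y t y0 yd tI.
have := dP y; rewrite /ball /= sub0r normrN gtr0_norm// => /(_ yd y0 t tI).
rewrite /P => H.
have := normc_triangle (f (zeta t + y%:C * 'i%C) - f (zeta t)) (f (zeta t)).
rewrite subrK -/(zeta t); lra.
Qed.

End circle.

(** Bernoulli's inequality. It removes [p^N] from [(q / p)^N], the radius [p] being chosen after
    [N]. *)
Lemma expr_ge_half (N : nat) (p : R) : 1 - (2 * N.+1%:R)^-1 <= p -> p <= 1 ->
  2^-1 <= p ^+ N.
Proof.
move=> pN p1.
have n0 : 0 < 2 * N.+1%:R :> R by rewrite mulr_gt0.
set x := (2 * N.+1%:R)^-1 in pN *.
have h1 : x <= 2^-1 by rewrite lef_pV2 ?posrE// ler_peMr// ler1n.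
have hN : N.+1%:R * x = 2^-1.
  by rewrite /x invfM mulrCA mulfV ?mulr1// pnatr_eq0.
have p0 : 0 <= p by lra.
have bern n : 1 - n%:R * (1 - p) <= p ^+ n.
  elim: n => [|n IH]; first by rewrite mul0r subr0.
  rewrite exprSr; apply: le_trans (ler_wpM2r p0 IH).
  have : 0 <= n%:R * ((1 - p) ^+ 2) by rewrite mulr_ge0// sqr_ge0.
  by rewrite -[n.+1]addn1 natrD; lra.
apply: le_trans (bern N).
have : N%:R * (1 - p) <= N.+1%:R * x.
  by apply: ler_pM; rewrite ?ler_nat//; lra.
by rewrite hN; lra.
Qed.

(** Order of the choices: [C] from [r] and [z]; then, for given [f] and [eps], the height [y], the
    order [N], and last the radius [p], close to 1 in terms of [N]. Nothing chosen after [C]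
    survives in the final estimate. *)
Theorem upper_bound (r : R) (z : R[i]) : 0 < r -> r < 1 ->
  upper_half_plane z -> r < normc (z - 'i%C) ->
  exists2 C : R, 0 < C &
    forall (eps : R) (f : R[i] -> R[i]), 0 < eps ->
      hardy2 f -> (hardy2_norm f <= 1%:E)%E ->
      (L2norm_circle 'i%C r f <= eps%:E)%E ->
      normc (f z) <= C * eps `^ gamma r z.
Proof.
move=> r0 r1 z0 rz.
have a0 := rho_gt0 r0 r1; have a1 := rho_lt1 r0 r1.
have av := mobius_outside r0 r1 z0 rz; have v1 := mobius_normc_lt1 r0 r1 z0.
rewrite /gamma; set v := mobius r z in av v1 *; set a := rho r in a0 a1 av *.
set q := normc v in av v1 *.
have pi0 := pi_gt0 R; have pi2 : 0 <= 2 * pi :> R by rewrite mulr_ge0// ltW.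
have pa0 : 0 < 1 + a by rewrite addr_gt0.
have ma0 : 0 < 1 - a by rewrite subr_gt0.
have qa0 : 0 < q - a by rewrite subr_gt0.
have q10 : 0 < 1 - q by rewrite subr_gt0.
have ri0 : 0 < r^-1 by rewrite invr_gt0.
pose B := (1 + a) / (1 - a).
have B0 : 0 < B by exact: divr_gt0.
pose k := 2 * pi * ((1 - a) / (1 + a)).
have k0 : 0 < k by apply: mulr_gt0; [exact: mulr_gt0|exact: divr_gt0].
(* The bound of [circle_integral_bound] with the trace constant 10 of [hardy2_norm_trace]. *)
pose M := 2 + 2 * pi + 2 / (1 + r) * 10.
have M0 : 0 < M.
  have : 0 < 2 / (1 + r) by rewrite divr_gt0// addr_gt0.
  rewrite /M; lra.
(* [2 * pi + r^-1] is from [circle_mean_le]; the second [2 * pi] pays for the translation, which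
   costs at most [e] at each point of the circle. *)
pose C3 := 2 * pi + r^-1 + 2 * pi.
have C30 : 0 < C3 by rewrite /C3; lra.
pose A1 := 2 * B / (q - a) * C3 / a.
(* 8 is the product of the 2 in [two_circles], the 2 in [1 / (p - q) <= 2 / (1 - q)] and the 2 in
   [(q / p)^N <= 2 * e^g]. *)
pose A2 := 8 * B / (1 - q) * M.
have cB : 0 < 2 * B / (q - a) by apply: divr_gt0 => //; exact: mulr_gt0.
have A10 : 0 < A1 by apply: divr_gt0 => //; exact: mulr_gt0.
have A20 : 0 < A2.
  by apply: mulr_gt0 => //; apply: divr_gt0 => //; exact: mulr_gt0.
(* The [+ 1] pays for the distance from [f (z + i y)] to [f z], below [eta <= e^g]. *)
exists ((A1 + A2) / k + 1).
  by apply: addr_gt0 => //; apply: divr_gt0 => //; exact: addr_gt0.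
move=> e f e0 [af fsup] f1 fe.
have df w : 0 < complex.Im w -> cdifferentiable f w.
  by move=> w0; apply/cdifferentiableP; exact: af.
have [K K0 fK] := hardy2_trace_bound fsup.
have [d d0 fd] := hardy2_norm_trace df f1.
set g := ln q / ln a.
have eg0 : 0 < e `^ g by rewrite powR_gt0.
pose eta := Num.min e (e `^ g).
have eta0 : 0 < eta by rewrite lt_min e0.
have [d1 d10 fd1] := circle_uniform r0 r1 df eta0.
have [d2 d20 fd2] := cdifferentiable_continuous (df z z0) eta0.
pose y := Num.min (d / 2) (Num.min (d1 / 2) (d2 / 2)).
have y0 : 0 < y by rewrite !lt_min !divr_gt0.
have yd : y < d by rewrite gt_min; apply/orP; left; clear -d0; lra.
have yd1 : y < d1 by rewrite !gt_min; apply/orP; right; apply/orP; left; clear -d10; lra.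
have yd2 : y < d2 by rewrite !gt_min; apply/orP; right; apply/orP; right; clear -d20; lra.
have [Bf fB] := bounded_above_line df fK y0.
pose F := disc_pullback r f y.
have dF u : normc u < 1 -> cdifferentiable F u.
  exact: cdifferentiable_disc_pullback_disc.
have Fv : F v = f (z + y%:C * 'i%C) by rewrite /F /disc_pullback mobiusK// ltW.
have FG : (\int[mu]_(t in `[0%R, (2 * pi)%R]) normc (F (a%:C * disc_curve a t)))%R <= C3 * e.
  have E t : F (a%:C * disc_curve a t) = f ('i%C + r%:C * ('i%C * expi t) + y%:C * 'i%C).
    by rewrite /F /disc_pullback mobius_inv_circle.
  have c1 t : {for t, continuous (fun t => normc (f ('i%C + r%:C * ('i%C * expi t))))}.
    apply: (ccont_normc (g := fun t => f ('i%C + r%:C * ('i%C * expi t)))).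
    apply: (ccont_comp (g := fun t => 'i%C + r%:C * ('i%C * expi t)) (K := f)).
      exact: pder_ccont (pder_path 'i%C r (pderZ 'i%C (pder_expi t))).
    by apply: df; rewrite mul_i_expi Im_circle.
  have c2 t : {for t, continuous (fun t => normc (F (a%:C * disc_curve a t)))}.
    apply: ccont_normc; apply: (ccont_comp (g := fun t => a%:C * disc_curve a t)).
      exact: pder_ccont (pderZ _ (pder_disc_curve a0 a1 t)).
    apply: dF; rewrite normcM normc_disc_curve// mulr1 normc_real gtr0_norm//.
  apply: (@le_trans _ _ (\int[mu]_(t in `[0%R, (2 * pi)%R])
      (normc (f ('i%C + r%:C * ('i%C * expi t))) + e))%R).
    apply: le_Rintegral => //.
    - by apply: continuous_integrable => t _; exact: c2.
    - apply: continuous_integrable => t _.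
      exact: (@continuousD _ _ _ _ (cst e) t (c1 t) (cvg_cst _)).
    move=> t tI; rewrite E; apply: le_trans (fd1 y t y0 yd1 tI) _.
    by rewrite lerD2l ge_min lexx.
  rewrite RintegralD//; last 2 first.
  - by apply: continuous_integrable => t _; exact: c1.
  - by apply: continuous_integrable => t _; exact: cvg_cst.
  rewrite circle_mean_shift// Rintegral_cst// lebesgue_itvcc//.
  have := circle_mean_le r0 r1 df e0 fe; rewrite /C3; lra.
have [N [qN qaN]] := exists_order a0 av v1 e0; rewrite -/g in qN qaN.
(* The first term keeps [p - q] above [(1 - q) / 2], the second gives [p^N >= 1 / 2]. *)
pose p1 := Num.max ((1 + q) / 2) (1 - (2 * N.+1%:R)^-1).
have p11 : p1 < 1.
  rewrite gt_max; apply/andP; split; first by clear -v1; lra.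
  by rewrite gtrBl invr_gt0 mulr_gt0.
have [p /andP[pp1 pl1] FM] := circle_integral_bound r0 r1 df y0 (fd y y0 yd) fB p11.
rewrite -/F -/M in FM.
move: pp1; rewrite gt_max => /andP[pq pN].
have qp : q < p by clear -pq v1; lra.
have pN2 := expr_ge_half (ltW pN) (ltW pl1).
have := two_circles a0 a1 av qp pl1 dF N.
rewrite -/k -/B -/q => H.
have t1 : 2 * B / (q - a) * ((q / a) ^+ N - 1) *
   (\int[mu]_(t in `[0%R, (2 * pi)%R]) normc (F (a%:C * disc_curve a t)))%R <= A1 * e `^ g.
  have qa1 : 0 <= (q / a) ^+ N - 1.
    by rewrite subr_ge0 exprn_ege1// ler_pdivlMr// mul1r ltW.
  have c0 := ltW cB.
  apply: le_trans (ler_wpM2l (mulr_ge0 c0 qa1) FG) _.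
  have -> : 2 * B / (q - a) * ((q / a) ^+ N - 1) * (C3 * e) =
    2 * B / (q - a) * C3 * (((q / a) ^+ N - 1) * e) by ring.
  have -> : A1 * e `^ g = 2 * B / (q - a) * C3 * (e `^ g / a) by rewrite /A1; ring.
  by apply: ler_wpM2l => //; apply: mulr_ge0 => //; exact: ltW.
have t2 : 2 * B / (p - q) * (q / p) ^+ N *
   (\int[mu]_(t in `[0%R, (2 * pi)%R]) normc (F (p%:C * disc_curve a t)))%R <= A2 * e `^ g.
  have q0 : 0 < q := lt_trans a0 av.
  have p0 : 0 < p := lt_trans q0 qp.
  have i1 : (p - q)^-1 <= 2 / (1 - q).
    rewrite -[2 / _]invf_div lef_pV2 ?posrE ?divr_gt0 ?subr_gt0//.
    by clear -pq; lra.
  have i2 : (q / p) ^+ N <= 2 * e `^ g.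
    rewrite expr_div_n ler_pdivrMr ?exprn_gt0//.
    apply: (le_trans qN); rewrite -mulrA mulrCA ler_peMr ?(ltW eg0)//.
    by clear -pN2; lra.
  have -> : A2 * e `^ g = 2 * B * (2 / (1 - q)) * (2 * e `^ g) * M by rewrite /A2; ring.
  have pq0 : 0 <= (p - q)^-1 by rewrite invr_ge0 subr_ge0 ltW.
  have qpN : 0 <= (q / p) ^+ N by rewrite exprn_ge0// divr_ge0// ltW.
  apply: ler_pM => //.
  - by apply: mulr_ge0 => //; apply: mulr_ge0 => //; rewrite mulr_ge0 ?(ltW B0).
  - by apply: Rintegral_ge0 => t _; exact: normc_ge0.
  apply: ler_pM => //.
    by apply: mulr_ge0 => //; rewrite mulr_ge0 ?(ltW B0).
  by apply: ler_wpM2l => //; rewrite mulr_ge0 ?(ltW B0).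
have {}H : normc (F v) <= (A1 + A2) / k * e `^ g.
  rewrite mulrAC ler_pdivlMr// (le_trans H)// [leRHS]mulrDl; exact: lerD.
have hz : normc (f z) <= normc (F v) + eta.
  rewrite Fv -[f z](subKr (f (z + y%:C * 'i%C))).
  apply: le_trans (normc_sub _ _) _; rewrite lerD2l; apply/ltW/fd2.
  by rewrite normcM normc_i mulr1 normc_real gtr0_norm.
apply: (le_trans hz); rewrite [leRHS]mulrDl mul1r; apply: lerD => //.
by rewrite ge_min lexx orbT.
Qed.

End upper_bound.

(** * The extremal function *)

Section complex_limits.
Variable R : realType.
Implicit Types (x y : nat -> R[i]) (l m : R[i]).

(** Convergence in the real modulus; [clim_lim] identifies it with the limit in [R[i]^o] that
    defines [M_fun]. *)
Definition clim x l : Prop := forall e : R, 0 < e ->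
  exists N0, forall N, (N0 <= N)%N -> normc (x N - l) < e.

Lemma clim_cvg x l : clim x l -> (x : nat -> R[i]^o) @ \oo --> (l : R[i]^o).
Proof.
move=> xl; apply/cvgrPdist_lt => e e0.
have eE : e = (complex.Re e)%:C.
  by move: e0; rewrite ltcE /= => /andP[/eqP]; case: (e) => a b /= ->.
move: e0; rewrite eE ltcR => /xl[N0 NP]; exists N0 => // N /NP.
by rewrite normc_distC normr_complex ltcR.
Qed.

Lemma clim_lim x l : clim x l -> lim ((x : nat -> R[i]^o) @ \oo) = l.
Proof. by move=> /clim_cvg; apply: cvg_lim; exact: norm_hausdorff. Qed.

Lemma clim_ext x y l : x =1 y -> clim x l -> clim y l.
Proof. by move=> /funext ->. Qed.

Lemma clim_ReIm x a b :
  (fun n => complex.Re (x n)) @ \oo --> a ->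
  (fun n => complex.Im (x n)) @ \oo --> b -> clim x (a +i* b).
Proof.
move=> xa xb e e0; have e2 : 0 < e / 2 by rewrite divr_gt0.
have [N1 _ P1] := (cvgrPdist_lt _ _).1 xa _ e2.
have [N2 _ P2] := (cvgrPdist_lt _ _).1 xb _ e2.
exists (maxn N1 N2) => N; rewrite geq_max => /andP[/P1 h1 /P2 h2].
rewrite (le_lt_trans (normc_ReIm _))// (splitr e) ltrD//.
  by rewrite cReD cReN distrC.
by rewrite cImD cImN distrC.
Qed.

Lemma climD x y l m : clim x l -> clim y m -> clim (fun n => x n + y n) (l + m).
Proof.
move=> xl ym e e0; have e2 : 0 < e / 2 by rewrite divr_gt0.
have [N1 P1] := xl _ e2; have [N2 P2] := ym _ e2.
exists (maxn N1 N2) => N; rewrite geq_max => /andP[/P1 h1 /P2 h2].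
have -> : x N + y N - (l + m) = (x N - l) + (y N - m) by ring.
by rewrite (le_lt_trans (normc_triangle _ _))// (splitr e) ltrD.
Qed.

Lemma climZ (c : R[i]) x l : clim x l -> clim (fun n => c * x n) (c * l).
Proof.
move=> xl e e0; have c0 : 0 < normc c + 1 by rewrite ltr_wpDl ?normc_ge0.
have [N0 P0] := xl _ (divr_gt0 e0 c0); exists N0 => N /P0.
rewrite -mulrBr normcM ltr_pdivlMr// => h; apply: le_lt_trans h.
by rewrite mulrC ler_wpM2l ?normc_ge0// lerDl.
Qed.

Lemma climB x y l m : clim x l -> clim y m -> clim (fun n => x n - y n) (l - m).
Proof.
move=> xl /(climZ (-1)); rewrite mulN1r => /(climD xl).
by apply: clim_ext => n; rewrite mulN1r.
Qed.

Lemma clim_le x l (B : R) : clim x l -> (forall n, normc (x n) <= B) -> normc l <= B.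
Proof.
move=> xl xB; apply/ler_addgt0Pl => e /xl[N /(_ N (leqnn _)) h].
have := normc_triangle (x N) (- (x N - l)); rewrite normc_opp.
have -> : x N + - (x N - l) = l by ring.
have := xB N; lra.
Qed.

Lemma clim_Re_ge x l (B : R) : clim x l ->
  (exists N0, forall n, (N0 <= n)%N -> B <= complex.Re (x n)) -> B <= complex.Re l.
Proof.
move=> xl [N0 xB]; apply/ler_addgt0Pl => e /xl[N1 /(_ (maxn N0 N1) (leq_maxr _ _)) h].
have := le_lt_trans (normc_Re _) h; rewrite cReD cReN ltr_norml => /andP[_].
have := xB _ (leq_maxl N0 N1); lra.
Qed.

Lemma normc_sum (I : Type) (s : seq I) (F : I -> R[i]) :
  normc (\sum_(i <- s) F i) <= \sum_(i <- s) normc (F i).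
Proof.
elim: s => [|i s IH]; first by rewrite !big_nil ComplexField.Normc.normc0.
by rewrite !big_cons (le_trans (normc_triangle _ _))// lerD2l.
Qed.

Lemma Re_sum (I : Type) (s : seq I) (F : I -> R[i]) :
  complex.Re (\sum_(i <- s) F i) = \sum_(i <- s) complex.Re (F i).
Proof. by elim: s => [|i s IH]; rewrite ?big_nil// !big_cons cReD IH. Qed.

Lemma Im_sum (I : Type) (s : seq I) (F : I -> R[i]) :
  complex.Im (\sum_(i <- s) F i) = \sum_(i <- s) complex.Im (F i).
Proof. by elim: s => [|i s IH]; rewrite ?big_nil// !big_cons cImD IH. Qed.

Lemma bounded_series_cvg (u : nat -> R) (S : R) :
  (forall N, \sum_(0 <= n < N) `|u n| <= S) ->
  cvgn (fun N => \sum_(0 <= n < N) u n).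
Proof.
move=> uS; apply: (@normed_cvg R R^o u).
apply: nondecreasing_is_cvgn.
  by apply: nondecreasing_series => n _ _; exact: normr_ge0.
by exists S => _ [N _ <-]; exact: uS.
Qed.

Lemma clim_series (c : nat -> R[i]) (S : R) :
  (forall N, \sum_(0 <= n < N) normc (c n) <= S) ->
  exists l, clim (fun N => \sum_(0 <= n < N) c n) l.
Proof.
move=> cS.
have /cvg_ex[a ca] : cvgn (fun N => \sum_(0 <= n < N) complex.Re (c n)).
  apply: (@bounded_series_cvg _ S) => N; apply: le_trans (cS N).
  by apply: ler_sum => n _; exact: normc_Re.
have /cvg_ex[b cb] : cvgn (fun N => \sum_(0 <= n < N) complex.Im (c n)).
  apply: (@bounded_series_cvg _ S) => N; apply: le_trans (cS N).
  by apply: ler_sum => n _; exact: normc_Im.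
exists (a +i* b); apply: clim_ReIm.
  by under eq_fun do rewrite Re_sum.
by under eq_fun do rewrite Im_sum.
Qed.

Lemma expr_sub_le (u w : R[i]) n : normc u <= 1 -> normc w <= 1 ->
  normc (u ^+ n - w ^+ n) <= n%:R * normc (u - w).
Proof.
move=> u1 w1; elim: n => [|n IH].
  by rewrite !expr0 subrr ComplexField.Normc.normc0 mul0r.
have -> : u ^+ n.+1 - w ^+ n.+1 = u * (u ^+ n - w ^+ n) + (u - w) * w ^+ n.
  by rewrite !exprS; ring.
apply: le_trans (normc_triangle _ _) _; rewrite !normcM normcX.
have h1 : normc u * normc (u ^+ n - w ^+ n) <= 1 * (n%:R * normc (u - w)).
  by apply: ler_pM; rewrite ?normc_ge0.
have h2 : normc (u - w) * normc w ^+ n <= normc (u - w) * 1.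
  by rewrite ler_wpM2l ?normc_ge0// exprn_ile1 ?normc_ge0.
by rewrite -[n.+1]addn1 natrD; lra.
Qed.

(** By induction, multiplying the previous remainder by [u]; [n^2] is a crude form of the sharp
    [n (n - 1) / 2]. *)
Lemma expr_taylor_le (u w : R[i]) n : normc u <= 1 -> normc w <= 1 ->
  normc (w ^+ n - u ^+ n - n%:R * u ^+ n.-1 * (w - u)) <=
  n%:R ^+ 2 * normc (w - u) ^+ 2.
Proof.
move=> u1 w1; case: n => [|n] /=.
  by rewrite !expr0 subrr !mul0r subrr ComplexField.Normc.normc0 expr0n mul0r.
elim: n => [|n IH].
  by rewrite !expr1 expr0 !mul1r subrr ComplexField.Normc.normc0 mulr_ge0// sqr_ge0.
have -> : w ^+ n.+2 - u ^+ n.+2 - n.+2%:R * u ^+ n.+1 * (w - u) =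
    u * (w ^+ n.+1 - u ^+ n.+1 - n.+1%:R * u ^+ n * (w - u)) +
    (w - u) * (w ^+ n.+1 - u ^+ n.+1).
  by rewrite !exprS -[n.+2]addn1 natrD; ring.
apply: le_trans (normc_triangle _ _) _; rewrite !normcM.
have h1 : normc u * normc (w ^+ n.+1 - u ^+ n.+1 - n.+1%:R * u ^+ n * (w - u)) <=
    1 * (n.+1%:R ^+ 2 * normc (w - u) ^+ 2).
  by apply: ler_pM; rewrite ?normc_ge0.
have h2 : normc (w - u) * normc (w ^+ n.+1 - u ^+ n.+1) <=
    normc (w - u) * (n.+1%:R * normc (w - u)).
  by rewrite ler_wpM2l ?normc_ge0// expr_sub_le.
have h3 : 0 <= n.+1%:R * normc (w - u) ^+ 2 by rewrite mulr_ge0// sqr_ge0.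
have h4 : 0 <= normc (w - u) ^+ 2 by exact: sqr_ge0.
by rewrite -[n.+2]addn1 natrD; lra.
Qed.

Section power_series.
Variables (b : nat -> R[i]) (S0 S2 : R).
Hypothesis bS0 : forall N, \sum_(0 <= n < N) normc (b n) <= S0.
Hypothesis bS2 : forall N, \sum_(0 <= n < N) n%:R ^+ 2 * normc (b n) <= S2.

Let psum (u : R[i]) N := \sum_(0 <= n < N) b n * u ^+ n.

Lemma power_series_cvg (u : R[i]) : normc u <= 1 -> exists l, clim (psum u) l.
Proof.
move=> u1; apply: (@clim_series _ S0) => N; apply: le_trans (bS0 N).
apply: ler_sum => n _; rewrite normcM normcX ler_piMr ?normc_ge0//.
by rewrite exprn_ile1 ?normc_ge0.
Qed.

Variable G : R[i] -> R[i].
Hypothesis GP : forall u, normc u <= 1 -> clim (psum u) (G u).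

Lemma power_series_le (u : R[i]) (S : R) : normc u <= 1 ->
  (forall N, \sum_(0 <= n < N) normc (b n) * normc u ^+ n <= S) ->
  normc (G u) <= S.
Proof.
move=> /GP Gu uS; apply: (clim_le Gu) => N; apply: le_trans (uS N).
apply: le_trans (normc_sum _ _) _.
by apply: ler_sum => n _; rewrite normcM normcX.
Qed.

(** Valid up to the unit circle, which is what the boundary values of the extremal function
    require. *)
Lemma power_series_lipschitz (u w : R[i]) : normc u <= 1 -> normc w <= 1 ->
  normc (G u - G w) <= S2 * normc (u - w).
Proof.
move=> u1 w1; apply: (clim_le (climB (GP u1) (GP w1))) => N.
rewrite /psum -sumrB; apply: le_trans (normc_sum _ _) _.
apply: (@le_trans _ _ (\sum_(0 <= n < N) n%:R ^+ 2 * normc (b n) * normc (u - w))).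
  apply: ler_sum => n _; rewrite -mulrBr normcM -mulrA mulrCA.
  apply: ler_wpM2l; first exact: normc_ge0.
  apply: le_trans (expr_sub_le n u1 w1) _.
  rewrite ler_wpM2r ?normc_ge0// -natrX ler_nat; case: (n) => // k.
  by rewrite leq_pmulr.
by rewrite -mulr_suml ler_wpM2r ?normc_ge0.
Qed.

(** The derivative is the termwise one; the second-order remainders add up with weights [n^2] to at
    most [S2 * |h|^2]. *)
Lemma power_series_differentiable (u : R[i]) : normc u < 1 -> cdifferentiable G u.
Proof.
move=> u1; have u1' := ltW u1.
have [l ll] : exists l, clim (fun N => \sum_(0 <= n < N) b n * (n%:R * u ^+ n.-1)) l.
  apply: (@clim_series _ S2) => N; apply: le_trans (bS2 N).
  apply: ler_sum => n _; rewrite !normcM normcX mulrC ler_wpM2r ?normc_ge0//.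
  have -> : (n%:R : R[i]) = (n%:R : R)%:C by rewrite rmorph_nat.
  rewrite normc_real ger0_norm//.
  apply: (@le_trans _ _ (n%:R * 1)).
    by rewrite ler_wpM2l// exprn_ile1 ?normc_ge0.
  by rewrite mulr1 -natrX ler_nat; case: (n) => // k; rewrite leq_pmulr.
have S20 : 0 <= S2 by apply: le_trans (bS2 0); rewrite big_geq.
exists l => e e0.
have S21 : 0 < S2 + 1 by rewrite ltr_wpDl.
(* The first bound keeps [u + h] in the closed disc, the second makes [S2 * |h|^2] at most
   [e * |h|]. *)
exists (Num.min (1 - normc u) (e / (S2 + 1))).
  by rewrite lt_min subr_gt0 u1 divr_gt0.
move=> h; rewrite lt_min => /andP[h1 h2].
have uh1 : normc (u + h) <= 1.
  by rewrite (le_trans (normc_triangle _ _))//; lra.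
apply: (@le_trans _ _ (S2 * normc h ^+ 2)); last first.
  rewrite expr2 mulrA ler_wpM2r ?normc_ge0//.
  move: h2; rewrite ltr_pdivlMr// => h2; have := normc_ge0 h; lra.
have lim := climB (climB (GP uh1) (GP u1')) (climZ h ll).
rewrite mulrC; apply: (clim_le lim) => N.
rewrite /psum mulr_sumr -!sumrB; apply: le_trans (normc_sum _ _) _.
apply: (@le_trans _ _ (\sum_(0 <= n < N) n%:R ^+ 2 * normc (b n) * normc h ^+ 2)).
  apply: ler_sum => n _.
  have -> : b n * (u + h) ^+ n - b n * u ^+ n - h * (b n * (n%:R * u ^+ n.-1)) =
    b n * ((u + h) ^+ n - u ^+ n - n%:R * u ^+ n.-1 * (u + h - u)) by ring.
  have -> : n%:R ^+ 2 * normc (b n) * normc h ^+ 2 =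
    normc (b n) * (n%:R ^+ 2 * normc h ^+ 2) by ring.
  rewrite normcM; apply: ler_wpM2l; first exact: normc_ge0.
  by have := expr_taylor_le n u1' uh1; rewrite (_ : u + h - u = h)//; ring.
by rewrite -mulr_suml ler_wpM2r ?sqr_ge0.
Qed.

End power_series.
End complex_limits.

(** * Sums cut at the scale of the parameter *)

Section geometric_sums.
Variable R : realType.

(** By telescoping: the coefficients of [T] solve [T n - T n.+1 = n^2 * q^n]. *)
Lemma sum_sqr_expr_le (q : R) : 0 < q -> q < 1 ->
  exists S, forall N, \sum_(0 <= n < N) n%:R ^+ 2 * q ^+ n <= S.
Proof.
move=> q0 q1; have q10 : 0 < 1 - q by rewrite subr_gt0.
pose al := (1 - q)^-1; pose be := 2 * al * q / (1 - q).
pose de := q * (al + be) / (1 - q).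
have al0 : 0 <= al by rewrite invr_ge0 ltW.
have be0 : 0 <= be by apply: divr_ge0; [rewrite !mulr_ge0// ltW|exact: ltW].
have de0 : 0 <= de by apply: divr_ge0; [rewrite mulr_ge0 ?addr_ge0// ltW|exact: ltW].
pose T (n : nat) := q ^+ n * (al * n%:R ^+ 2 + be * n%:R + de).
exists (T 0%N) => N.
suff : \sum_(0 <= n < N) n%:R ^+ 2 * q ^+ n + T N <= T 0%N.
  apply: le_trans; rewrite lerDl mulr_ge0 ?exprn_ge0 ?(ltW q0)//.
  by rewrite !addr_ge0// mulr_ge0// sqr_ge0.
elim: N => [|N IH]; first by rewrite big_geq// add0r.
rewrite big_nat_recr//=; apply: le_trans IH.
rewrite -addrA lerD2l le_eqVlt; apply/orP; left; apply/eqP.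
rewrite /T /de /be /al (exprS q N) -natr1; field.
by rewrite gt_eqF.
Qed.

(** The sum is cut at the index given by [exists_order] for base [A] and scale [E]. Its two
    conclusions bound exactly the growing sum of [(Q / A)^n] before the cut and the decaying sum of
    [Q^n / E] after it. *)
Lemma sum_scale_le (A Q E : R) (N : nat) : 0 < A -> A < Q -> Q < 1 -> 0 < E ->
  \sum_(0 <= n < N) Q ^+ n / (E + A ^+ n) <=
  ((Q - A)^-1 + (1 - Q)^-1) * (E `^ (ln Q / ln A) / E).
Proof.
move=> A0 AQ Q1 E0; have Q0 : 0 < Q := lt_trans A0 AQ.
have QA : 0 < Q - A by rewrite subr_gt0.
have Q10 : 0 < 1 - Q by rewrite subr_gt0.
have [N0 [h1 h2]] := exists_order A0 AQ Q1 E0.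
set X := E `^ _ in h1 h2 *.
pose f n := Q ^+ n / (E + A ^+ n).
have An n : 0 < A ^+ n by rewrite exprn_gt0.
have EA n : 0 < E + A ^+ n by rewrite addr_gt0.
have f0 n : 0 <= f n by rewrite divr_ge0 ?exprn_ge0 ?(ltW Q0)// ltW.
have f1 n : f n <= (Q / A) ^+ n.
  rewrite expr_div_n ler_pM2l ?exprn_gt0// lef_pV2 ?posrE// lerDr ltW//.
have f2 n : f n <= Q ^+ n / E.
  by rewrite ler_pM2l ?exprn_gt0// lef_pV2 ?posrE// lerDl ltW.
have s1 n : \sum_(0 <= k < n) f k <= ((Q / A) ^+ n - 1) / (Q / A - 1).
  have QA1 : 0 < Q / A - 1 by rewrite subr_gt0 ltr_pdivlMr// mul1r.
  elim: n => [|n IH]; first by rewrite big_geq// expr0 subrr mul0r.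
  rewrite big_nat_recr//=; apply: le_trans (lerD IH (f1 n)) _.
  rewrite le_eqVlt; apply/orP; left; apply/eqP; rewrite exprS.
  by move: (Q / A) QA1 => x x1; field; rewrite gt_eqF.
have s2 k : \sum_(N0 <= n < N0 + k) f n <= Q ^+ N0 / E / (1 - Q).
  suff : \sum_(N0 <= n < N0 + k) f n + Q ^+ (N0 + k) / E / (1 - Q) <= Q ^+ N0 / E / (1 - Q).
    apply: le_trans; rewrite lerDl.
    by rewrite !divr_ge0 ?exprn_ge0 ?(ltW Q0) ?(ltW Q10) ?(ltW E0).
  elim: k => [|k IH]; first by rewrite addn0 big_geq// add0r.
  rewrite addnS big_nat_recr ?leq_addr//=; apply: le_trans IH.
  rewrite -addrA lerD2l; apply: le_trans (lerD (f2 _) (lexx _)) _.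
  rewrite le_eqVlt; apply/orP; left; apply/eqP; rewrite exprS; field.
  by rewrite !gt_eqF.
have le1 : \sum_(0 <= n < N) f n <= \sum_(0 <= n < N0 + N) f n.
  rewrite (@big_cat_nat _ _ _ N 0 (N0 + N))//= ?leq_addl// lerDl.
  by apply: sumr_ge0 => n _.
apply: (le_trans le1); rewrite (@big_cat_nat _ _ _ N0 0 (N0 + N))//= ?leq_addr//.
apply: le_trans (lerD (s1 N0) (s2 N)) _; rewrite [leRHS]mulrDl; apply: lerD.
  have -> : ((Q / A) ^+ N0 - 1) / (Q / A - 1) =
    (Q - A)^-1 * (((Q / A) ^+ N0 - 1) * E * A / E).
    move: ((Q / A) ^+ N0) => x; field.
    by rewrite (gt_eqF A0) (gt_eqF E0) (gt_eqF QA).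
  rewrite ler_pM2l ?invr_gt0// ler_pM2r ?invr_gt0//.
  by move: h2; rewrite ler_pdivlMr.
rewrite mulrC ler_pM2l ?invr_gt0// ler_pM2r ?invr_gt0//.
Qed.

End geometric_sums.

(** * The extremal series in the disc *)

Section extremal.
Variables (R : realType) (r : R) (z : R[i]).
Hypotheses (r0 : 0 < r) (r1 : r < 1) (z0P : 0 < complex.Im z)
  (rz : r < normc (z - 'i%C)).
Local Notation s := (Num.sqrt (1 - r ^+ 2)).
Local Notation a := (rho r).
Local Notation v := (mobius r z).
Local Notation q := (normc v).

Let a0 : 0 < a := rho_gt0 r0 r1.
Let a1 : a < 1 := rho_lt1 r0 r1.
Let aq : a < q := mobius_outside r0 r1 z0P rz.
Let q1 : q < 1 := mobius_normc_lt1 r0 r1 z0P.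
Let q0 : 0 < q := lt_trans a0 aq.
Let s0 : 0 < s := height_gt0 r0 r1.

Let gammaE : gamma r z = ln q / ln a. Proof. by []. Qed.

(** The value 0 at [n = 0] lets the series, which starts at 1, be handled as a power series starting
    at 0. *)
Definition extremal_coef (e : R) (n : nat) : R[i] :=
  if n == 0%N then 0 else v^*%C ^+ n / (e ^+ 2 + a ^+ (2 * n))%:C.

(** The limit in [M_fun] with a free variable in place of [m w], so that [M_funE] holds by
    conversion. *)
Definition extremal_series (e : R) (u : R[i]) : R[i] :=
  lim ((fun N => \sum_(1 <= n < N.+1)
    ((v^*%C * u) ^+ n / (e ^+ 2 + a ^+ (2 * n))%:C) : R[i]^o) @ \oo).

Section fixed_eps.
Variable e : R.
Hypothesis e0 : 0 < e.
Local Notation b := (extremal_coef e).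
Local Notation G := (extremal_series e).

Let den_gt0 n : 0 < e ^+ 2 + a ^+ (2 * n).
Proof. by rewrite addr_gt0// exprn_gt0. Qed.

Let coef_le n : normc (b n) <= q ^+ n / (e ^+ 2 + (a ^+ 2) ^+ n).
Proof.
rewrite -exprM /extremal_coef; case: eqP => _.
  by rewrite ComplexField.Normc.normc0 divr_ge0 ?exprn_ge0 ?normc_ge0// ltW.
by rewrite normcf_div normcX normc_conj normc_real ger0_norm// ltW.
Qed.

Let E0 : 0 < e ^+ 2. Proof. by rewrite exprn_gt0. Qed.
Let A0 : 0 < a ^+ 2. Proof. by rewrite exprn_gt0. Qed.
Let AQ1 : a ^+ 2 < q.
Proof. by apply: lt_trans aq; rewrite expr2 gtr_pMl. Qed.

Let bS0 N : \sum_(0 <= n < N) normc (b n) <=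
  ((q - a ^+ 2)^-1 + (1 - q)^-1) * ((e ^+ 2) `^ (ln q / ln (a ^+ 2)) / e ^+ 2).
Proof.
apply: le_trans (sum_scale_le N A0 AQ1 q1 E0).
by apply: ler_sum => n _; exact: coef_le.
Qed.

(** The coefficients are bounded crudely by [q^n / e^2]. The dependence on [e] is harmless, as this
    only yields regularity for fixed [e]. *)
Let bS2 : exists S2, forall N, \sum_(0 <= n < N) n%:R ^+ 2 * normc (b n) <= S2.
Proof.
have [S HS] := sum_sqr_expr_le q0 q1; exists (S / e ^+ 2) => N.
rewrite ler_pdivlMr// mulr_suml; apply: le_trans (HS N).
apply: ler_sum => n _; rewrite -mulrA ler_wpM2l ?sqr_ge0//.
rewrite -ler_pdivlMr//; apply: le_trans (coef_le n) _.
have d0 : 0 < e ^+ 2 + (a ^+ 2) ^+ n by rewrite addr_gt0// exprn_gt0.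
by rewrite ler_pM2l ?exprn_gt0// lef_pV2 ?posrE// lerDl exprn_ge0 ?sqr_ge0.
Qed.

Let partial_sumE (u : R[i]) N :
  \sum_(1 <= n < N.+1) ((v^*%C * u) ^+ n / (e ^+ 2 + a ^+ (2 * n))%:C) =
  \sum_(0 <= n < N.+1) b n * u ^+ n.
Proof.
rewrite [RHS]big_ltn// {1}/extremal_coef eqxx mul0r add0r.
apply: eq_big_nat => n /andP[n0 _].
by rewrite /extremal_coef gtn_eqF// exprMn mulrAC.
Qed.

Lemma extremal_partial_sum_clim (u : R[i]) : normc u <= 1 ->
  exists l, clim (fun N => \sum_(1 <= n < N.+1)
    ((v^*%C * u) ^+ n / (e ^+ 2 + a ^+ (2 * n))%:C)) l.
Proof.
move=> u1; have [l ll] := power_series_cvg bS0 u1; exists l => d /ll[N0 P0].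
by exists N0 => N N0N; rewrite partial_sumE; apply/P0/leqW.
Qed.

Lemma extremal_series_clim (u : R[i]) : normc u <= 1 ->
  clim (fun N => \sum_(0 <= n < N) b n * u ^+ n) (G u).
Proof.
move=> u1; have [l ll] := power_series_cvg bS0 u1.
suff -> : G u = l by [].
apply: clim_lim => d /ll[N0 P0].
by exists N0 => N N0N; rewrite partial_sumE; apply/P0/leqW.
Qed.

Let ln_a : ln a < 0. Proof. by rewrite ln_lt0// a0. Qed.

Let ln_a2 : ln (a ^+ 2) = 2 * ln a.
Proof. by rewrite lnXn// mulr_natl. Qed.

Let powR_sqr (x : R) : (e ^+ 2) `^ x = e `^ (2 * x).
Proof. by rewrite -powR_mulrn ?(ltW e0)// -powRrM. Qed.

(** With base [rho^2] and scale [e^2] the exponent is [ln q / ln (rho^2) = gamma / 2], and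
    [(e^2)^(gamma / 2) = e^gamma]. *)
Lemma extremal_series_le (u : R[i]) : normc u <= 1 ->
  normc (G u) <= ((q - a ^+ 2)^-1 + (1 - q)^-1) * (e `^ gamma r z / e ^+ 2).
Proof.
move=> u1; apply: (power_series_le extremal_series_clim) => // N.
have -> : e `^ gamma r z = (e ^+ 2) `^ (ln q / ln (a ^+ 2)).
  by rewrite powR_sqr ln_a2 gammaE; congr (_ `^ _); field; rewrite lt_eqF.
apply: le_trans (bS0 N); apply: ler_sum => n _.
by rewrite ler_piMr ?normc_ge0// exprn_ile1 ?normc_ge0.
Qed.

(** The extra factor [rho^n] changes the ratio to [q * rho], whose exponent is [(gamma + 1) / 2]: a
    gain of one factor [e]. *)
Lemma extremal_series_circle_le (u : R[i]) : normc u = a ->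
  normc (G u) <=
  ((q * a - a ^+ 2)^-1 + (1 - q * a)^-1) * (e `^ gamma r z * e / e ^+ 2).
Proof.
move=> ua; apply: (power_series_le extremal_series_clim) => [|N].
  by rewrite ua ltW.
have qa0 : 0 < q * a by rewrite mulr_gt0.
have h1 : a ^+ 2 < q * a by rewrite expr2 ltr_pM2r.
have h2 : q * a < 1.
  by apply: lt_trans a1; rewrite gtr_pMl.
have -> : e `^ gamma r z * e = (e ^+ 2) `^ (ln (q * a) / ln (a ^+ 2)).
  rewrite -[X in _ * X](powRr1 (ltW e0)) -powRD; last by rewrite (gt_eqF e0) implybT.
  have lnqa : ln (q * a) = ln q + ln a by rewrite lnM ?posrE.
  rewrite powR_sqr ln_a2 gammaE lnqa; congr (_ `^ _).
  by field; rewrite lt_eqF.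
apply: le_trans (sum_scale_le N A0 h1 h2 E0); apply: ler_sum => n _.
have -> : (q * a) ^+ n / (e ^+ 2 + (a ^+ 2) ^+ n) =
  q ^+ n / (e ^+ 2 + (a ^+ 2) ^+ n) * a ^+ n by rewrite (exprMn n q a) mulrAC.
by rewrite ua ler_wpM2r ?coef_le// exprn_ge0// ltW.
Qed.

(** Here the ratio is [q^2], with exponent [gamma]. *)
Lemma extremal_series_point_le :
  normc (G v) <=
  ((q ^+ 2 - a ^+ 2)^-1 + (1 - q ^+ 2)^-1) * (e `^ gamma r z * e `^ gamma r z / e ^+ 2).
Proof.
apply: (power_series_le extremal_series_clim) => [|N]; first exact: ltW.
have qq : 0 < q ^+ 2 by rewrite exprn_gt0.
have h1 : a ^+ 2 < q ^+ 2 by rewrite ltr_sqr ?nnegrE ?normc_ge0// ltW.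
have h2 : q ^+ 2 < 1 by rewrite expr_lt1 ?normc_ge0.
have -> : e `^ gamma r z * e `^ gamma r z = (e ^+ 2) `^ (ln (q ^+ 2) / ln (a ^+ 2)).
  rewrite -powRD; last by rewrite (gt_eqF e0) implybT.
  rewrite powR_sqr ln_a2 gammaE lnXn// -mulr_natl; congr (_ `^ _).
  by field; rewrite lt_eqF.
apply: le_trans (sum_scale_le N A0 h1 h2 E0); apply: ler_sum => n _.
by rewrite expr2 exprMn mulrAC ler_wpM2r ?exprn_ge0 ?coef_le ?normc_ge0.
Qed.

(** At [u = v] all terms are nonnegative reals, so one of them suffices: the one whose index [N0]
    puts [rho^N0] between [rho * e] and [e]. Then [q^N0 >= (rho * e)^gamma = q * e^gamma], and the
    denominator is at most [2 * e^2]. That [N0 > 0] matters, the term of index 0 being 0. *)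
Lemma extremal_series_point_ge : e < 1 ->
  q ^+ 2 / 2 * (e `^ gamma r z * e `^ gamma r z / e ^+ 2) <= normc (G v).
Proof.
move=> e1; have [N0 [N00 aN eN]] := exists_scale a0 aq q1 e0 e1.
have term n : b n * v ^+ n =
    (if n == 0%N then 0 else q ^+ (2 * n) / (e ^+ 2 + a ^+ (2 * n)))%:C.
  rewrite /extremal_coef; case: eqP => _; first by rewrite mul0r.
  rewrite mulrAC -exprMn [v^*%C * v]mulrC -sqr_normc_conj -rmorphXn -exprM.
  by rewrite [RHS]rmorphM fmorphV.
have tge0 n : 0 <= (if n == 0%N then 0 else q ^+ (2 * n) / (e ^+ 2 + a ^+ (2 * n)) : R).
  by case: eqP => // _; rewrite divr_ge0 ?exprn_ge0 ?normc_ge0// ltW.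
apply: le_trans (normc_Re _); apply: le_trans (ler_norm _).
apply: (clim_Re_ge (extremal_series_clim (ltW q1))); exists N0.+1 => N N0N.
under eq_bigr do rewrite term.
rewrite Re_sum /= (@big_cat_nat _ _ _ N0.+1)//= big_nat_recr//=.
apply: (@le_trans _ _ (q ^+ (2 * N0) / (e ^+ 2 + a ^+ (2 * N0)))); last first.
  rewrite gtn_eqF// addrAC lerDr addr_ge0//; apply: sumr_ge0 => n _; exact: tge0.
have qN : q * e `^ gamma r z <= q ^+ N0.
  have -> : q * e `^ gamma r z = (a * e) `^ gamma r z.
    by rewrite powRM ?(ltW a0) ?(ltW e0)// gammaE powR_exponent.
  rewrite gammaE -(powR_exponentX a0 aq q1); apply: ge0_ler_powR.
  - exact: ltW (exponent_gt0 a0 aq q1).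
  - by rewrite nnegrE mulr_ge0// ltW.
  - by rewrite nnegrE exprn_ge0// ltW.
  - exact: ltW.
have -> : q ^+ 2 / 2 * (e `^ gamma r z * e `^ gamma r z / e ^+ 2) =
  (q * e `^ gamma r z) ^+ 2 / (2 * e ^+ 2) by field; rewrite gt_eqF.
rewrite mulnC exprM; apply: ler_pM.
- exact: sqr_ge0.
- by rewrite invr_ge0 mulr_ge0// sqr_ge0.
- by rewrite ler_sqr ?nnegrE ?exprn_ge0 ?normc_ge0// mulr_ge0 ?normc_ge0 ?powR_ge0.
have d2 : 0 < 2 * e ^+ 2 by rewrite mulr_gt0.
have aN2 : a ^+ (N0 * 2) <= e ^+ 2.
  by rewrite exprM ler_sqr ?nnegrE ?exprn_ge0// ltW.
have d1 : 0 < e ^+ 2 + a ^+ (N0 * 2) by rewrite addr_gt0 ?exprn_gt0.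
by rewrite lef_pV2 ?posrE//; lra.
Qed.

Lemma extremal_series_lipschitz : exists2 S2, 0 <= S2 & forall u w,
  normc u <= 1 -> normc w <= 1 -> normc (G u - G w) <= S2 * normc (u - w).
Proof.
have [S2 HS] := bS2; exists S2 => [|u w u1 w1].
  by apply: le_trans (HS 0%N); rewrite big_geq.
exact: (power_series_lipschitz HS extremal_series_clim u1 w1).
Qed.

Lemma extremal_series_differentiable (u : R[i]) : normc u < 1 -> cdifferentiable G u.
Proof.
have [S2 HS] := bS2 => u1.
exact: (power_series_differentiable HS extremal_series_clim u1).
Qed.

End fixed_eps.
End extremal.

(** * The extremal function in the half-plane *)

Section extremal_function.
Variables (R : realType) (r : R) (z : R[i]).
Hypotheses (r0 : 0 < r) (r1 : r < 1) (z0P : 0 < complex.Im z)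
  (rz : r < normc (z - 'i%C)).
Notation mu := (@lebesgue_measure R).
Local Notation s := (Num.sqrt (1 - r ^+ 2)).
Local Notation a := (rho r).
Local Notation v := (mobius r z).
Local Notation q := (normc v).
Local Notation M := (M_fun r z).

Let a0 : 0 < a := rho_gt0 r0 r1.
Let a1 : a < 1 := rho_lt1 r0 r1.
Let aq : a < q := mobius_outside r0 r1 z0P rz.
Let q1 : q < 1 := mobius_normc_lt1 r0 r1 z0P.
Let q0 : 0 < q := lt_trans a0 aq.
Let s0 : 0 < s := height_gt0 r0 r1.

Let K1 := (q - a ^+ 2)^-1 + (1 - q)^-1.
Let K2 := (q * a - a ^+ 2)^-1 + (1 - q * a)^-1.
Let K3 := (q ^+ 2 - a ^+ 2)^-1 + (1 - q ^+ 2)^-1.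

Let K1_gt0 : 0 < K1.
Proof.
apply: addr_gt0; rewrite invr_gt0 subr_gt0//.
by apply: lt_trans aq; rewrite expr2 gtr_pMl.
Qed.

Let K2_gt0 : 0 < K2.
Proof.
apply: addr_gt0; rewrite invr_gt0 subr_gt0; first by rewrite expr2 ltr_pM2r.
by apply: lt_trans a1; rewrite gtr_pMl.
Qed.

Let K3_gt0 : 0 < K3.
Proof.
apply: addr_gt0; rewrite invr_gt0 subr_gt0.
  by rewrite ltr_sqr ?nnegrE ?normc_ge0// ltW.
by rewrite expr_lt1 ?normc_ge0.
Qed.

Lemma add_z0_ge (w : R[i]) : 0 <= complex.Im w -> s <= normc (w + z0 r).
Proof.
move=> w0; rewrite -ler_sqr ?nnegrE ?normc_ge0 ?(ltW s0)// normc_add_z0.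
have := sqr_ge0 (complex.Re w); have := mulr_ge0 w0 (ltW s0).
have := sqr_ge0 (complex.Im w); lra.
Qed.

Section fixed_eps.
Variable e : R.
Hypothesis e0 : 0 < e.
Local Notation G := (extremal_series r z e).

Lemma M_fun_cvg (w : R[i]) : 0 <= complex.Im w -> cvgn (M_partial_sum r z e w).
Proof.
move=> w0; have [l /clim_cvg ll] :=
  extremal_partial_sum_clim r0 r1 z0P rz e0 (mobius_normc_le1 r0 r1 w0).
by apply/cvg_ex; exists l.
Qed.

Lemma M_funE (w : R[i]) :
  M e w = (e `^ (2 - gamma r z))%:C / (w + z0 r) * G (mobius r w).
Proof. by []. Qed.

Let c := e `^ (2 - gamma r z).

Let c0 : 0 < c. Proof. exact: powR_gt0. Qed.

(** The power of [e] in front of the series is the inverse of the growth found in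
    [extremal_series_le]. *)
Let cE : c * (e `^ gamma r z / e ^+ 2) = 1.
Proof.
rewrite mulrA -powRD; last by rewrite (gt_eqF e0) implybT.
by rewrite subrK powR_mulrn ?mulfV ?(ltW e0)// expf_neq0// gt_eqF.
Qed.

Lemma normc_M_fun (w : R[i]) :
  normc (M e w) = c * normc (G (mobius r w)) / normc (w + z0 r).
Proof.
by rewrite M_funE normcM normcf_div normc_real (ger0_norm (ltW c0)) mulrAC.
Qed.

Lemma M_fun_le (w : R[i]) : 0 <= complex.Im w -> normc (M e w) <= K1 / normc (w + z0 r).
Proof.
move=> w0; rewrite normc_M_fun ler_wpM2r ?invr_ge0 ?normc_ge0//.
have h := extremal_series_le r0 r1 z0P rz e0 (mobius_normc_le1 r0 r1 w0).
apply: le_trans (ler_wpM2l (ltW c0) h) _.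
by rewrite mulrCA cE mulr1.
Qed.

Lemma M_fun_circle_le (w : R[i]) : 0 <= complex.Im w -> normc (w - 'i%C) = r ->
  normc (M e w) <= K2 / s * e.
Proof.
move=> w0 wr; rewrite normc_M_fun.
have h := extremal_series_circle_le r0 r1 z0P rz e0 (mobius_circle r0 r1 w0 wr).
have sw := add_z0_ge w0.
have nw : 0 < normc (w + z0 r) by exact: lt_le_trans sw.
rewrite ler_pdivrMr//; apply: le_trans (ler_wpM2l (ltW c0) h) _.
rewrite mulrCA -/K2.
have -> : c * (e `^ gamma r z * e / e ^+ 2) = c * (e `^ gamma r z / e ^+ 2) * e by ring.
rewrite cE mul1r -[leLHS]mulr1.
have -> : K2 / s * e * normc (w + z0 r) = K2 * e * (normc (w + z0 r) / s) by ring.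
apply: ler_wpM2l; first by rewrite mulr_ge0// ltW.
by rewrite ler_pdivlMr// mul1r.
Qed.

Lemma M_fun_point_le : normc (M e z) <= K3 / normc (z + z0 r) * e `^ gamma r z.
Proof.
have h := extremal_series_point_le r0 r1 z0P rz e0.
rewrite normc_M_fun [leRHS]mulrAC ler_wpM2r ?invr_ge0 ?normc_ge0//.
apply: le_trans (ler_wpM2l (ltW c0) h) _; rewrite mulrCA -/K3.
have -> : c * (e `^ gamma r z * e `^ gamma r z / e ^+ 2) =
  c * (e `^ gamma r z / e ^+ 2) * e `^ gamma r z by ring.
by rewrite cE mul1r.
Qed.

Lemma M_fun_point_ge : e < 1 ->
  q ^+ 2 / 2 / normc (z + z0 r) * e `^ gamma r z <= normc (M e z).
Proof.
move=> e1; have h := extremal_series_point_ge r0 r1 z0P rz e0 e1.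
rewrite normc_M_fun [leLHS]mulrAC ler_wpM2r ?invr_ge0 ?normc_ge0//.
apply: le_trans (ler_wpM2l (ltW c0) h); rewrite mulrCA.
have -> : c * (e `^ gamma r z * e `^ gamma r z / e ^+ 2) =
  c * (e `^ gamma r z / e ^+ 2) * e `^ gamma r z by ring.
by rewrite cE mul1r.
Qed.

Lemma cdifferentiable_M_fun (w : R[i]) : 0 < complex.Im w -> cdifferentiable (M e) w.
Proof.
move=> w0; have d0 := add_z0_neq0 r0 r1 (ltW w0).
have dz : cdifferentiable (fun w => w + z0 r) w.
  exact: cdifferentiableD (cdifferentiable_id _) (cdifferentiable_cst _ _).
have dV := @cdifferentiableV R (fun w => w + z0 r) w d0 dz.
apply: (cdifferentiableM (f := fun w => c%:C / (w + z0 r))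
  (g := fun w => G (mobius r w))).
  exact: cdifferentiableM (cdifferentiable_cst _ _) dV.
apply: (cdifferentiable_comp (f := mobius r) (g := G)).
  apply: cdifferentiableM dV.
  exact: cdifferentiableB (cdifferentiable_id _) (cdifferentiable_cst _ _).
exact: (extremal_series_differentiable r0 r1 z0P rz e0 (mobius_normc_lt1 r0 r1 w0)).
Qed.

Lemma mobius_sub (w w' : R[i]) : w + z0 r != 0 -> w' + z0 r != 0 ->
  mobius r w - mobius r w' = 2 * z0 r * (w - w') / ((w + z0 r) * (w' + z0 r)).
Proof. by move=> d d'; rewrite /mobius; field; rewrite d d'. Qed.

Lemma normc_z0 : normc (z0 r) = s.
Proof. by rewrite /z0 normcM normc_i mul1r normc_real gtr0_norm. Qed.

(** The weight [1 / |w' + z0|] is retained because an unweighted Lipschitz bound would not be square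
    integrable along the line. [L] may depend on [e]. *)
Lemma M_fun_lipschitz : exists2 L, 0 <= L & forall w w',
  0 <= complex.Im w -> 0 <= complex.Im w' ->
  normc (M e w - M e w') <= L * normc (w - w') / normc (w' + z0 r).
Proof.
have [S2 S20 HS] := extremal_series_lipschitz r0 r1 z0P rz e0.
pose S := K1 * (e `^ gamma r z / e ^+ 2).
have S0 : 0 <= S by rewrite mulr_ge0 ?divr_ge0 ?sqr_ge0 ?powR_ge0// ltW.
exists (c * (2 * S2 + S) / s).
  apply: divr_ge0; last exact: ltW.
  by apply: mulr_ge0; [exact: ltW|rewrite addr_ge0// mulr_ge0].
move=> w w' w0 w'0.
have d := add_z0_neq0 r0 r1 w0; have d' := add_z0_neq0 r0 r1 w'0.
have m1 := mobius_normc_le1 r0 r1 w0; have m1' := mobius_normc_le1 r0 r1 w'0.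
have sw := add_z0_ge w0; have sw' := add_z0_ge w'0.
have nd : 0 < normc (w + z0 r) by rewrite normc_gt0.
have nd' : 0 < normc (w' + z0 r) by rewrite normc_gt0.
have GS := extremal_series_le r0 r1 z0P rz e0 m1; rewrite -/K1 -/S in GS.
have Glip := HS _ _ m1 m1'.
(* The prefactor of [w'] is taken out, so that the change of prefactor appears as a multiple of
   [G (mobius r w)]. *)
have -> : M e w - M e w' = c%:C / (w' + z0 r) *
  ((G (mobius r w) - G (mobius r w')) + G (mobius r w) * (- (w - w') / (w + z0 r))).
  have -> : w - w' = (w + z0 r) - (w' + z0 r) by ring.
  rewrite !M_funE -/c; move: (G _) (G _) (w + z0 r) (w' + z0 r) d d' => g g' t t' d d'.
  by field; rewrite d d'.
rewrite normcM normcf_div normc_real (ger0_norm (ltW c0)).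
have -> : c * (2 * S2 + S) / s * normc (w - w') / normc (w' + z0 r) =
  c / normc (w' + z0 r) * ((2 * S2 + S) / s * normc (w - w')) by ring.
apply: ler_wpM2l; first by rewrite divr_ge0 ?normc_ge0// ltW.
apply: le_trans (normc_triangle _ _) _; rewrite mulrDl mulrDl; apply: lerD.
  apply: (le_trans Glip); rewrite mobius_sub// normcf_div (normcM _ (w - w')) (normcM 2) normc_z0
    (normcM (w + z0 r)).
  have -> : normc (2 : R[i]) = 2.
    by rewrite -(rmorph_nat (real_complex R)) normc_real ger0_norm.
  have -> : 2 * S2 / s * normc (w - w') = S2 * (2 * s * normc (w - w') / (s * s)).
    by field; rewrite gt_eqF.
  apply: ler_wpM2l => //; apply: ler_wpM2l.
    by rewrite !mulr_ge0 ?normc_ge0// ltW.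
  rewrite lef_pV2 ?posrE ?mulr_gt0//.
  by apply: ler_pM; rewrite ?(ltW s0).
rewrite normcM normcf_div normc_opp -mulrA; apply: ler_pM.
- exact: normc_ge0.
- by rewrite divr_ge0 ?normc_ge0.
- exact: GS.
by rewrite mulrC ler_wpM2r ?normc_ge0// lef_pV2 ?posrE.
Qed.

End fixed_eps.

(** As [s <= 1], the integrand is at most [1 / (s^2 * (1 + x^2))], which leads to the arctangent
    integral without rescaling; the exact value is [pi / s]. *)
Lemma integral_poisson_le :
  (\int[mu]_x ((x ^+ 2 + s ^+ 2)^-1)%:E <= (pi / s ^+ 2)%:E)%E.
Proof.
have s20 : 0 < s ^+ 2 by rewrite exprn_gt0.
have s21 : s ^+ 2 <= 1 by rewrite expr_le1 ?(ltW s0)// ltW// height_lt1.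
have den (x : R) : 0 < x ^+ 2 + s ^+ 2 by rewrite ltr_wpDl ?sqr_ge0.
have den1 (x : R) : 0 < oneDsqr x by rewrite (lt_le_trans ltr01)// oneDsqr_ge1.
have m1 : measurable_fun [set: measurableTypeR R] (fun x : R => (oneDsqr x)^-1).
  exact: continuous_measurable_fun (@continuous_oneDsqrV R).
have cx : continuous (fun x : R => x ^+ 2 + s ^+ 2).
  by move=> x; apply: cvgD; [exact: exprn_continuous|exact: cvg_cst].
have m2 : measurable_fun [set: measurableTypeR R] (fun x : R => (x ^+ 2 + s ^+ 2)^-1).
  apply: continuous_measurable_fun => x.
  by apply: cvgV; [rewrite gt_eqF|exact: cx].
apply: (@le_trans _ _ (\int[mu]_x ((s ^- 2)%:E * ((oneDsqr x)^-1)%:E))%E).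
  apply: ge0_le_integral => //.
  - by move=> x _; rewrite lee_fin invr_ge0 ltW.
  - exact/measurable_EFinP.
  - by apply: measurable_funeM; exact/measurable_EFinP.
  - move=> x _; rewrite -EFinM lee_fin -invfM lef_pV2 ?posrE ?mulr_gt0//.
    by rewrite /oneDsqr mulrDr mulr1 addrC lerD2r ler_piMl ?sqr_ge0.
rewrite ge0_integralZl//; last exact/measurable_EFinP.
rewrite ge0_symfun_integralT.
- rewrite -set_itvcy integral0y_oneDsqr -!EFinM lee_fin.
  by rewrite le_eqVlt; apply/orP; left; apply/eqP; field; rewrite gt_eqF.
- by move=> x; rewrite invr_ge0 ltW.
- exact: continuous_oneDsqrV.
- by move=> x; rewrite /= /oneDsqr sqrrN.
Qed.

(** The common tool for the horizontal traces, the boundary values and their difference, each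
    dominated by a multiple of the square integrable [1 / |x + z0|]. The inequality [J <= (J + 1)^2]
    avoids a square root in the constant. *)
Lemma L2norm_line_dominated (g : R -> R[i]) (k : R) : 0 <= k ->
  measurable_fun [set: measurableTypeR R] (fun x => complex.Re (g x)) ->
  measurable_fun [set: measurableTypeR R] (fun x => complex.Im (g x)) ->
  (forall x, normc (g x) <= k / normc (x%:C + z0 r)) ->
  (L2norm_line g <= (k * (pi / s ^+ 2 + 1))%:E)%E.
Proof.
move=> k0 mr mi gk.
pose J := pi / s ^+ 2; have s20 : 0 < s ^+ 2 by rewrite exprn_gt0.
have J0 : 0 <= J by rewrite divr_ge0 ?pi_ge0 ?(ltW s20).
have den (x : R) : 0 < x ^+ 2 + s ^+ 2 by rewrite ltr_wpDl ?sqr_ge0.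
have m2 : measurable_fun [set: measurableTypeR R] (fun x : R => (x ^+ 2 + s ^+ 2)^-1).
  apply: continuous_measurable_fun => x; apply: cvgV; first by rewrite gt_eqF.
  by apply: cvgD; [exact: exprn_continuous|exact: cvg_cst].
rewrite -/J; apply/L2norm_line_le; first by rewrite mulr_ge0 ?addr_ge0.
apply: (@le_trans _ _ (\int[mu]_x ((k ^+ 2)%:E * ((x ^+ 2 + s ^+ 2)^-1)%:E))%E).
  apply: ge0_le_integral => //.
  - by move=> x _; rewrite lee_fin sqr_ge0.
  - by apply/measurable_EFinP; exact: measurable_normc_sqr.
  - by apply: measurable_funeM; exact/measurable_EFinP.
  - move=> x _; rewrite -EFinM lee_fin.
    have -> : k ^+ 2 / (x ^+ 2 + s ^+ 2) = (k / normc (x%:C + z0 r)) ^+ 2.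
      by rewrite expr_div_n normc_add_z0 /= add0r.
    by rewrite ler_sqr ?nnegrE ?normc_ge0 ?divr_ge0 ?normc_ge0.
rewrite ge0_integralZl//; last 3 first.
- exact/measurable_EFinP.
- by move=> x _; rewrite lee_fin invr_ge0 ltW.
- by rewrite lee_fin sqr_ge0.
apply: (@le_trans _ _ ((k ^+ 2)%:E * J%:E)%E).
  apply: lee_pmul => //; rewrite ?lee_fin ?sqr_ge0//; last exact: integral_poisson_le.
  by apply: integral_ge0 => x _; rewrite lee_fin invr_ge0 ltW.
rewrite -EFinM lee_fin exprMn; apply: ler_wpM2l; first exact: sqr_ge0.
by have := sqr_ge0 J; have := J0; lra.
Qed.

Section membership.
Variable e : R.
Hypothesis e0 : 0 < e.

Let J1 := pi / s ^+ 2 + 1.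

Let J10 : 0 < J1.
Proof. by rewrite ltr_wpDl// divr_ge0 ?pi_ge0// sqr_ge0. Qed.

(** Real points are mapped to the unit circle, where the series still converges, so the formula for
    [M] itself is the candidate boundary value. *)
Let boundary (x : R) := M e x%:C.

Let ccont_boundary (x : R) : ccont boundary x.
Proof.
have [L L0 HL] := M_fun_lipschitz e0.
apply/ccontP => d d0.
have L1 : 0 < L / s + 1 by rewrite ltr_wpDl// divr_ge0// ltW.
exists (d / (L / s + 1)); first by rewrite divr_gt0.
move=> y; rewrite ltr_pdivlMr// => yx.
have := HL y%:C x%:C (lexx _) (lexx _).
have -> : y%:C - x%:C = (y - x)%:C by rewrite rmorphB.
rewrite normc_real => /le_lt_trans; apply.
have nx := add_z0_ge (w := x%:C) (lexx _).
have nx0 : 0 < normc (x%:C + z0 r) := lt_le_trans s0 nx.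
apply: le_lt_trans yx; rewrite mulrDr mulr1.
apply: le_trans (_ : _ <= `|y - x| * (L / s)) _; last by rewrite lerDl.
rewrite [L * _]mulrC -mulrA; apply: ler_wpM2l => //; apply: ler_wpM2l => //.
by rewrite lef_pV2 ?posrE.
Qed.

Let normc_line_ge (x y : R) : 0 <= y ->
  normc (x%:C + z0 r) <= normc ((x +i* y) + z0 r).
Proof.
move=> y0; rewrite -ler_sqr ?nnegrE ?normc_ge0// !normc_add_z0 /= lerD2l.
rewrite ler_sqr ?nnegrE ?lerD2r ?addr_ge0 ?(ltW s0)//.
Qed.

Let line_ccont (y : R) : 0 < y -> forall x : R, ccont (fun x : R => M e (x +i* y)) x.
Proof.
by move=> y0; apply: ccont_line => // w w0; exact: cdifferentiable_M_fun.
Qed.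

Let trace_norm (y : R) : 0 < y ->
  (L2norm_line (fun x => M e (x +i* y)) <= (K1 * J1)%:E)%E.
Proof.
move=> y0; have [mr mi] := measurable_ccont (line_ccont y0).
apply: L2norm_line_dominated => //; first exact: ltW.
move=> x; apply: le_trans (M_fun_le e0 _) _; first exact: ltW.
apply: ler_wpM2l; first exact: ltW.
have nx := add_z0_ge (w := x%:C) (lexx _).
rewrite lef_pV2 ?posrE ?normc_line_ge ?(lt_le_trans s0 nx)//; first exact: ltW.
by rewrite (lt_le_trans s0)// add_z0_ge// ltW.
Qed.

Lemma hardy2_M_fun : hardy2 (M e).
Proof.
split; first by move=> w w0; apply/cdifferentiableP; exact: cdifferentiable_M_fun.
apply: (@le_lt_trans _ _ (K1 * J1)%:E); last by rewrite ltry.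
by apply: ge_ereal_sup => _ [y y0 <-]; exact: trace_norm.
Qed.

(** Between [x + i y] and [x] the weighted Lipschitz bound is [L * y / |x + z0|], whose L^2 norm is
    at most a multiple of [y]. *)
Let boundary_cvg : boundary_value (M e) boundary.
Proof.
have [mr mi] := measurable_ccont ccont_boundary.
have [L L0 HL] := M_fun_lipschitz e0.
split => //.
have bound y : 0 < y ->
    (L2norm_line (fun x => M e (x +i* y) - boundary x)%R <= (L * y * J1)%:E)%E.
  move=> y0; have [mfr mfi] := measurable_ccont (line_ccont y0).
  apply: L2norm_line_dominated.
  - by rewrite mulr_ge0// ltW.
  - exact: measurable_ReB.
  - exact: measurable_ImB.
  move=> x; apply: le_trans (HL (x +i* y) x%:C (ltW y0) (lexx 0)) _.
  have -> : (x +i* y) - x%:C = y%:C * 'i%C by apply: complex_ext => /=; ring.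
  by rewrite normcM normc_i mulr1 normc_real gtr0_norm.
move=> A nA.
have {}nA : nbhs (0 : R) (fun x : R => A x%:E) by exact: nA.
move/nbhs_ballP : nA => [d /= d0 dA].
have LJ : 0 < L * J1 + 1 by rewrite ltr_wpDl// mulr_ge0// ltW.
apply/nbhs_ballP; exists (d / (L * J1 + 1)) => /=; first by rewrite divr_gt0.
move=> y; rewrite /ball /= sub0r normrN => yd y0.
rewrite gtr0_norm// ltr_pdivlMr// in yd.
have := bound y y0; have : (0 <= L2norm_line (fun x => M e (x +i* y) - boundary x)%R)%E.
  exact: Lnorm_ge0.
case: (L2norm_line _) => [t| |]//; rewrite !lee_fin => t0 tL.
apply: dA; rewrite /ball /= sub0r normrN ger0_norm//; apply: le_lt_trans tL _.
by apply: le_lt_trans yd; lra.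
Qed.

(** The norm is an infimum, so the one boundary value exhibited above suffices. *)
Lemma hardy2_norm_M_fun : (hardy2_norm (M e) <= (K1 * J1)%:E)%E.
Proof.
apply: (@le_trans _ _ (L2norm_line boundary)).
  by apply: ereal_inf_lbound; exists boundary.
have [mr mi] := measurable_ccont ccont_boundary.
apply: L2norm_line_dominated => //; first exact: ltW.
by move=> x; exact: (M_fun_le e0 (w := x%:C)).
Qed.

(** With [|M| <= k] on the circle and [r < 1], the squared norm is at most [2 pi k^2], and
    [2 pi <= (2 pi + 1)^2]. *)
Lemma L2norm_circle_M_fun :
  (L2norm_circle 'i%C r (M e) <= (K2 / s * (2 * pi + 1) * e)%:E)%E.
Proof.
have pi0 := pi_gt0 R.
pose k := K2 / s * e; have k0 : 0 <= k by rewrite mulr_ge0 ?divr_ge0// ltW.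
have -> : K2 / s * (2 * pi + 1) * e = k * (2 * pi + 1) by rewrite /k; ring.
have pi1 : 0 <= 2 * pi + 1 :> R by rewrite addr_ge0// mulr_ge0// ltW.
apply/L2norm_circle_le; [exact: ltW|exact: mulr_ge0|].
have ch t : {for t, continuous (fun t => normc (M e ('i%C + r%:C * expi t)))}.
  apply: ccont_normc; apply: ccont_circle0 => // w w0.
  exact: cdifferentiable_M_fun.
have mh : measurable_fun [set: measurableTypeR R]
    (fun t => normc (M e ('i%C + r%:C * expi t)) ^+ 2 * r).
  apply: measurable_funM; last exact: measurable_cst.
  by apply: measurable_funX; exact: continuous_measurable_fun.
apply: (@le_trans _ _ (\int[mu]_(t in `[0%R, (2 * pi)%R]) (k ^+ 2)%:E)%E).
  apply: ge0_le_integral => //.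
  - by move=> t _; rewrite lee_fin mulr_ge0 ?sqr_ge0// ltW.
  - by apply/measurable_EFinP; exact: measurable_funTS.
  - move=> t _; rewrite lee_fin -[leRHS]mulr1; apply: ler_pM.
    + exact: sqr_ge0.
    + exact: ltW.
    + rewrite ler_sqr ?nnegrE ?normc_ge0//; apply: M_fun_circle_le => //.
        exact/ltW/Im_circle.
      have -> : 'i%C + r%:C * expi t - 'i%C = r%:C * expi t by ring.
      by rewrite normcM normc_expi mulr1 normc_real gtr0_norm.
    + exact: ltW.
rewrite integral_cst//= lebesgue_measure_itv /= lte_fin mulr_gt0//.
rewrite -EFinD -EFinM lee_fin subr0 [leRHS]exprMn.
apply: ler_wpM2l; first exact: sqr_ge0.
by have := sqr_ge0 (pi : R); lra.
Qed.

End membership.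

Lemma extremal_bounds : exists c1 c2 c3 c4 eps0 : R,
  [/\ 0 < c1, 0 < c2, 0 < c3, 0 < c4 & 0 < eps0] /\
  forall eps : R, 0 < eps -> eps < eps0 ->
    [/\ hardy2 (M eps),
        (hardy2_norm (M eps) <= c1%:E)%E,
        (L2norm_circle 'i%C r (M eps) <= (c2 * eps)%:E)%E,
        c3 * eps `^ gamma r z <= normc (M eps z) &
        normc (M eps z) <= c4 * eps `^ gamma r z].
Proof.
have pi0 := pi_gt0 R.
have nz : 0 < normc (z + z0 r) by rewrite normc_gt0 add_z0_neq0// ltW.
(* [eps0 = 1] comes from the lower bound at [z], where [exists_scale] asks for [e < 1]. *)
exists (K1 * (pi / s ^+ 2 + 1)), (K2 / s * (2 * pi + 1)),
  (q ^+ 2 / 2 / normc (z + z0 r)), (K3 / normc (z + z0 r)), 1.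
split.
  split => //.
  - by rewrite mulr_gt0// ltr_wpDl// divr_ge0 ?sqr_ge0// ltW.
  - by rewrite mulr_gt0 ?divr_gt0//; lra.
  - by rewrite !divr_gt0// exprn_gt0.
  - by rewrite divr_gt0.
move=> e e0 e1; split.
- exact: hardy2_M_fun.
- exact: hardy2_norm_M_fun.
- exact: L2norm_circle_M_fun.
- exact: M_fun_point_ge.
- exact: M_fun_point_le.
Qed.

End extremal_function.

Unset Implicit Arguments.

Theorem theorem2p4 (R : realType) (r : R) (z : R[i])
    (hr0 : 0 < r) (hr1 : r < 1)
    (hz : upper_half_plane z) (hzr : r < normc (z - 'i%C)) :
  (exists2 C : R, 0 < C &
     forall (eps : R) (f : R[i] -> R[i]), 0 < eps ->
       hardy2 f -> (hardy2_norm f <= 1%:E)%E ->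
       (L2norm_circle 'i%C r f <= eps%:E)%E ->
       normc (f z) <= C * eps `^ gamma r z)
  /\ (forall (eps : R) (w : R[i]), 0 < eps -> upper_half_plane w ->
        cvgn (M_partial_sum r z eps w))
  /\ (exists c1 c2 c3 c4 eps0 : R,
        [/\ 0 < c1, 0 < c2, 0 < c3, 0 < c4 & 0 < eps0] /\
        forall eps : R, 0 < eps -> eps < eps0 ->
          [/\ hardy2 (M_fun r z eps),
              (hardy2_norm (M_fun r z eps) <= c1%:E)%E,
              (L2norm_circle 'i%C r (M_fun r z eps) <= (c2 * eps)%:E)%E,
              c3 * eps `^ gamma r z <= normc (M_fun r z eps z) &
              normc (M_fun r z eps z) <= c4 * eps `^ gamma r z]).
Proof.
split; first exact: upper_bound.
split; last exact: extremal_bounds.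
by move=> e w e0 w0; exact: (M_fun_cvg hr0 hr1 hz hzr e0 (ltW w0)).
Qed.
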